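(* Suppose that the demand density $\psi$ is softly unimodal and has bounded support in $[0,\infty)$. Then the inventory cost $\mathcal{C}_n(\pi^*_n)$ that is realized over $n$ periods under the mean-optimal policy $\pi^*_n$ satisfies $$ \frac{\mathcal{C}_n(\pi^*_n) - \mathbb{E}[\mathcal{C}_n(\pi^*_n)]}{\sqrt{\operatorname{Var}[\mathcal{C}_n(\pi^*_n)]}} \Longrightarrow N(0,1) \quad \text{as } n \rightarrow \infty, $$ where $\Longrightarrow$ denotes convergence in distribution and $N(0,1)$ is the standard normal distribution.
   Context: Notation: for integers $a \le b$, $[a:b]=\{a,a+1,\ldots,b\}$ and $[a:b)=\{a,\ldots,b-1\}$. Model (Bulinskaya's inventory model with delivery delays). There are $n$ periods. The demands $D_1,D_2,\ldots$ are independent random variables with common density $\psi$ supported on a bounded subinterval of $[0,\infty)$ ($\psi$ is zero outside it). The variables $Y_1,Y_2,\ldots$ are independent Bernoulli variables with $\mathbb{P}(Y_i=1)=q$, where $q\in[0,1]$ is fixed, and they are independent of the demands; $Y_i=1$ means that the order of period $i$ is filled immediately, and otherwise it is filled at the beginning of the next period. The cost constants are $c>0$ (ordering cost rate), $c_h>0$ (holding cost rate), $c_p$ (backlog penalty rate), with $c<c_p$. The carrying-cost function is $L(z)=c_h z$ if $z\ge 0$ and $L(z)=-c_p z$ if $z<0$. A negative inventory level represents backlogged demand. Mean-optimal policy. Set $v_0\equiv 0$ and, for $k\ge 1$ and $x \in \mathbb{R}$, $$ v_k(x)=\min_{y\ge x}\Big\{c(y-x)+q\,\mathbb{E}[L(y-D_1)]+(1-q)\,\mathbb{E}[L(x-D_1)]+\mathbb{E}[v_{k-1}(y-D_1)]\Big\}.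 $$ For $i\in[1:n]$ let $\gamma_{n,i}(x)$ be the value of $y\geq x$ attaining the minimum for $k=n-i+1$ (the minimizer is unique by Bulinskaya; should there be ties, take the smallest minimizer). The policy $\pi_n^*$ places in period $i$, when the inventory at the beginning of the period is $x$, an order of size $\gamma_{n,i}(x)-x$; it minimizes the expected total cost over all feasible policies. Let $n_0=\inf\{j\in\{0,1,2,\ldots\}: c<c_p(q+j+1)\}$. Bulinskaya showed that there are levels $0<s_{n_0+2}\le s_{n_0+3}\le\cdots$, with finite limit $s_\infty$, such that $\gamma_{n,i}(x)=\max\{x,s_{n-i+1}\}$ for $i\in[1:n-n_0)$. Inventory process and cost. The inventory at the beginning of period $1$ is a fixed value $X_{n,1}=x\in[0,s_\infty]$ and $X_{n,i+1}=\gamma_{n,i}(X_{n,i})-D_i$ for $i\in[1:n]$. The one-period cost is $$ \mathcal{P}_{n,i}=c(\gamma_{n,i}(X_{n,i})-X_{n,i})+Y_iL(\gamma_{n,i}(X_{n,i})-D_i)+(1-Y_i)L(X_{n,i}-D_i), $$ and the total realized cost is $\mathcal{C}_n(\pi_n^* )=\sum_{i=1}^n\mathcal{P}_{n,i}$. Soft unimodality. The density $\psi$ is softly unimodal if for each $\epsilon\ge 0$ there is $\widehat{w}=\widehat{w}(\epsilon)\in[-\infty,\infty)$ such that $\psi(w+\epsilon)\le\psi(w)$ for all $w\geq \widehat{w}$ and $\psi(w+\epsilon)\geq\psi(w)$ for all $w<\widehat{w}$. *)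

(* Defs.v *)
From HB Require Import structures.
From mathcomp Require Import all_boot all_order all_algebra.
From mathcomp Require Import all_classical all_reals all_analysis.

Set Implicit Arguments.
Unset Strict Implicit.
Unset Printing Implicit Defensive.

Import Order.TTheory GRing.Theory Num.Theory.
Import numFieldNormedType.Exports.

Local Open Scope classical_set_scope.
Local Open Scope ring_scope.

Section Probability.
Context {d : measure_display} {T : measurableType d} {R : realType}.
Variable P : probability T R.

Definition mutually_independent {I : choiceType} (X : I -> T -> R) : Prop :=
  forall (J : seq I) (B : I -> set R),
    uniq J -> (forall i, measurable (B i)) ->
    P (\bigcap_(i in [set` J]) (X i @^-1` B i)) =
    (\prod_(i <- J) P (X i @^-1` B i))%E.

Definition is_density (f : R -> R) : Prop :=
  measurable_fun [set: R] f /\ forall z, 0 <= f z.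

Definition has_density (X : {RV P >-> R}) (f : R -> R) : Prop :=
  is_density f /\
  forall B : set R, measurable B ->
    distribution P X B = (\int[lebesgue_measure]_(z in B) (f z)%:E)%E.

(* Pointwise convergence of the distribution functions at every continuity
   point of the distribution function of [mu]. *)
Definition cvg_in_distribution (X : nat -> T -> R) (mu : set R -> \bar R) :
    Prop :=
  forall t : R, {for t, continuous (fun r : R => mu `]-oo, r]%classic)} ->
    P (X n @^-1` `]-oo, t]%classic) @[n --> \oo] --> mu `]-oo, t]%classic.

Definition standardized (Z : T -> R) : T -> R :=
  fun w => (Z w - fine 'E_P[Z]) / Num.sqrt (fine 'V_P[Z]).

End Probability.

Section Density.
Context {R : realType}.

Definition bounded_support_ge0 (f : R -> R) : Prop :=
  exists a b : R, 0 <= a /\ forall z, ~ (a <= z <= b) -> f z = 0.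

(* The threshold lies in [-oo, +oo), hence the extended real [w]. *)
Definition softly_unimodal (f : R -> R) : Prop :=
  forall eps : R, 0 <= eps ->
    exists w : \bar R, [/\ (w < +oo)%E,
      forall z : R, (w <= z%:E)%E -> f (z + eps) <= f z &
      forall z : R, (z%:E < w)%E -> f z <= f (z + eps)].

End Density.

Section Inventory.
Context {d : measure_display} {T : measurableType d} {R : realType}.
Variable P : probability T R.
(* [D i] and [Y i] are the demand and the delivery indicator of the period
   numbered [i.+1] when the periods of the horizon are numbered from 1. *)
Variables (D : nat -> T -> R) (Y : nat -> T -> bool).
Variables (c ch cp q : R).

Definition carrying_cost (z : R) : R := if 0 <= z then ch * z else - cp * z.

Local Notation L := carrying_cost.

Definition order_objective (v : R -> R) (x y : R) : R :=
  c * (y - x) + q * fine 'E_P[fun w => L (y - D 0 w)]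
  + (1 - q) * fine 'E_P[fun w => L (x - D 0 w)]
  + fine 'E_P[fun w => v (y - D 0 w)].

Fixpoint value (k : nat) : R -> R :=
  if k is k'.+1 then
    fun x => inf [set order_objective (value k') x y | y in [set y | x <= y]]
  else fun=> 0.

Definition minimizers (k : nat) (x : R) : set R :=
  [set y | x <= y /\
    forall z, x <= z -> order_objective (value k.-1) x y
                        <= order_objective (value k.-1) x z].

(* [k >= 1] is the number of periods to go, the current one included. *)
Definition order_up_to (k : nat) (x : R) : R :=
  xget x [set y | minimizers k x y /\ forall z, minimizers k x z -> y <= z].

(* The only real [s] such that [order_up_to k] is [x |-> max x s]. When
   [0 < c < cp] and [0 <= q], it exists for all [k >= 2]; it may fail to exist
   for [k = 1], and the value then chosen does not affect [limit_level]. *)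
Definition base_stock_level (k : nat) : R :=
  xget 0 [set s | forall x, order_up_to k x = Num.max x s].

Definition limit_level : R := limn base_stock_level.

Variable x0 : R.

(* With [i] counted from 0, there are [n - i] periods to go at period [i]. *)
Fixpoint inventory (n i : nat) (w : T) : R :=
  if i is j.+1 then
    order_up_to (n - j) (inventory n j w) - D j w
  else x0.

Definition period_cost (n i : nat) (w : T) : R :=
  let x := inventory n i w in
  let y := order_up_to (n - i) x in
  c * (y - x) + (Y i w)%:R * L (y - D i w)
  + (1 - (Y i w)%:R) * L (x - D i w).

Definition total_cost (n : nat) (w : T) : R :=
  \sum_(i < n) period_cost n i w.

End Inventory.

(* Main.v *)
Require Import Defs.
From HB Require Import structures.
From mathcomp Require Import all_boot all_order all_algebra.
From mathcomp Require Import all_classical all_reals all_analysis.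
From mathcomp Require Import measurable_realfun.
From mathcomp Require Import ring lra zify.

(** Up to null sets the demands lie in an interval [[0, b]], and every random quantity
    below is bounded.

    _The policy._ Write [l y] for the mean carrying cost of a period in which the stock
    after the deliveries is [y], [l2 y] for the mean of [l (y - D)], and
    [J = q l + (1 - q) l2]. The holding cost of the level [y] after an order falls due in
    this period with probability [q] and in the next one otherwise, so that, once these
    costs are attributed to the period of the order, the objective with [k + 1 >= 2]
    periods to go becomes [J y + E V (y - D)] plus a constant, where the cost to go [V] is
    nondecreasing and convex. Hence the optimal level [S k] lies below the least
    minimizer [s] of [J] ([base_stock_level_le]). Comparing the level [S k] with [s]
    turns the recursion into a telescoping inequality ([excess_step]), and
    [sum (J (S k) - J s)] is finite ([stage_cost_gap_summable]). In particular [S k]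
    tends to [s], and [s] is the limit level.

    _Decomposition of the cost._ The order volumes telescope. What is left of the cost
    of a period is its innovation, a function of the stock before and after the order,
    of the demand and of the delivery, with mean zero given the past, plus [J] at the
    level after the order, whose excess over [J s] is summable ([process_costE],
    [remainder_bounded]). Far from the end of the horizon the stock is raised to almost
    [s] in every period; replacing it by [s] turns the innovations into functions
    [base_innovation] of the demands of two consecutive periods and of one delivery.
    The replacement errors are orthogonal and small on average, so their sum is
    [o (sqrt n)] in mean square ([process_cost_approximation]).

    _Normal limit._ The base innovations are uniformly bounded, orthogonal, and
    independent unless adjacent. Stein's method gives a central limit theorem for such
    sums ([stein_local_bound], [base_sum_ramp]) provided that the variance grows
    linearly. It does: the variance of a base innovation is at least that of its
    conditional mean given the demand of its period, which is [A D] up to a constant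
    for the convex function [A = demand_effect]. Shifting the demand by [t] raises the
    mean of [A] by at least [c t], because [s] minimizes [J] and [l2] does not increase
    when approaching [s] from the left. If [A D] were almost surely constant, convexity
    would keep [A] below this constant on the whole range of [D], and as the law of [D]
    has no atoms a shift by [t] could only raise the mean of [A] by [o (t)]
    ([convex_variance_gt0]).

    Finally the perturbation of size [o (sqrt n)] disappears after normalization
    ([normalization_close]), and averages of Lipschitz ramps determine the limit of the
    distribution functions ([cvg_in_distribution_ramp]). *)

Set Implicit Arguments.
Unset Strict Implicit.
Unset Printing Implicit Defensive.

Import Order.TTheory GRing.Theory Num.Theory.
Import numFieldNormedType.Exports.

Local Open Scope classical_set_scope.
Local Open Scope ring_scope.

(** * Bounded random variables and their expectations *)

Section BoundedRandomVariables.
Context {d : measure_display} {T : measurableType d} {R : realType}.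

Definition bounded_rv (f : T -> R) : Prop :=
  measurable_fun [set: T] f /\ exists K : R, forall w, `|f w| <= K.

Lemma bounded_rv_cst k : bounded_rv (fun=> k).
Proof. by split=> //; exists `|k|. Qed.

Lemma bounded_rvD f g :
  bounded_rv f -> bounded_rv g -> bounded_rv (fun w => f w + g w).
Proof.
move=> [mf [K fK]] [mg [K' gK]]; split; first exact: measurable_funD.
by exists (K + K') => w; rewrite (le_trans (ler_normD _ _))// lerD.
Qed.

Lemma bounded_rvM f g :
  bounded_rv f -> bounded_rv g -> bounded_rv (fun w => f w * g w).
Proof.
move=> [mf [K fK]] [mg [K' gK]]; split; first exact: measurable_funM.
by exists (K * K') => w; rewrite normrM ler_pM.
Qed.

Lemma bounded_rvZ k f : bounded_rv f -> bounded_rv (fun w => k * f w).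
Proof. by move=> bf; apply: bounded_rvM => //; exact: bounded_rv_cst. Qed.

Lemma bounded_rvN f : bounded_rv f -> bounded_rv (fun w => - f w).
Proof.
move=> [mf [K fK]]; split; first exact: measurable_funN.
by exists K => w; rewrite normrN.
Qed.

Lemma bounded_rvB f g :
  bounded_rv f -> bounded_rv g -> bounded_rv (fun w => f w - g w).
Proof. by move=> bf bg; apply: bounded_rvD => //; exact: bounded_rvN. Qed.

Lemma bounded_rv_sum (I : Type) (r : seq I) (p : pred I) (f : I -> T -> R) :
  (forall i, p i -> bounded_rv (f i)) ->
  bounded_rv (fun w => \sum_(i <- r | p i) f i w).
Proof.
move=> bf; elim: r => [|i r IHr].
  by under eq_fun do rewrite big_nil; exact: bounded_rv_cst.
under eq_fun do rewrite big_cons; case: (boolP (p i)) => // pi.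
by apply: bounded_rvD => //; exact: bf.
Qed.

Lemma bounded_rv_norm f : bounded_rv f -> bounded_rv (fun w => `|f w|).
Proof.
move=> [mf [K fK]]; split; first exact: measurableT_comp.
by exists K => w; rewrite normr_id.
Qed.

Variable P : probability T R.

Lemma bounded_rv_integrable f :
  bounded_rv f -> P.-integrable [set: T] (EFin \o f).
Proof.
move=> [mf [K fK]].
apply: measurable_bounded_integrable => //.
  by rewrite (le_lt_trans (probability_le1 P measurableT))// ltry.
exists K; split; first exact: num_real.
by move=> x Kx w _; apply: le_trans (ltW Kx); exact: fK.
Qed.

Lemma eq_mean f g : (forall w, f w = g w) -> \int[P]_w f w = \int[P]_w g w.
Proof. by move=> fg; apply: eq_Rintegral => w _; exact: fg. Qed.

Lemma mean_cst k : \int[P]_w k = k.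
Proof. by rewrite Rintegral_cst//= probability_setT/= mulr1. Qed.

Lemma meanD f g : bounded_rv f -> bounded_rv g ->
  \int[P]_w (f w + g w) = \int[P]_w f w + \int[P]_w g w.
Proof. by move=> bf bg; rewrite RintegralD//; exact: bounded_rv_integrable. Qed.

Lemma meanB f g : bounded_rv f -> bounded_rv g ->
  \int[P]_w (f w - g w) = \int[P]_w f w - \int[P]_w g w.
Proof. by move=> bf bg; rewrite RintegralB//; exact: bounded_rv_integrable. Qed.

Lemma meanZ k f : bounded_rv f -> \int[P]_w (k * f w) = k * \int[P]_w f w.
Proof. by move=> bf; rewrite RintegralZl//; exact: bounded_rv_integrable. Qed.

Lemma mean_sum (I : Type) (r : seq I) (p : pred I) (f : I -> T -> R) :
  (forall i, p i -> bounded_rv (f i)) ->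
  \int[P]_w (\sum_(i <- r | p i) f i w) = \sum_(i <- r | p i) \int[P]_w f i w.
Proof.
move=> bf; elim: r => [|i r IHr].
  by under eq_Rintegral do rewrite big_nil; rewrite big_nil mean_cst.
rewrite big_cons; under eq_Rintegral do rewrite big_cons.
case: (boolP (p i)) => // pi; rewrite meanD ?IHr//; first exact: bf.
exact: bounded_rv_sum.
Qed.

Lemma le_mean f g : bounded_rv f -> bounded_rv g ->
  (forall w, f w <= g w) -> \int[P]_w f w <= \int[P]_w g w.
Proof.
by move=> bf bg fg; apply: le_Rintegral => //; exact: bounded_rv_integrable.
Qed.

Lemma mean_ge0 f : (forall w, 0 <= f w) -> 0 <= \int[P]_w f w.
Proof. by move=> f0; exact: Rintegral_ge0. Qed.

Lemma norm_mean_le f k : bounded_rv f -> (forall w, `|f w| <= k) ->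
  `|\int[P]_w f w| <= k.
Proof.
move=> bf fk.
apply: le_trans (le_normr_Rintegral measurableT (bounded_rv_integrable bf)) _.
rewrite -[leRHS](mean_cst k); apply: le_mean => //.
- exact: bounded_rv_norm.
- exact: bounded_rv_cst.
Qed.

(** Expanding [E (z f - y g)^2 >= 0] at [y = E f g], [z = E g^2]. *)
Lemma mean_Cauchy_Schwarz f g : bounded_rv f -> bounded_rv g ->
  (\int[P]_w (f w * g w)) ^+ 2
    <= \int[P]_w (f w ^+ 2) * \int[P]_w (g w ^+ 2).
Proof.
move=> bf bg.
have b2 h : bounded_rv h -> bounded_rv (fun w => h w ^+ 2).
  by move=> bh; apply: bounded_rvM.
set A := \int[P]_w (f w ^+ 2); set B := \int[P]_w (g w ^+ 2).
set C := \int[P]_w (f w * g w).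
have key (y z : R) : 0 <= z ^+ 2 * A - 2 * y * z * C + y ^+ 2 * B.
  have -> : z ^+ 2 * A - 2 * y * z * C + y ^+ 2 * B =
      \int[P]_w ((z * f w - y * g w) ^+ 2).
    rewrite [RHS](eq_mean (g := fun w => z ^+ 2 * f w ^+ 2
        - 2 * y * z * (f w * g w) + y ^+ 2 * g w ^+ 2)); last by move=> w; ring.
    rewrite meanD; last 2 first.
    - apply: bounded_rvB; apply: bounded_rvZ; first exact: b2.
      exact: bounded_rvM.
    - by apply: bounded_rvZ; exact: b2.
    rewrite meanB; last 2 first.
    - by apply: bounded_rvZ; exact: b2.
    - by apply: bounded_rvZ; exact: bounded_rvM.
    by rewrite !meanZ//; [exact: b2|exact: bounded_rvM|exact: b2].
  by apply: mean_ge0 => w; exact: sqr_ge0.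
have A0 : 0 <= A by apply: mean_ge0 => w; exact: sqr_ge0.
have B0 : 0 <= B by apply: mean_ge0 => w; exact: sqr_ge0.
have [B00|Bn0] := eqVneq B 0.
  have [->|C0] := eqVneq C 0; first by rewrite B00 expr0n mulr0.
  have := key ((A + 1) / (2 * C)) 1; rewrite B00.
  have -> : 1 ^+ 2 * A - 2 * ((A + 1) / (2 * C)) * 1 * C
      + ((A + 1) / (2 * C)) ^+ 2 * 0 = - 1 :> R by field.
  by rewrite lerNr oppr0 ler10.
have Bgt0 : 0 < B by rewrite lt_def Bn0.
have := key C B.
have -> : B ^+ 2 * A - 2 * C * B * C + C ^+ 2 * B = B * (A * B - C ^+ 2) by ring.
by rewrite pmulr_rge0// subr_ge0.
Qed.

End BoundedRandomVariables.

(** * Lipschitz and convex functions on the line, and their least minimizers *)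

Section RealFunctions.
Context {R : realType}.
Implicit Types f g : R -> R.

Definition lip f : Prop :=
  exists2 K, 0 <= K & forall x y, `|f x - f y| <= K * `|x - y|.

Lemma lip_cst k : lip (fun=> k).
Proof. by exists 0 => // x y; rewrite subrr normr0 mul0r. Qed.

Lemma lipD f g : lip f -> lip g -> lip (fun y => f y + g y).
Proof.
move=> [K K0 fK] [K' K'0 gK]; exists (K + K') => [|x y]; first exact: addr_ge0.
rewrite mulrDl opprD addrACA (le_trans (ler_normD _ _))//.
by apply: lerD; [exact: fK|exact: gK].
Qed.

Lemma lipZ k f : lip f -> lip (fun y => k * f y).
Proof.
move=> [K K0 fK]; exists (`|k| * K) => [|x y]; first exact: mulr_ge0.
by rewrite -mulrBr normrM -mulrA ler_wpM2l.
Qed.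

Lemma lip_scale k : lip (fun y => k * y).
Proof. by exists `|k| => // x y; rewrite -mulrBr normrM. Qed.

Lemma lip_flip f a : lip f -> lip (fun z => f (a - z)).
Proof.
move=> [K K0 fK]; exists K => // x y; apply: le_trans (fK _ _) _.
by rewrite (_ : a - x - (a - y) = y - x) 1?distrC//; ring.
Qed.

Lemma lip_max f s : lip f -> lip (fun y => f (Num.max y s)).
Proof.
move=> [K K0 fK]; exists K => // x y; apply: le_trans (fK _ _) _.
apply: ler_wpM2l => //.
case: (leP x s) => xs; case: (leP y s) => ys; rewrite ?subrr ?normr0//.
- by rewrite !ler0_norm; lra.
- by rewrite !ger0_norm; lra.
Qed.

Lemma lip_bounded_increment f : lip f ->
  exists2 K, 0 <= K & forall y z, f y - K * `|z| <= f (y - z) <= f y + K * `|z|.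
Proof.
move=> [K K0 fK]; exists K => // y z.
have := fK (y - z) y; rewrite addrAC subrr add0r normrN.
by rewrite ler_norml => /andP[]; lra.
Qed.

Lemma lip_continuous f : lip f -> continuous f.
Proof.
move=> [K K0 fK] x; apply/cvgrPdist_le => /= e e0.
have K1 : 0 < K + 1 by lra.
have eK : 0 < e / (K + 1) by rewrite divr_gt0.
near=> y; apply: le_trans (fK _ _) _.
have : `|x - y| < e / (K + 1).
  by near: y; apply: (@cvgr_dist_lt _ _ _ (nbhs x) _ id).
move=> /ltW xy; apply: le_trans (_ : (K + 1) * (e / (K + 1)) <= _); last first.
  by rewrite mulrC divfK// gt_eqF.
by apply: ler_pM => //; lra.
Unshelve. all: by end_near. Qed.

Lemma continuous_bounded (g : R -> R) (A : R) : continuous g ->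
  exists K, forall x, - A <= x <= A -> `|g x| <= K.
Proof.
move=> cg; have [A0|A0] := leP (- A) A; last first.
  by exists 0 => x /andP[h1 h2]; lra.
have cng : {within `[- A, A], continuous (fun x => `|g x|)}.
  apply: continuous_subspaceT => x.
  by apply: (@continuous_comp _ _ _ g); [exact: cg|exact: norm_continuous].
have [c _ gc] := EVT_max A0 cng.
by exists `|g c| => x xA; apply: gc; rewrite in_itv.
Qed.

Lemma lip_measurable f : lip f -> measurable_fun [set: R] f.
Proof. by move=> /lip_continuous; exact: continuous_measurable_fun. Qed.

(** The chord inequality multiplied by [z - x], which keeps it free of divisions. *)
Definition convex f : Prop := forall x y z, x <= y <= z ->
  (z - x) * f y <= (z - y) * f x + (y - x) * f z.

Lemma convexD f g : convex f -> convex g -> convex (fun y => f y + g y).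
Proof.
by move=> cf cg x y z xyz; have := cf _ _ _ xyz; have := cg _ _ _ xyz; lra.
Qed.

Lemma convexZ k f : 0 <= k -> convex f -> convex (fun y => k * f y).
Proof.
move=> k0 cf x y z xyz.
rewrite mulrCA [X in _ <= X + _]mulrCA [X in _ <= _ + X]mulrCA -mulrDr.
by rewrite ler_wpM2l// cf.
Qed.

Lemma convex_scale k : convex (fun y => k * y).
Proof. by move=> x y z _; lra. Qed.

Lemma convex_cst k : convex (fun=> k).
Proof. by move=> x y z _; lra. Qed.

Lemma convex_opp_shift f a : convex f -> convex (fun y => f (a - y)).
Proof.
move=> cf x y z /andP[xy yz]; have := cf (a - z) (a - y) (a - x).
rewrite !lerD2l !lerN2 xy yz => /(_ isT).
have -> : a - x - (a - z) = z - x by ring.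
have -> : a - x - (a - y) = y - x by ring.
have -> : a - y - (a - z) = z - y by ring.
lra.
Qed.

(** The increments of a convex function over steps of a fixed length are
    nondecreasing: apply the three-point inequality at both inner points. *)
Lemma convex_increment f x y h : convex f -> x <= y -> 0 <= h ->
  f (x + h) - f x <= f (y + h) - f y.
Proof.
move=> cf xy h0; have [->//|xny] := eqVneq x y.
have xyl : x < y by rewrite lt_neqAle xny.
have := cf x (x + h) (y + h); have := cf x y (y + h).
rewrite !lerDl h0 xy lerD2r xy => /(_ isT) + /(_ isT).
have -> : y + h - (x + h) = y - x by ring.
have -> : x + h - x = h by ring.
have -> : y + h - y = h by ring.
move=> h1 h2; rewrite -subr_ge0 -(pmulr_rge0 _ (_ : 0 < y + h - x)); last lra.
lra.
Qed.

Definition least_min f s : Prop :=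
  (forall y, f s <= f y) /\ (forall y, y < s -> f s < f y).

Lemma convex_ge_min f s y z : convex f -> (forall y, f s <= f y) ->
  s <= y <= z -> f y <= f z.
Proof.
move=> cf ms /andP[sy yz]; have [<-//|sny] := eqVneq s y.
have syl : s < y by rewrite lt_neqAle sny.
have := cf s y z; rewrite sy yz => /(_ isT).
have : (z - y) * f s <= (z - y) * f y by rewrite ler_wpM2l ?subr_ge0.
move=> h1 h2; rewrite -subr_ge0 -(pmulr_rge0 _ (_ : 0 < y - s)); last lra.
lra.
Qed.

Lemma convex_le_min f s y z : convex f -> (forall y, f s <= f y) ->
  y <= z <= s -> f z <= f y.
Proof.
move=> cf ms /andP[yz zs]; have [->//|sny] := eqVneq z s.
have syl : z < s by rewrite lt_neqAle sny.
have := cf y z s; rewrite zs yz => /(_ isT).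
have : (z - y) * f s <= (z - y) * f z by rewrite ler_wpM2l ?subr_ge0.
move=> h1 h2; rewrite -subr_ge0 -(pmulr_rge0 _ (_ : 0 < s - z)); last lra.
lra.
Qed.

(** Flattening a convex function on the left of its minimizer [s] keeps it convex:
    this is how ordering up to [s] acts on the cost to go. *)
Lemma convex_max f s : convex f -> (forall y, f s <= f y) ->
  convex (fun y => f (Num.max y s)).
Proof.
move=> cf ms x y z /andP[xy yz].
have [ys|sy] := leP y s.
  have h1 := ms (Num.max x s); have h2 := ms (Num.max z s).
  have : (z - y) * f s <= (z - y) * f (Num.max x s).
    by rewrite ler_wpM2l ?subr_ge0.
  have : (y - x) * f s <= (y - x) * f (Num.max z s).
    by rewrite ler_wpM2l ?subr_ge0.
  lra.
rewrite (@max_l _ _ z s); last lra.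
have [xs|sx] := leP x s; last by apply: cf; rewrite xy.
have := cf s y z; rewrite yz ltW// => /(_ isT).
have : f y <= f z by apply: (convex_ge_min cf ms); rewrite ltW.
move=> fyz; have : (s - x) * f y <= (s - x) * f z.
  by rewrite ler_wpM2l ?subr_ge0.
lra.
Qed.

Lemma max_nondecreasing f s : convex f -> (forall y, f s <= f y) ->
  forall x y, x <= y -> f (Num.max x s) <= f (Num.max y s).
Proof.
move=> cf ms x y xy; apply: (convex_ge_min cf ms).
by rewrite le_max lexx orbT ge_max !le_max xy lexx orbT.
Qed.

Definition coercive f : Prop :=
  exists k C, 0 < k /\ forall y, k * `|y| - C <= f y.

(** The minimizers form a set that is closed and, by coercivity, bounded below. *)
Lemma least_min_exists f : lip f -> coercive f -> exists s, least_min f s.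
Proof.
move=> lf [k [C [k0 fC]]].
pose B := (`|f 0| + `|C|) / k.
have B0 : 0 <= B by rewrite divr_ge0 ?addr_ge0// ltW.
have kB : k * B = `|f 0| + `|C| by rewrite mulrC divfK// gt_eqF.
have [||t tB ft] := @EVT_min R f (- B) B; first lra.
  exact/continuous_subspaceT/lip_continuous.
have tmin y : f t <= f y.
  have [yB|yB] := lerP `|y| B; first by apply: ft; rewrite in_itv/= -ler_norml.
  have f0 : f t <= f 0 by apply: ft; rewrite in_itv/= oppr_le0 B0.
  have := fC y; have : k * B < k * `|y| by rewrite ltr_pM2l.
  by rewrite kB; have := ler_norm (f 0); have := ler_norm C; lra.
pose S := [set y | f y <= f t].
have S0 : S !=set0 by exists t; rewrite /S/=.
have SB : has_lbound S.
  exists (- ((f t + C) / k)) => y; rewrite /S/= => fy.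
  rewrite lerNl ler_pdivlMr//.
  have := fC y; have : k * - y <= k * `|y|.
    by rewrite ler_pM2l// -normrN ler_norm.
  lra.
have iS : has_inf S by split.
have [K K0 fK] := lf.
have fS : f (inf S) <= f t.
  apply/ler_addgt0Pr => e e0; have K1 : 0 < K + 1 by lra.
  have eK : 0 < e / (K + 1) by rewrite divr_gt0.
  have [y Sy yi] := inf_adherent eK iS.
  have iy : inf S <= y by exact: ge_inf.
  have := fK (inf S) y; rewrite ler_norml => /andP[_ h].
  have : K * `|inf S - y| <= (K + 1) * (e / (K + 1)).
    by apply: ler_pM => //; rewrite ?lerDl// ler0_norm; lra.
  rewrite [in X in _ <= X -> _]mulrC divfK ?gt_eqF//.
  by have : f y <= f t := Sy; lra.
exists (inf S); split=> [y|y yS]; first exact: le_trans fS (tmin y).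
rewrite ltNge; apply/negP => fy; move: yS; rewrite ltNge => /negP; apply.
by apply: ge_inf => //; exact: le_trans fy fS.
Qed.

End RealFunctions.

Lemma bounded_rv_comp d (T : measurableType d) (R : realType) (f : T -> R)
  (g : R -> R) : lip g -> bounded_rv f -> bounded_rv (fun w => g (f w)).
Proof.
move=> lg [mf [K fK]]; split.
  by apply: measurableT_comp => //; exact: lip_measurable.
have [L L0 gL] := lg; exists (`|g 0| + L * K) => w.
have := gL (f w) 0; rewrite subr0 => h.
have : L * `|f w| <= L * K by rewrite ler_wpM2l.
have -> : g (f w) = g 0 + (g (f w) - g 0) by ring.
by move=> h2; apply: le_trans (ler_normD _ _) _; lra.
Qed.

(** * The dynamic program and its base-stock levels *)

Section DemandAverage.
Context {d : measure_display} {T : measurableType d} {R : realType}.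
Variables (P : probability T R) (X : T -> R) (b : R).
Hypothesis mX : measurable_fun [set: T] X.
Hypothesis X0b : forall w, 0 <= X w <= b.

Definition after_demand (f : R -> R) (y : R) : R := \int[P]_w f (y - X w).

Local Notation m := after_demand.

Lemma bounded_demand : bounded_rv X.
Proof.
by split=> //; exists b => w; have /andP[X0 Xb] := X0b w; rewrite ger0_norm.
Qed.

Lemma after_demand_rv f y : lip f -> bounded_rv (fun w => f (y - X w)).
Proof.
move=> lf; split.
  apply: measurableT_comp; first exact: lip_measurable.
  exact: measurable_funB.
have [K K0 fK] := lip_bounded_increment lf; exists (`|f y| + K * b) => w.
have /andP[X0 Xb] := X0b w; have := fK y (X w).
have : K * `|X w| <= K * b by rewrite ler_wpM2l// ger0_norm.
rewrite ler_norml; have := ler_norm (f y); have := ler_norm (- f y).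
by rewrite normrN; lra.
Qed.

Lemma after_demand_lip f : lip f -> lip (m f).
Proof.
move=> lf; have [K K0 fK] := lf; exists K => // x y.
rewrite -meanB; [|exact: after_demand_rv..].
apply: norm_mean_le => [|w]; first by apply: bounded_rvB; exact: after_demand_rv.
by apply: le_trans (fK _ _) _; rewrite opprB addrA subrK.
Qed.

Lemma after_demand_convex f : lip f -> convex f -> convex (m f).
Proof.
move=> lf cf x y z xyz.
rewrite -!meanZ; [|exact: after_demand_rv..].
rewrite -meanD; [|by apply: bounded_rvZ; exact: after_demand_rv..].
apply: le_mean => [||w]; first by apply: bounded_rvZ; exact: after_demand_rv.
  by apply: bounded_rvD; apply: bounded_rvZ; exact: after_demand_rv.
have := cf (x - X w) (y - X w) (z - X w); rewrite !lerD2r => /(_ xyz).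
have h u v : u - X w - (v - X w) = u - v by ring.
by rewrite !h.
Qed.

Lemma after_demandD f g y : lip f -> lip g ->
  m (fun y => f y + g y) y = m f y + m g y.
Proof. by move=> lf lg; rewrite /m meanD//; exact: after_demand_rv. Qed.

Lemma after_demandZ k f y : lip f -> m (fun y => k * f y) y = k * m f y.
Proof. by move=> lf; rewrite /m meanZ//; exact: after_demand_rv. Qed.

Lemma after_demand_cst k y : m (fun=> k) y = k.
Proof. exact: mean_cst. Qed.

Lemma after_demand_scale k y : m (fun y => k * y) y = k * (y - \int[P]_w X w).
Proof.
have by_ : bounded_rv (fun=> y : R) := @bounded_rv_cst _ T R y.
rewrite /m meanZ; first by rewrite meanB ?mean_cst//; exact: bounded_demand.
by apply: bounded_rvB => //; exact: bounded_demand.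
Qed.

Lemma le_after_demand f g y z : lip f -> lip g ->
  (forall u, 0 <= u <= b -> f (y - u) <= g (z - u)) -> m f y <= m g z.
Proof.
move=> lf lg fg; apply: le_mean; [exact: after_demand_rv..|] => w.
exact: fg (X0b w).
Qed.

Lemma after_demand_ge f y k : lip f ->
  (forall u, 0 <= u <= b -> k <= f (y - u)) -> k <= m f y.
Proof.
move=> lf kf; rewrite -[leLHS](after_demand_cst k y).
by apply: le_after_demand => //; exact: lip_cst.
Qed.

Lemma after_demand_le f y k : lip f ->
  (forall u, 0 <= u <= b -> f (y - u) <= k) -> m f y <= k.
Proof.
move=> lf kf; rewrite -[leRHS](after_demand_cst k y).
by apply: le_after_demand => //; exact: lip_cst.
Qed.

End DemandAverage.

Section CarryingCost.
Context {R : realType}.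
Variables (ch cp : R).
Hypotheses (ch0 : 0 < ch) (cp0 : 0 < cp).
Local Notation L := (carrying_cost ch cp).

Lemma carrying_cost_ge z : ch * z <= L z /\ - cp * z <= L z.
Proof.
rewrite /carrying_cost; case: (leP 0 z) => z0; split=> //.
  have : 0 <= (ch + cp) * z by rewrite mulr_ge0// addr_ge0// ltW.
  by rewrite mulrDl mulNr; lra.
have : (ch + cp) * z <= 0 by rewrite mulr_ge0_le0// ?addr_ge0// ltW.
by rewrite mulrDl mulNr; lra.
Qed.

Lemma carrying_cost_cases z : L z = ch * z \/ L z = - cp * z.
Proof. by rewrite /carrying_cost; case: ifP; [left|right]. Qed.

Lemma carrying_cost_lip : lip L.
Proof.
exists (ch + cp) => [|x y]; first by rewrite addr_ge0 ?ltW.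
have h u v : L u <= L v + (ch + cp) * `|u - v|.
  have [h1 h2] := carrying_cost_ge v.
  have := ler_wpM2l (ltW ch0) (ler_norm (u - v)).
  have := ler_wpM2l (ltW cp0) (ler_norm (- (u - v))); rewrite normrN.
  have := ler_wpM2l (ltW ch0) (normr_ge0 (u - v)).
  have := ler_wpM2l (ltW cp0) (normr_ge0 (u - v)).
  by case: (carrying_cost_cases u) => ->; lra.
have := h x y; have := h y x; rewrite ler_norml (distrC y x).
lra.
Qed.

Lemma carrying_cost_convex : convex L.
Proof.
move=> x y z /andP[xy yz].
have [h1 h2] := carrying_cost_ge x; have [h3 h4] := carrying_cost_ge z.
have a0 : 0 <= z - y by lra.
have b0 : 0 <= y - x by lra.
case: (carrying_cost_cases y) => ->.
  have := ler_wpM2l a0 h1; have := ler_wpM2l b0 h3; lra.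
have := ler_wpM2l a0 h2; have := ler_wpM2l b0 h4; lra.
Qed.

Lemma carrying_cost_increment_ge x y : x <= y -> - cp * (y - x) <= L y - L x.
Proof.
move=> xy; have [_ h] := carrying_cost_ge y.
rewrite [L x]/carrying_cost; case: (leP 0 x) => x0; last lra.
rewrite /carrying_cost (le_trans x0 xy).
have : 0 <= ch * (y - x) by rewrite mulr_ge0 ?subr_ge0// ltW.
have : 0 <= cp * (y - x) by rewrite mulr_ge0 ?subr_ge0// ltW.
lra.
Qed.

End CarryingCost.

(** The sum of the [u k] is paid for by the decrease of [v], which stays
    nonnegative. *)
Lemma telescoping_bound (R : realDomainType) (u v : nat -> R) :
  (forall k, 0 <= u k) -> (forall k, 0 <= v k) ->
  (forall k, v k.+1 + u k.+1 <= v k) ->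
  forall n, \sum_(k < n) u k <= u 0%N + v 0%N.
Proof.
move=> u0 v0 uv [|n]; first by rewrite big_ord0 addr_ge0.
suff: \sum_(k < n.+1) u k + v n <= u 0%N + v 0%N.
  by move=> /(le_trans _); apply; rewrite lerDl.
elim: n => [|n IHn]; first by rewrite big_ord1.
rewrite big_ord_recr/=; apply: le_trans IHn; rewrite -addrA lerD2l.
by rewrite addrC uv.
Qed.

Section DynamicProgram.
Context {d : measure_display} {T : measurableType d} {R : realType}.
Variables (P : probability T R) (X : T -> R) (b : R).
Hypothesis mX : measurable_fun [set: T] X.
Hypothesis X0b : forall w, 0 <= X w <= b.
Variables (D : nat -> T -> R) (c ch cp q : R).
Hypotheses (c0 : 0 < c) (ch0 : 0 < ch) (ccp : c < cp) (q01 : 0 <= q <= 1).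
Hypothesis mD : measurable_fun [set: T] (D 0).
Hypothesis DX : {ae P, forall w, D 0 w = X w}.

Local Notation L := (carrying_cost ch cp).
Local Notation m := (after_demand P X).
Local Notation mu := (\int[P]_w X w).
Local Notation obj := (order_objective P D c ch cp q).
Local Notation val := (value P D c ch cp q).
Local Notation up := (order_up_to P D c ch cp q).
Local Notation S := (base_stock_level P D c ch cp q).

Let cp0 : 0 < cp. Proof. exact: lt_trans ccp. Qed.
Let q0 : 0 <= q. Proof. by case/andP: q01. Qed.
Let p0 : 0 <= 1 - q. Proof. by rewrite subr_ge0; case/andP: q01. Qed.
Let b0 : 0 <= b.
Proof.
apply: (le_trans (normr_ge0 (\int[P]_w X w))).
apply: norm_mean_le (bounded_demand mX X0b) _ => w.
by have /andP[X0 Xb] := X0b w; rewrite ger0_norm.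
Qed.

Definition mean_cost : R -> R := m L.
(** A delayed order leaves its mark on the stock of the next period: a level [y]
    after the order costs [mean_cost y] in this period if the order is delivered at
    once, and [mean_cost2 y] in the next one otherwise. *)
Definition mean_cost2 : R -> R := m mean_cost.
Definition stage_cost (y : R) : R := q * mean_cost y + (1 - q) * mean_cost2 y.

Local Notation l := mean_cost.
Local Notation l2 := mean_cost2.
Local Notation J := stage_cost.

Let lipL : lip L. Proof. exact: carrying_cost_lip. Qed.
Lemma mean_cost_lip : lip l. Proof. exact: after_demand_lip mX X0b _ lipL. Qed.
Lemma mean_cost2_lip : lip l2.
Proof. exact: after_demand_lip mX X0b _ mean_cost_lip. Qed.
Lemma mean_cost_convex : convex l.
Proof. exact: after_demand_convex mX X0b _ lipL (carrying_cost_convex ch0 cp0). Qed.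
Lemma mean_cost2_convex : convex l2.
Proof. exact: after_demand_convex mX X0b _ mean_cost_lip mean_cost_convex. Qed.
Lemma stage_cost_lip : lip J.
Proof.
by apply: lipD; apply: lipZ; [exact: mean_cost_lip|exact: mean_cost2_lip].
Qed.
Lemma stage_cost_convex : convex J.
Proof.
by apply: convexD; apply: convexZ => //;
  [exact: mean_cost_convex|exact: mean_cost2_convex].
Qed.

Lemma expectation_after_demand f y : lip f ->
  fine 'E_P[fun w => f (y - D 0 w)] = m f y.
Proof.
move=> lf; rewrite unlock /after_demand /Rintegral; congr fine.
have mf := lip_measurable lf.
apply: ae_eq_integral => //.
- by apply/measurable_EFinP; apply: measurableT_comp => //; exact: measurable_funB.
- by apply/measurable_EFinP; apply: measurableT_comp => //; exact: measurable_funB.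
- by apply: filterS DX => w /= -> _.
Qed.

(** The part of the objective that depends on the level after the order. *)
Definition order_cost (k : nat) (y : R) : R := c * y + q * l y + m (val k) y.
Local Notation G := order_cost.

Lemma order_objectiveE k x y : lip (val k) ->
  obj (val k) x y = - c * x + (1 - q) * l x + G k y.
Proof.
move=> lv; rewrite /order_objective !expectation_after_demand//.
by rewrite -/l /order_cost; lra.
Qed.

(** If [G k] first decreases and then increases, a minimizer over [y >= x] is the
    least global minimizer, or [x] itself when [x] lies beyond it. *)
Lemma order_up_to_max k s : lip (val k) -> convex (G k) -> least_min (G k) s ->
  forall x, up k.+1 x = Num.max x s /\
    val k.+1 x = - c * x + (1 - q) * l x + G k (Num.max x s).
Proof.
move=> lv cG [ms ls] x.
have xM : x <= Num.max x s by rewrite le_max lexx.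
have Mmin z : x <= z -> G k (Num.max x s) <= G k z.
  move=> xz; have [xs|sx] := leP x s; first exact: ms.
  by apply: (convex_ge_min cG ms); rewrite (ltW sx).
split.
  apply: xget_unique => /= [|y [[xy my] ly]].
    split.
      split=> // z xz; rewrite !order_objectiveE// lerD2l; exact: Mmin.
    move=> z [xz mz]; rewrite ge_max xz/= leNgt; apply/negP => zs.
    have := mz (Num.max x s) xM; rewrite !order_objectiveE// lerD2l.
    have := ls _ zs; rewrite max_r ?(le_trans xz) ?(ltW zs)//; lra.
  apply/le_anti/andP; split.
    apply: ly; split=> // z xz; rewrite !order_objectiveE// lerD2l; exact: Mmin.
  rewrite ge_max xy leNgt; apply/negP => ys.
  have := my (Num.max x s) xM; rewrite !order_objectiveE// lerD2l.
  have := ls _ ys; rewrite max_r ?(le_trans xy) ?(ltW ys)//; lra.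
rewrite [LHS]/=; apply/le_anti/andP; split.
  apply: ge_inf; last by exists (Num.max x s) => //; rewrite order_objectiveE.
  exists (- c * x + (1 - q) * l x + G k (Num.max x s)) => _ /= [y xy <-].
  by rewrite order_objectiveE// lerD2l; exact: Mmin.
apply: lb_le_inf; first by exists (obj (val k) x x), x => /=.
by move=> _ /= [y xy <-]; rewrite order_objectiveE// lerD2l; exact: Mmin.
Qed.

Lemma order_up_to_id k : lip (val k) ->
  (forall y z, y <= z -> G k y <= G k z) ->
  forall x, up k.+1 x = x /\
    val k.+1 x = - c * x + (1 - q) * l x + G k x.
Proof.
move=> lv nG x; split.
  apply: xget_unique => /= [|y [[xy my] ly]].
    split; last by move=> z [].
    by split=> // z xz; rewrite !order_objectiveE// lerD2l; exact: nG.
  apply/le_anti; rewrite xy andbT; apply: ly; split=> // z xz.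
  by rewrite !order_objectiveE// lerD2l; exact: nG.
rewrite [LHS]/=; apply/le_anti/andP; split.
  apply: ge_inf; last by exists x => //=; rewrite order_objectiveE.
  exists (- c * x + (1 - q) * l x + G k x) => _ /= [y xy <-].
  by rewrite order_objectiveE// lerD2l; exact: nG.
apply: lb_le_inf; first by exists (obj (val k) x x), x => /=.
by move=> _ /= [y xy <-]; rewrite order_objectiveE// lerD2l; exact: nG.
Qed.

(** [V] is the cost to go without the terms that are fixed before the order. Its
    decrease towards [-oo] is slower than the growth of the backlog penalty, which
    makes [order_cost] coercive one period earlier. *)
Definition cost_tail (k : nat) (V : R -> R) : Prop :=
  [/\ lip V, convex V, (forall x y, x <= y -> V x <= V y),
      (exists a B, 0 <= B < cp /\ forall y, a + B * Num.min y 0 <= V y) &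
      forall x, val k x = - c * x + (1 - q) * l x + V x].

Lemma cost_tail_lip k V : cost_tail k V -> lip (val k).
Proof.
move=> [lV _ _ _ vE]; rewrite (funext vE).
apply: lipD => //; apply: lipD; first exact: lip_scale.
by apply: lipZ; exact: mean_cost_lip.
Qed.

(** The holding cost [(1 - q) * l] of the stock left to the next period is moved to
    the present period, where it completes [q * l] to the stage cost. *)
Lemma order_costE k V : cost_tail k V ->
  forall y, G k y = J y + c * mu + m V y.
Proof.
move=> [lV _ _ _ vE] y; rewrite /order_cost (funext vE).
have ll := mean_cost_lip.
rewrite (after_demandD P mX X0b)//; last first.
  by apply: lipD; [exact: lip_scale|exact: lipZ].
rewrite (after_demandD P mX X0b)//; [|exact: lip_scale|exact: lipZ].
rewrite (after_demand_scale P mX X0b) (after_demandZ P mX X0b)//.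
by rewrite /stage_cost -/l2; lra.
Qed.

Lemma mean_cost_ge_linear : exists C, forall y, L y - C <= l y.
Proof.
have [K K0 fK] := lip_bounded_increment lipL; exists (K * b) => y.
apply: (after_demand_ge P mX X0b) => // u /andP[u0 ub].
have := fK y u; rewrite ger0_norm//.
have : K * u <= K * b by rewrite ler_wpM2l.
lra.
Qed.

Lemma stage_cost_ge_linear : exists C, forall y, L y - C <= J y.
Proof.
have [C lC] := mean_cost_ge_linear.
have [K K0 fK] := lip_bounded_increment lipL.
exists (C + K * b) => y.
have h1 := lC y; have Kb : 0 <= K * b by exact: mulr_ge0.
have h2 : L y - (C + K * b) <= l2 y.
  apply: (after_demand_ge P mX X0b); first exact: mean_cost_lip.
  move=> u /andP[u0 ub]; have := fK y u; rewrite ger0_norm//.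
  have : K * u <= K * b by rewrite ler_wpM2l.
  by have := lC (y - u); lra.
have h3 : L y - (C + K * b) <= l y by lra.
rewrite /stage_cost.
have := ler_wpM2l q0 h3; have := ler_wpM2l p0 h2; lra.
Qed.

Lemma stage_cost_coercive : coercive J.
Proof.
have [C JC] := stage_cost_ge_linear.
exists (Num.min ch cp), C; split=> [|y]; first by rewrite lt_min ch0 cp0.
apply: le_trans (JC y); rewrite lerD2r /carrying_cost.
have mch : Num.min ch cp <= ch by rewrite ge_min lexx.
have mcp : Num.min ch cp <= cp by rewrite ge_min lexx orbT.
case: (leP 0 y) => y0; first by rewrite ger0_norm// ler_wpM2r.
by rewrite ltr0_norm// mulNr mulrN lerN2 ler_wnM2r// ltW.
Qed.

Lemma order_cost_regular k V : cost_tail k V ->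
  [/\ lip (G k), convex (G k) & coercive (G k)].
Proof.
move=> tV; have GE := order_costE tV.
case: tV => lV cV nV [a [B [/andP[B0 Bcp] VB]]] _.
rewrite (funext GE); split.
- apply: lipD; last exact: (after_demand_lip P mX X0b).
  by apply: lipD; [exact: stage_cost_lip|exact: lip_cst].
- apply: convexD; last exact: (after_demand_convex P mX X0b).
  by apply: convexD; [exact: stage_cost_convex|exact: convex_cst].
have [C JC] := stage_cost_ge_linear.
exists (Num.min ch (cp - B)), (C - c * mu - (a - B * b)); split=> [|y].
  by rewrite lt_min ch0 subr_gt0.
have h : a - B * b + B * Num.min y 0 <= m V y.
  apply: (after_demand_ge P mX X0b) => // u /andP[u0 ub].
  apply: le_trans (VB _).
  have : Num.min y 0 - b <= Num.min (y - u) 0.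
    by rewrite le_min; case: (leP y 0) => y0; lra.
  by move=> /(ler_wpM2l B0); lra.
have := JC y; rewrite /carrying_cost.
have mch : Num.min ch (cp - B) <= ch by rewrite ge_min lexx.
have mcp : Num.min ch (cp - B) <= cp - B by rewrite ge_min lexx orbT.
move: h; case: (leP 0 y) => y0 h.
  by rewrite ger0_norm//; have := ler_wpM2r y0 mch; lra.
have yy0 : 0 <= - y by lra.
by rewrite ltr0_norm//; have := ler_wpM2r yy0 mcp; lra.
Qed.

Lemma cost_tail_max k s : lip (val k) -> lip (G k) -> convex (G k) ->
  least_min (G k) s -> cost_tail k.+1 (fun x => G k (Num.max x s)).
Proof.
move=> lv lG cG lms; have [ms ls] := lms; split.
- exact: lip_max.
- exact: convex_max.
- exact: max_nondecreasing.
- by exists (G k s), 0; split=> [|y]; rewrite ?lexx// mul0r addr0.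
- by move=> x; have [_ ->] := order_up_to_max lv cG lms x.
Qed.

Lemma lip_value0 : lip (val 0).
Proof. exact: lip_cst. Qed.

Lemma order_cost0E y : G 0 y = c * y + q * l y.
Proof. by rewrite /order_cost /= after_demand_cst addr0. Qed.

(** With one period to go an order pays off only if it is likely enough to be
    delivered at once; otherwise nothing is ordered. *)
Lemma last_period :
  ((exists s, forall x, up 1 x = Num.max x s) \/ (forall x, up 1 x = x)) /\
  exists V, cost_tail 1 V.
Proof.
have G0E := funext order_cost0E.
have lG : lip (G 0).
  rewrite G0E; apply: lipD; first exact: lip_scale.
  by apply: lipZ; exact: mean_cost_lip.
have cG : convex (G 0).
  rewrite G0E; apply: convexD; first exact: convex_scale.
  by apply: convexZ => //; exact: mean_cost_convex.
have [C lC] := mean_cost_ge_linear.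
have [cq|qc] := ltP c (q * cp).
  have coG : coercive (G 0).
    exists (Num.min c (q * cp - c)), (q * C); split=> [|y].
      by rewrite lt_min c0 subr_gt0.
    rewrite order_cost0E; have := ler_wpM2l q0 (lC y).
    rewrite /carrying_cost.
    have m1 : Num.min c (q * cp - c) <= c by rewrite ge_min lexx.
    have m2 : Num.min c (q * cp - c) <= q * cp - c by rewrite ge_min lexx orbT.
    case: (leP 0 y) => y0.
      rewrite ger0_norm//; have := ler_wpM2r y0 m1.
      have : 0 <= q * (ch * y) by rewrite !mulr_ge0// ltW.
      lra.
    have yy0 : 0 <= - y by lra.
    by rewrite ltr0_norm//; have := ler_wpM2r yy0 m2; lra.
  have [s lms] := least_min_exists lG coG; split.
    by left; exists s => x; have [] := order_up_to_max lip_value0 cG lms x.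
  by exists (fun x => G 0 (Num.max x s)); exact: cost_tail_max lip_value0 _ _ _.
have nG y z : y <= z -> G 0 y <= G 0 z.
  move=> yz; rewrite !order_cost0E.
  have : - cp * (z - y) <= l z - l y.
    have lL := lipL; rewrite /mean_cost /after_demand -meanB;
      [|exact: (after_demand_rv mX X0b _ lL)..].
    rewrite -[leLHS](mean_cst P); apply: le_mean => [||w].
    - exact: bounded_rv_cst.
    - by apply: bounded_rvB; exact: (after_demand_rv mX X0b _ lL).
    have := carrying_cost_increment_ge ch0 cp0 (_ : y - X w <= z - X w).
    by rewrite lerD2r yz => /(_ isT); rewrite opprB addrA subrK.
  move=> /(ler_wpM2l q0).
  have : (q * cp) * (z - y) <= c * (z - y) by rewrite ler_wpM2r ?subr_ge0.
  lra.
split; first by right=> x; have [] := order_up_to_id lip_value0 nG x.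
exists (G 0); split=> //.
- exists (- (q * C)), (c - q * cp); split=> [|y].
    rewrite subr_ge0 qc/= (le_lt_trans _ ccp)// gerBl mulr_ge0//.
    exact: ltW.
  rewrite order_cost0E; have := ler_wpM2l q0 (lC y).
  rewrite /carrying_cost; case: (leP 0 y) => y0; rewrite ?mulr0 ?addr0; last lra.
  have : 0 <= q * (ch * y) by rewrite !mulr_ge0// ltW.
  have : 0 <= c * y by rewrite mulr_ge0// ltW.
  lra.
- by move=> x; have [_ ->] := order_up_to_id lip_value0 nG x.
Qed.

Lemma cost_tail_step k V : cost_tail k V -> exists s, [/\ least_min (G k) s,
  (forall x, up k.+1 x = Num.max x s) &
  cost_tail k.+1 (fun x => G k (Num.max x s))].
Proof.
move=> tV; have lv := cost_tail_lip tV; have [lG cG coG] := order_cost_regular tV.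
have [s lms] := least_min_exists lG coG; exists s; split=> //.
- by move=> x; have [] := order_up_to_max lv cG lms x.
- exact: cost_tail_max.
Qed.

Lemma cost_tail_exists k : exists V, cost_tail k.+1 V.
Proof.
elim: k => [|k [V tV]]; first by case: last_period.
by have [s [_ _]] := cost_tail_step tV; eexists; eassumption.
Qed.

(** From two periods to go on, the policy is of base-stock type whatever the last
    period looks like. *)
Lemma base_stock_levelP k : [/\ least_min (G k.+1) (S k.+2),
  (forall x, up k.+2 x = Num.max x (S k.+2)) &
  cost_tail k.+2 (fun x => G k.+1 (Num.max x (S k.+2)))].
Proof.
have [V tV] := cost_tail_exists k; have [s [lms us ts]] := cost_tail_step tV.
suff -> : S k.+2 = s by [].
apply: xget_unique => //= t ut; apply/le_anti/andP; split.
  by have := ut s; rewrite us maxxx => e; rewrite [leRHS]e le_max lexx orbT.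
by have := us t; rewrite ut maxxx => e; rewrite [leRHS]e le_max lexx orbT.
Qed.

Section Limit.
Variable s : R.
Hypothesis sJ : least_min J s.

Let Jmin y : J s <= J y. Proof. by case: sJ. Qed.

(** Beyond [s] both parts of [order_cost], the stage cost and the cost to go,
    increase. *)
Lemma base_stock_level_le k : S k.+2 <= s.
Proof.
have [[_ ls] _ _] := base_stock_levelP k; have [V tV] := cost_tail_exists k.
rewrite leNgt; apply/negP => /[dup] sS /ls; rewrite !(order_costE tV).
case: tV => lV _ nV _ _.
have : m V s <= m V (S k.+2).
  apply: (le_after_demand P mX X0b) => // u _; apply: nV.
  by rewrite lerD2r ltW.
move=> mV; apply/negP; rewrite -leNgt; apply: lerD; last exact: mV.
by rewrite lerD2r; exact: Jmin.
Qed.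

(** What ordering up to [s] instead of the optimal level costs with [k.+2]
    periods to go. *)
Definition excess (k : nat) : R := G k.+1 s - G k.+1 (S k.+2).

Lemma excess_ge0 k : 0 <= excess k.
Proof. by have [[h _] _ _] := base_stock_levelP k; rewrite subr_ge0. Qed.

(** One step of the recursion turns the difference of two successive excesses
    into a bound for the stage cost at the optimal level: the demand only lowers
    the stock, and the cost to go does not increase when the stock is lowered. *)
Lemma excess_step k : excess k.+1 + (J (S k.+3) - J s) <= excess k.
Proof.
have [[ms _] _ tV] := base_stock_levelP k.
rewrite {1}/excess !(order_costE tV).
case: tV => lV _ nV _ _.
have h1 : m (fun x => G k.+1 (Num.max x (S k.+2))) s <= G k.+1 s.
  apply: (after_demand_le P mX X0b); first exact: lV.
  move=> u /andP[u0 _].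
  have us : s - u <= s by rewrite gerBl.
  apply: le_trans (nV _ _ us) _.
  by rewrite (max_l (base_stock_level_le k)).
have h2 : G k.+1 (S k.+2) <= m (fun x => G k.+1 (Num.max x (S k.+2))) (S k.+3).
  by apply: (after_demand_ge P mX X0b); [exact: lV|move=> u _; exact: ms].
rewrite /excess; move: h1 h2.
move: (m _ s) (m _ (S k.+3)) (G k.+1 s) (G k.+1 (S k.+2)) (J s) (J (S k.+3)).
by move=> *; lra.
Qed.

Lemma stage_cost_gap_summable :
  exists B, forall n, \sum_(k < n) (J (S k.+2) - J s) <= B.
Proof.
have u0 k : 0 <= J (S k.+2) - J s by rewrite subr_ge0; exact: Jmin.
exists (J (S 2) - J s + excess 0).
exact: telescoping_bound u0 excess_ge0 excess_step.
Qed.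

(** The stage cost at the levels tends to its minimum because the gaps are summable,
    and a level below [s - e] would keep a gap, [s] being the least minimizer. *)
Lemma base_stock_level_cvg : S n @[n --> \oo] --> s.
Proof.
have [B sB] := stage_cost_gap_summable.
have u0 : J (S k.+2) - J s @[k --> \oo] --> 0.
  apply: cvg_series_cvg_0; apply: nondecreasing_is_cvgn.
    by apply: nondecreasing_series => k _ _; rewrite subr_ge0.
  exists B => _ [n _ <-]; rewrite /series/= big_mkord; exact: sB.
rewrite -(cvg_shiftn 2%N); apply/cvgrPdist_lt => e e0.
have Je : 0 < J (s - e) - J s.
  by rewrite subr_gt0; case: sJ => _; apply; rewrite gtrBl.
near=> n.
have sS := base_stock_level_le n.
change (`|s - S (n + 2)%N| < e).
rewrite addn2 ger0_norm ?subr_ge0// ltrBlDl -ltrBlDr ltNge; apply/negP => Ss.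
have JS : J (s - e) <= J (S n.+2).
  by apply: (convex_le_min stage_cost_convex Jmin); rewrite Ss gerBl ltW.
have : `|0 - (J (S n.+2) - J s)| < J (s - e) - J s.
  by near: n; exact: (cvgr_dist_lt _ _ u0 _ Je).
rewrite sub0r normrN ger0_norm ?subr_ge0 ?Jmin// ltrD2r ltNge => /negP; exact.
Unshelve. all: by end_near. Qed.

Lemma limit_levelE : limit_level P D c ch cp q = s.
Proof. by apply: cvg_lim => //; exact: base_stock_level_cvg. Qed.

(** The increments of [l2] are averages of increments of [l] further left, hence
    smaller; were [l2] to increase up to [s], then so would [J]. *)
Lemma mean_cost2_left t : 0 <= t -> l2 s <= l2 (s - t).
Proof.
move=> t0; rewrite leNgt; apply/negP => h.
have ll := mean_cost_lip.
have h2 : l2 s - l2 (s - t) <= l s - l (s - t).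
  rewrite /mean_cost2 /after_demand -meanB; [|exact: (after_demand_rv mX X0b _ ll)..].
  rewrite -[leRHS](mean_cst P); apply: le_mean => [||w].
  - by apply: bounded_rvB; exact: (after_demand_rv mX X0b _ ll).
  - exact: bounded_rv_cst.
  have := @convex_increment _ _ (s - t - X w) (s - t) t mean_cost_convex.
  have /andP[X0 _] := X0b w.
  by rewrite gerBl X0 t0 subrK (_ : s - t - X w + t = s - X w);
    [move=> /(_ isT isT)|ring].
move: h h2 (Jmin (s - t)); rewrite /stage_cost.
move: (l s) (l (s - t)) (l2 s) (l2 (s - t)) => u v u2 v2 h h2.
have [q_eq0|qn0] := eqVneq q 0; first by rewrite q_eq0; lra.
have : 0 < q * (u - v) by rewrite mulr_gt0 ?lt_def ?qn0// subr_ge0; lra.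
have : 0 <= (1 - q) * (u2 - v2) by rewrite mulr_ge0// subr_ge0 ltW.
lra.
Qed.

End Limit.

End DynamicProgram.

(** * Independence of disjoint groups of variables *)

Section IndependentMaps.
Context {d d1 d2 : measure_display} {T : measurableType d}.
Context {T1 : measurableType d1} {T2 : measurableType d2} {R : realType}.
Variable P : probability T R.

(** The joint law of two independent maps is the product of their laws, so Fubini
    lets one average first over one argument, with the other held fixed. *)
Lemma mean_independent (U : {mfun T >-> T1}) (V : {mfun T >-> T2})
    (phi : T1 * T2 -> R) :
  (forall A B, measurable A -> measurable B ->
    P (U @^-1` A `&` V @^-1` B) = (P (U @^-1` A) * P (V @^-1` B))%E) ->
  bounded_rv phi ->
  \int[P]_w phi (U w, V w) = \int[P]_w (\int[P]_w' phi (U w, V w')).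
Proof.
move=> indep [mphi [K phiK]].
pose UV w := (U w, V w).
have mUV : measurable_fun [set: T] UV by exact: measurable_fun_pair.
pose UVm : {mfun T >-> (T1 * T2)%type} := mfun_Sub (mem_set mUV).
pose mU := distribution P U; pose mV := distribution P V.
have mE : forall A, measurable A ->
    (mU \x mV)%E A = distribution P UVm A.
  by apply: product_measure_unique => A B mA mB; rewrite /= -indep.
have iphi : (mU \x mV)%E.-integrable setT (EFin \o phi).
  apply: measurable_bounded_integrable => //.
    rewrite -[ltLHS]/((mU \x mV)%E setT) mE//.
    by rewrite (le_lt_trans (probability_le1 (distribution P UVm) _))// ltry.
  exists K; split; first exact: num_real.
  by move=> x Kx z _; apply: le_trans (ltW Kx); exact: phiK.
have mphi2 x : measurable_fun [set: T2] (fun y => phi (x, y)).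
  by apply: measurableT_comp => //; exact: measurable_pair1.
have b2 x : bounded_rv (fun w' => phi (x, V w')).
  split; last by exists K => w.
  exact: (measurableT_comp (mphi2 x)).
have innerE x : (\int[P]_w' phi (x, V w'))%:E = (\int[mV]_y (phi (x, y))%:E)%E.
  rewrite integral_distribution//; last exact: (bounded_rv_integrable P (b2 x)).
    by rewrite /Rintegral fineK// integrable_fin_num//; exact: (bounded_rv_integrable P (b2 x)).
  exact/measurable_EFinP.
rewrite {1}/Rintegral.
transitivity (fine (\int[distribution P UVm]_z (phi z)%:E)%E).
  rewrite integral_distribution//; first exact/measurable_EFinP.
  apply: bounded_rv_integrable; split; last by exists K => w.
  exact: measurableT_comp.
rewrite -(eq_measure_integral _ (fun A mA _ => mE A mA)).
rewrite -integral12_prod_meas1//.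
rewrite /Rintegral; congr fine.
rewrite integral_distribution//.
- by apply: eq_integral => w _; exact: esym (innerE (U w)).
- exact: (measurable_fubini_F iphi).
- apply: (@eq_integrable _ _ _ P _ measurableT
    (fun w => (\int[P]_w' phi (U w, V w'))%:E)); first by move=> w _; exact: innerE.
  apply: bounded_rv_integrable; split.
    apply/measurable_EFinP; rewrite (_ : EFin \o _ =
      fubini_F mV (EFin \o phi) \o U); last first.
      by apply/funext => w; exact: innerE.
    by apply: measurableT_comp => //; exact: (measurable_fubini_F iphi).
  by exists K => w; exact: norm_mean_le.
Qed.

End IndependentMaps.

Section IndependentGroups.
Context {d : measure_display} {T : measurableType d} {R : realType}.
Context {I : choiceType}.
Variables (P : probability T R) (X : I -> T -> R).
Hypothesis mX : forall i, measurable_fun [set: T] (X i).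
Hypothesis indX : mutually_independent P X.

Definition cylinders (J : seq I) : set (set T) :=
  [set A | exists2 B : I -> set R, (forall i, measurable (B i)) &
    A = \bigcap_(i in [set` J]) (X i @^-1` B i)].

Lemma measurable_cylinder J A : cylinders J A -> measurable A.
Proof.
move=> [B mB ->]; apply: fin_bigcap_measurable => // i _.
by rewrite -[_ @^-1` _]setTI; exact: mX.
Qed.

Lemma cylinders_setI J : setI_closed (cylinders J).
Proof.
move=> _ _ [B mB ->] [C mC ->]; exists (fun i => B i `&` C i).
  by move=> i; exact: measurableI.
by rewrite -bigcapI; apply: eq_bigcapr => i _; rewrite preimage_setI.
Qed.

Lemma cylinders_setT J : cylinders J setT.
Proof.
exists (fun=> setT) => //.
by apply/esym/seteqP; split=> // w _ i _.
Qed.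

(** The sample space with only the events decided by the variables of [J]: being a
    function of these variables becomes measurability on this type. *)
Definition events_of (J : seq I) := g_sigma_algebraType (cylinders J).

Lemma events_of_sub J A : <<s cylinders J >> A -> measurable A.
Proof.
apply: smallest_sub; first exact: sigma_algebra_measurable.
exact: measurable_cylinder.
Qed.

Lemma measurable_event_map J : measurable_fun [set: T] (id : T -> events_of J).
Proof. by move=> _ A mA; rewrite setTI; exact: (@events_of_sub J A mA). Qed.

Lemma measurable_variable J i : i \in J ->
  measurable_fun [set: events_of J] (X i : events_of J -> R).
Proof.
move=> iJ _ B mB; rewrite setTI; apply: sub_sigma_algebra.
exists (fun j => if j == i then B else setT).
  by move=> j; case: ifP.
apply/seteqP; split=> [w /= Bw j _ /=|w /(_ i iJ)/=]; last by rewrite eqxx.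
by case: ifP => // /eqP ->.
Qed.

Lemma independent_cylinders J1 J2 A1 A2 : uniq (J1 ++ J2) ->
  cylinders J1 A1 -> cylinders J2 A2 -> P (A1 `&` A2) = (P A1 * P A2)%E.
Proof.
move=> uJ [B mB ->] [C mC ->].
move: (uJ); rewrite cat_uniq => /and3P[u1 /hasPn J12 u2].
pose F i := if i \in J1 then B i else C i.
have mF i : measurable (F i) by rewrite /F; case: ifP.
have := indX uJ mF; rewrite big_cat/=.
rewrite (eq_big_seq (fun i => P (X i @^-1` B i))); last first.
  by move=> i iJ; rewrite /F iJ.
rewrite [X in (_ * X)%E](eq_big_seq (fun i => P (X i @^-1` C i))); last first.
  by move=> i iJ; rewrite /F (negbTE (J12 i iJ)).
rewrite -!indX// => <-; congr (P _).
apply/seteqP; split=> [w [Bw Cw] i /=|w Fw].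
  rewrite mem_cat /F; case: ifP => [iJ _|_ /= iJ]; [exact: Bw|exact: Cw].
split=> i /= iJ.
  by have := Fw i; rewrite /= mem_cat iJ /F iJ; exact.
have := Fw i; rewrite /= mem_cat iJ orbT /F (negbTE (J12 i iJ)); exact.
Qed.

(** On each side in turn, two measures that agree on the cylinders, a class stable by
    intersection, agree on all events that the cylinders generate. *)
Lemma independent_events J1 J2 A1 A2 : uniq (J1 ++ J2) ->
  <<s cylinders J1 >> A1 -> <<s cylinders J2 >> A2 ->
  P (A1 `&` A2) = (P A1 * P A2)%E.
Proof.
move=> uJ.
have cov : \bigcup_(_ in [set: nat]) [set: T] = setT.
  by apply: bigcup_const; exists 0%N.
have fP A : measurable A -> (0 <= fine (P A))%R by move=> _; exact: fine_ge0.
have sub J A := @events_of_sub J A.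
have half A : cylinders J1 A ->
    forall B, <<s cylinders J2 >> B -> P (B `&` A) = (P A * P B)%E.
  move=> cA; have mA := measurable_cylinder cA.
  pose m1 := mrestr P mA; pose m2 := mscale (NngNum (fP _ mA)) P.
  have uniq2 := g_sigma_algebra_measure_unique (cylinders J2)
    (@measurable_cylinder J2) (fun=> setT) (fun=> cylinders_setT J2) cov m1 m2.
  have m2E B : m2 B = (P A * P B)%E.
    by rewrite /m2 /mscale/= fineK// fin_num_measure.
  move=> B sB; rewrite -m2E; apply: uniq2 => //.
  - exact: cylinders_setI.
  - move=> C cC; rewrite [RHS]m2E; change (P (C `&` A) = (P A * P C)%E).
    by rewrite setIC (independent_cylinders uJ).
  - by move=> k; change (P (setT `&` A) < +oo)%E; rewrite setTI (le_lt_trans (probability_le1 P mA))// ltry.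
move=> sA sB; have mB := sub _ _ sB.
pose m1 := mrestr P mB; pose m2 := mscale (NngNum (fP _ mB)) P.
have uniq1 := g_sigma_algebra_measure_unique (cylinders J1)
    (@measurable_cylinder J1) (fun=> setT) (fun=> cylinders_setT J1) cov m1 m2.
have m2E A : m2 A = (P A2 * P A)%E.
  by rewrite /m2 /mscale/= fineK// fin_num_measure.
rewrite muleC -m2E; apply: uniq1 => //.
- exact: cylinders_setI.
- move=> C cC; rewrite [RHS]m2E; change (P (C `&` A2) = (P A2 * P C)%E).
  by rewrite setIC half// muleC.
- by move=> k; change (P (setT `&` A2) < +oo)%E; rewrite setTI (le_lt_trans (probability_le1 P mB))// ltry.
Qed.

(** This is [mean_independent] for the identity map, seen as a map to each of the two
    spaces of events: either group of variables may be frozen while one averages over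
    the other. *)
Lemma mean_freeze J1 J2 (phi : events_of J1 * events_of J2 -> R) :
  uniq (J1 ++ J2) -> bounded_rv phi ->
  \int[P]_w phi (w, w) = \int[P]_w (\int[P]_w' phi (w, w')).
Proof.
move=> uJ bphi.
pose U : {mfun T >-> events_of J1} := mfun_Sub (mem_set (@measurable_event_map J1)).
pose V : {mfun T >-> events_of J2} := mfun_Sub (mem_set (@measurable_event_map J2)).
apply: (@mean_independent _ _ _ _ _ _ _ P U V) => // A B mA mB.
exact: (independent_events uJ mA mB).
Qed.

Lemma bounded_rv_events J (f : events_of J -> R) :
  bounded_rv f -> bounded_rv (f : T -> R).
Proof.
move=> [mf [K fK]]; split; last by exists K.
exact: (measurableT_comp mf (@measurable_event_map J)).
Qed.

Lemma mean_independentM J1 J2 (f : events_of J1 -> R) (g : events_of J2 -> R) :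
  uniq (J1 ++ J2) -> bounded_rv f -> bounded_rv g ->
  \int[P]_w (f w * g w) = (\int[P]_w f w) * (\int[P]_w g w).
Proof.
move=> uJ bf bg; have [mf [K fK]] := bf; have [mg [K' gK]] := bg.
rewrite (@mean_freeze _ _ (fun z => f z.1 * g z.2))//=; last first.
  by apply: bounded_rvM; split; [exact: measurableT_comp|exists K|
    exact: measurableT_comp|exists K'].
transitivity (\int[P]_w ((\int[P]_w' g w') * f w)).
  by apply: eq_mean => w; rewrite meanZ 1?mulrC//; exact: bounded_rv_events.
by rewrite meanZ 1?mulrC//; exact: bounded_rv_events.
Qed.

End IndependentGroups.

(** * The Stein equation *)

Section PointwiseDerivatives.
Context {R : realType}.
Implicit Types (f g : R -> R) (x a b : R).

Definition deriv f x a : Prop := is_derive x (1 : R) f a.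

Lemma deriv_eq f x a b : deriv f x a -> a = b -> deriv f x b.
Proof. by move=> h <-. Qed.

Lemma deriv_cst k x : deriv (fun=> k) x 0.
Proof. exact: is_derive_cst. Qed.

Lemma deriv_id x : deriv (fun y => y) x 1.
Proof. exact: is_derive_id. Qed.

Lemma derivD f g x a b :
  deriv f x a -> deriv g x b -> deriv (fun y => f y + g y) x (a + b).
Proof. exact: is_deriveD. Qed.

Lemma derivB f g x a b :
  deriv f x a -> deriv g x b -> deriv (fun y => f y - g y) x (a - b).
Proof. exact: is_deriveB. Qed.

Lemma derivM f g x a b : deriv f x a -> deriv g x b ->
  deriv (fun y => f y * g y) x (a * g x + f x * b).
Proof.
move=> df dg; apply: deriv_eq; first exact: is_deriveM df dg.
by rewrite /GRing.scale/= addrC [g x * a]mulrC.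
Qed.

Lemma derivZ k f x a : deriv f x a -> deriv (fun y => k * f y) x (k * a).
Proof. exact: is_deriveZ. Qed.

Lemma derivV f x a : f x != 0 -> deriv f x a ->
  deriv (fun y => (f y)^-1) x (- a / f x ^+ 2).
Proof.
move=> f0 df; apply: deriv_eq; first exact: is_deriveV f0 df.
by rewrite /GRing.scale/= mulNr mulrC mulNr.
Qed.

Lemma deriv_comp f g x a b : deriv f (g x) a -> deriv g x b ->
  deriv (fun y => f (g y)) x (a * b).
Proof. exact: is_derive1_comp. Qed.

Lemma deriv_continuous f x a : deriv f x a -> {for x, continuous f}.
Proof.
by move=> [df _]; apply: differentiable_continuous; exact/derivable1_diffP.
Qed.

Lemma mean_value f f' x y : (forall z, deriv f z (f' z)) ->
  exists z, `|z - x| <= `|y - x| /\ f y - f x = f' z * (y - x).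
Proof.
move=> df; have cf : continuous f by move=> z; exact: deriv_continuous (df z).
have seg a b : a <= b ->
    exists2 c, c \in `[a, b]%R & f b - f a = f' c * (b - a).
  move=> ab; apply: MVT_segment => // [z _|]; first exact: df.
  exact: continuous_subspaceT.
case: (leP x y) => xy.
  have [c /[!in_itv]/= /andP[xc cy] e] := seg _ _ xy; exists c; split=> //.
  by rewrite !ger0_norm; lra.
have [c /[!in_itv]/= /andP[xc cy] e] := seg _ _ (ltW xy); exists c; split.
  by rewrite !ler0_norm; lra.
lra.
Qed.

Lemma bounded_deriv_lip f f' K : (forall z, deriv f z (f' z)) ->
  (forall z, `|f' z| <= K) -> forall x y, `|f x - f y| <= K * `|x - y|.
Proof.
move=> df f'K x y; have [z [_ ->]] := mean_value y x df.
by rewrite normrM ler_wpM2r.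
Qed.

Lemma decreasing_to_limit f f' a l : (forall z, a < z -> deriv f z (f' z)) ->
  (forall z, a < z -> f' z <= 0) -> f y @[y --> +oo] --> l ->
  forall x, a < x -> l <= f x.
Proof.
move=> df f'0 fl x ax; rewrite leNgt; apply/negP => fxl.
have mono y : x < y -> f y <= f x.
  move=> xy.
  have [||c /[!in_itv]/= /andP[xc cy] e] := @MVT_segment R f f' x y (ltW xy).
  - by move=> z /[!in_itv]/= /andP[xz _]; apply: df; exact: lt_trans xz.
  - apply: continuous_in_subspaceT => z /set_mem/= /[!in_itv]/= /andP[xz _].
    by apply: deriv_continuous; apply: df; exact: lt_le_trans xz.
  rewrite -subr_le0 e mulr_le0_ge0 ?subr_ge0 ?(ltW xy)//.
  by apply: f'0; exact: lt_le_trans xc.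
near (pinfty_nbhs R) => y.
have xy : x < y by near: y; apply: nbhs_pinfty_gt; exact: num_real.
have : `|l - f y| < l - f x.
  by near: y; move/cvgrPdist_lt: fl; apply; rewrite subr_gt0.
by have := mono y xy; have := ler_norm (l - f y); lra.
Unshelve. all: by end_near. Qed.

End PointwiseDerivatives.

Section Gauss.
Context {R : realType}.
Definition gauss : R -> R := normal_pdf 0 1.
Local Notation phi := gauss.
Local Notation mu := (@lebesgue_measure R).

Lemma gaussE x : phi x = normal_peak 1 * expR (- (x ^+ 2) / 2).
Proof.
rewrite /gauss normal_pdfE ?oner_eq0// /normal_fun subr0 expr1n; congr (_ * expR (_ / _)).
Qed.

Lemma gauss_gt0 x : 0 < phi x.
Proof. by rewrite gaussE mulr_gt0 ?expR_gt0 ?normal_peak_gt0 ?oner_eq0. Qed.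

Lemma gauss_even x : phi (- x) = phi x.
Proof. by rewrite !gaussE sqrrN. Qed.

Lemma gauss_bounded : exists2 K, 0 < K & forall x, phi x <= K.
Proof.
exists (normal_peak 1) => [|x]; first by rewrite normal_peak_gt0 ?oner_eq0.
by apply: normal_pdf_ub; exact: oner_neq0.
Qed.

Lemma deriv_gauss x : deriv phi x (- x * phi x).
Proof.
have -> : phi = fun x => normal_peak 1 * expR (- 2^-1 * (x * x)).
  by apply/funext => y; rewrite gaussE; congr (_ * expR _); field.
have h : deriv (fun x : R => - 2^-1 * (x * x)) x (- 2^-1 * (1 * x + x * 1)).
  by apply: derivZ; apply: derivM; exact: deriv_id.
apply: deriv_eq.
  by apply: derivZ; apply: deriv_comp h; exact: is_derive_expR.
by field.
Qed.

Lemma gauss_continuous : continuous phi.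
Proof. by apply: continuous_normal_pdf; exact: oner_neq0. Qed.

Lemma gauss_integrable : mu.-integrable [set: R] (EFin \o phi).
Proof. exact: integrable_normal_pdf. Qed.

Lemma gauss_over_cvg0 (u : R -> R) :
  (forall y, 0 < y -> 0 <= u y <= phi y / y) -> u y @[y --> +oo] --> (0 : R).
Proof.
move=> ub; have [K K0 phiK] := gauss_bounded.
apply: (@squeeze_cvgr _ _ _ _ (fun=> 0) (fun y => K * y^-1)).
- near=> y; have y0 : 0 < y by near: y; apply: nbhs_pinfty_gt; exact: num_real.
  have /andP[-> /=] := ub y y0 => /le_trans; apply.
  by rewrite ler_wpM2r// invr_ge0 ltW.
- exact: cvg_cst.
- rewrite -[X in _ --> X](mulr0 K); apply: cvgM; first exact: cvg_cst.
  by apply/gtr0_cvgV0; [exact: nbhs_pinfty_gt|exact: cvg_id].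
Unshelve. all: by end_near. Qed.

(** Both tails of the normal distribution are functions [U] of this kind, once the
    lower one is reflected. *)
Section Mills.
Variable U : R -> R.
Hypothesis dU : forall x, deriv U x (- phi x).
Hypothesis U0 : U y @[y --> +oo] --> (0 : R).

(** [phi y / y - U y] decreases to [0]. *)
Lemma mills_upper x : 0 < x -> x * U x <= phi x.
Proof.
move=> x0.
have := @decreasing_to_limit _ (fun y => phi y / y - U y)
  (fun y => - (phi y / y ^+ 2)) 0 0 _ _ _ x x0.
rewrite subr_ge0 ler_pdivlMr// mulrC; apply.
- move=> y y0; apply: deriv_eq.
    apply: derivB (dU y); apply: derivM; first exact: deriv_gauss.
    by apply: derivV; [rewrite gt_eqF|exact: deriv_id].
  by rewrite /=; field; rewrite gt_eqF.
- by move=> y y0; rewrite oppr_le0 divr_ge0 ?exprn_ge0 ?(ltW (gauss_gt0 _)) ?ltW.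
- rewrite -[X in _ --> X](subr0 0); apply: cvgB; last exact: U0.
  apply: gauss_over_cvg0 => y y0.
  by rewrite lexx andbT divr_ge0 ?(ltW (gauss_gt0 _)) ?ltW.
Qed.

(** [U y - y * phi y / (1 + y ^ 2)] decreases to [0]. *)
Lemma mills_lower x : 0 < x -> x * phi x <= (1 + x ^+ 2) * U x.
Proof.
move=> x0; have p (y : R) : 0 < 1 + y ^+ 2 by have := sqr_ge0 y; lra.
rewrite mulrC [leRHS]mulrC [leLHS]mulrC.
have := @decreasing_to_limit _ (fun y => U y - y * phi y / (1 + y * y))
  (fun y => - (2 * phi y / (1 + y ^+ 2) ^+ 2)) 0 0 _ _ _ x x0.
rewrite subr_ge0 ler_pdivrMr -expr2//; apply.
- move=> y y0; apply: deriv_eq.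
    apply: derivB; first exact: dU.
    apply: derivM; first by apply: derivM; [exact: deriv_id|exact: deriv_gauss].
    apply: derivV; first by rewrite -expr2 gt_eqF.
    apply: derivD; first exact: deriv_cst.
    by apply: derivM; exact: deriv_id.
  by rewrite /=; field; rewrite gt_eqF// p.
- by move=> y y0; rewrite oppr_le0 divr_ge0 ?exprn_ge0 ?mulr_ge0 ?(ltW (gauss_gt0 _)) ?ltW.
- rewrite -[X in _ --> X](subr0 0); apply: cvgB; first exact: U0.
  apply: gauss_over_cvg0 => y y0; have g0 := gauss_gt0 y.
  rewrite -expr2 divr_ge0 ?mulr_ge0 ?(ltW g0) ?(ltW y0) ?(ltW (p y))//=.
  rewrite ler_pdivrMr// mulrAC ler_pdivlMr//.
  have -> : phi y * (1 + y ^+ 2) = phi y + y * phi y * y by ring.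
  by rewrite lerDr ltW.
Qed.

End Mills.

Local Notation N := (normal_prob (0 : R) 1).

Definition gauss_cdf (x : R) : R := fine (N `]-oo, x]).
Local Notation Phi := gauss_cdf.

Lemma gauss_cdfE x : Phi x = \int[mu]_(u in `]-oo, x]) phi u.
Proof. by []. Qed.

Lemma deriv_integral (g : R -> R) x : continuous g ->
  mu.-integrable [set: R] (EFin \o g) ->
  deriv (fun y => \int[mu]_(u in `]-oo, y]) g u) x (g x).
Proof.
move=> cg ig; have [||||dF F'E] := @continuous_FTC1 R g -oo%O x (x + 1).
- by rewrite ltrDl.
- exact: integrableS ig.
- by rewrite ltNyr.
- exact: cg.
by apply: DeriveDef; [exact: dF|rewrite -derive1E F'E].
Qed.

Lemma deriv_gauss_cdf x : deriv Phi x (phi x).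
Proof. exact: deriv_integral gauss_continuous gauss_integrable. Qed.

(** A random variable of law [N], whose distribution function is [Phi]. *)
Let idN : measurableTypeR R -> R := idfun.

#[local] HB.instance Definition _ :=
  @isMeasurableFun.Build _ _ _ _ idN (@measurable_id _ _ setT).

Let PhiE x : cdf (idN : {RV N >-> R}) x = (Phi x)%:E.
Proof. by rewrite /gauss_cdf fineK// fin_num_measure. Qed.

Lemma gauss_cdf_cvgy : Phi y @[y --> +oo] --> (1 : R).
Proof. by have := cvg_cdfy1 (idN : {RV N >-> R}); rewrite (eq_cvg _ _ PhiE) => /fine_cvgP[]. Qed.

Lemma gauss_cdf_cvgNy : Phi y @[y --> -oo] --> (0 : R).
Proof. by have := cvg_cdfNy0 (idN : {RV N >-> R}); rewrite (eq_cvg _ _ PhiE) => /fine_cvgP[]. Qed.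

Definition mills_ratio (U : R -> R) (y : R) : R := U y / phi y.

Lemma mills_ratio_bounds (U : R -> R) : (forall x, deriv U x (- phi x)) ->
  U y @[y --> +oo] --> (0 : R) -> forall y, 1 <= y ->
  [/\ 0 <= mills_ratio U y <= 1, 0 <= y * mills_ratio U y <= 1 &
      y * (1 - y * mills_ratio U y) <= 1].
Proof.
move=> dU U0 y y1; have y0 : 0 < y by exact: lt_le_trans y1.
have g0 := gauss_gt0 y.
have up : y * mills_ratio U y <= 1.
  by rewrite /mills_ratio mulrA ler_pdivrMr// mul1r; exact: mills_upper.
have low : y <= (1 + y ^+ 2) * mills_ratio U y.
  by rewrite /mills_ratio mulrA ler_pdivlMr//; exact: mills_lower.
have r0 : 0 <= mills_ratio U y.
  have y2 : 0 < 1 + y ^+ 2 by have := sqr_ge0 y; lra.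
  by rewrite -(pmulr_rge0 _ y2) (le_trans _ low)// ltW.
have r1 : mills_ratio U y <= 1.
  by apply: le_trans up; rewrite ler_peMl.
split; first by rewrite r0 r1.
  by rewrite up andbT mulr_ge0// ltW.
have -> : y * (1 - y * mills_ratio U y) = y - y ^+ 2 * mills_ratio U y by ring.
by move: low; rewrite mulrDl mul1r; lra.
Qed.

Lemma deriv_upper_tail x : deriv (fun y => 1 - Phi y) x (- phi x).
Proof.
apply: deriv_eq; first by apply: derivB; [exact: deriv_cst|exact: deriv_gauss_cdf].
by rewrite sub0r.
Qed.

Lemma upper_tail_cvg0 : 1 - Phi y @[y --> +oo] --> (0 : R).
Proof.
rewrite -[X in _ --> X](subrr 1).
by apply: cvgB; [exact: cvg_cst|exact: gauss_cdf_cvgy].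
Qed.

Lemma deriv_lower_tail x : deriv (fun y => Phi (- y)) x (- phi x).
Proof.
have dN : deriv (fun y : R => - y) x (- 1) by exact: is_deriveNid.
apply: deriv_eq; first by apply: deriv_comp dN; exact: deriv_gauss_cdf.
by rewrite gauss_even mulrN1.
Qed.

Lemma lower_tail_cvg0 : Phi (- y) @[y --> +oo] --> (0 : R).
Proof. by have := gauss_cdf_cvgNy; rewrite cvgNy_compNP. Qed.

(** ** A smoothed half-line and its Stein solution *)

Section Solution.
Variables t delta : R.
Hypothesis delta0 : 0 < delta.

(** A Lipschitz substitute for the indicator function of the half-line below [t]. *)
Definition ramp (x : R) : R := Num.max 0 (Num.min 1 ((t + delta - x) / delta)).
Local Notation h := ramp.

Lemma ramp_ge0 x : 0 <= h x.
Proof. by rewrite le_max lexx. Qed.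

Lemma ramp_le1 x : h x <= 1.
Proof. by rewrite ge_max ler01 ge_min lexx. Qed.

Lemma ramp1 x : x <= t -> h x = 1.
Proof.
move=> xt; have : 1 <= (t + delta - x) / delta.
  by rewrite ler_pdivlMr// mul1r; lra.
by move=> h1; rewrite /ramp min_l// max_r.
Qed.

Lemma ramp0 x : t + delta <= x -> h x = 0.
Proof.
move=> xt; have : (t + delta - x) / delta <= 0.
  by rewrite ler_pdivrMr// mul0r; lra.
by move=> h0; rewrite /ramp max_l// ge_min h0 orbT.
Qed.

Lemma ramp_lip : lip h.
Proof.
exists delta^-1 => [|x y]; first by rewrite invr_ge0 ltW.
have -> : delta^-1 * `|x - y| = `|(t + delta - x) / delta - (t + delta - y) / delta|.
  rewrite -mulrBl normrM (gtr0_norm (_ : 0 < delta^-1)) ?invr_gt0// mulrC distrC.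
  by congr (`|_| * _); ring.
rewrite /ramp; set u := _ / delta; set v := _ / delta.
have := ler_norm (u - v); have := ler_norm (v - u); rewrite [in `|v - u|]distrC.
rewrite ler_norml.
have clampE (w : R) : Num.max 0 (Num.min 1 w) =
    if w <= 0 then 0 else if 1 <= w then 1 else w.
  case: (leP w 0) => w0; first by rewrite max_l// ge_min w0 orbT.
  by case: (leP 1 w) => w1; rewrite max_r// ltW.
rewrite !clampE; case: (leP u 0) => ?; case: (leP v 0) => ?;
  case: (leP 1 u) => ?; case: (leP 1 v) => ?; lra.
Qed.

Definition ramp_mean : R := \int[mu]_x (h x * phi x).
Local Notation p := ramp_mean.

Let cramp : continuous h. Proof. exact: lip_continuous ramp_lip. Qed.

Let integrable_times_gauss (g : R -> R) K : continuous g ->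
  (forall x, `|g x| <= K) -> mu.-integrable [set: R] (EFin \o (fun x => g x * phi x)).
Proof.
move=> cg gK.
apply: (@le_integrable _ _ _ mu setT measurableT _ (EFin \o (fun x => K * phi x))).
- apply/measurable_EFinP; apply: measurable_funM.
    exact: continuous_measurable_fun.
  exact: continuous_measurable_fun gauss_continuous.
- move=> x _ /=; rewrite lee_fin !normrM ler_pM//.
  by apply: le_trans (gK x) _; exact: ler_norm.
- exact: (integrableZl _ K gauss_integrable).
Qed.

Let iramp : mu.-integrable [set: R] (EFin \o (fun x => h x * phi x)).
Proof.
by apply: (@integrable_times_gauss _ 1) => // x; rewrite ger0_norm ?ramp_ge0 ?ramp_le1.
Qed.

Let int_gauss : \int[mu]_x phi x = 1.
Proof. by rewrite /Rintegral integral_normal_pdf. Qed.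

Lemma ramp_mean01 : 0 <= p <= 1.
Proof.
apply/andP; split.
  by apply: Rintegral_ge0 => x _; rewrite mulr_ge0 ?ramp_ge0 ?ltW ?gauss_gt0.
rewrite -int_gauss; apply: le_Rintegral => //; first exact: gauss_integrable.
by move=> x _; rewrite ler_piMl ?ramp_le1 ?ltW ?gauss_gt0.
Qed.

Let icph : mu.-integrable [set: R] (EFin \o (fun x => (h x - p) * phi x)).
Proof.
apply: (@integrable_times_gauss _ 1) => [x|x].
  by apply: cvgB; [exact: cramp|exact: cvg_cst].
have := ramp_ge0 x; have := ramp_le1 x; have := ramp_mean01.
by rewrite ler_norml => /andP[]; lra.
Qed.

Definition stein_integral (x : R) : R :=
  \int[mu]_(u in `]-oo, x]) ((h u - p) * phi u).
Local Notation F := stein_integral.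

Let dF x : deriv F x ((h x - p) * phi x).
Proof.
apply: deriv_integral => // y; apply: cvgM; last exact: gauss_continuous.
by apply: cvgB; [exact: cramp|exact: cvg_cst].
Qed.

Lemma stein_integral_left x : x <= t -> F x = (1 - p) * Phi x.
Proof.
move=> xt; rewrite gauss_cdfE -RintegralZl//; last first.
  exact: integrableS gauss_integrable.
apply: eq_Rintegral => u /[!inE]/= /[!in_itv]/= ux.
by rewrite ramp1// (le_trans ux).
Qed.

(** The integrand has integral [0] over the line, so its integral up to [x] is
    opposite to that over the upper tail, where [h] vanishes. *)
Lemma stein_integral_right x : t + delta <= x -> F x = p * (1 - Phi x).
Proof.
move=> tx.
have split_at g : mu.-integrable [set: R] (EFin \o g) -> \int[mu]_u g u =
    \int[mu]_(u in `]-oo, x]) g u + \int[mu]_(u in `]x, +oo[) g u.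
  move=> ig; rewrite -Rintegral_setU//.
  - by rewrite itv_setU_setT.
  - by rewrite itv_setU_setT.
  - exact: disjoint_rays.
have tot : \int[mu]_u ((h u - p) * phi u) = 0.
  transitivity (\int[mu]_u (h u * phi u - p * phi u)).
    by apply: eq_Rintegral => u _; rewrite mulrBl.
  rewrite RintegralB//; last exact: (integrableZl _ p gauss_integrable).
  by rewrite RintegralZl ?int_gauss ?mulr1 ?subrr//; exact: gauss_integrable.
have right : \int[mu]_(u in `]x, +oo[) ((h u - p) * phi u) = - p * (1 - Phi x).
  have -> : 1 - Phi x = \int[mu]_(u in `]x, +oo[) phi u.
    have := split_at _ gauss_integrable; rewrite int_gauss -gauss_cdfE; lra.
  rewrite -RintegralZl//; last exact: integrableS gauss_integrable.
  apply: eq_Rintegral => u /[!inE]/= /[!in_itv]/= /andP[xu _].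
  by rewrite ramp0 ?sub0r// (le_trans tx)// ltW.
by have := split_at _ icph; rewrite tot right -/(F x); lra.
Qed.

(** The solution of [f' x - x * f x = h x - p] that stays bounded at both ends. *)
Definition stein (x : R) : R := F x / phi x.
Local Notation f := stein.
Definition stein_deriv (x : R) : R := x * f x + h x - p.
Local Notation f' := stein_deriv.

Lemma deriv_stein x : deriv f x (f' x).
Proof.
have gn0 : phi x != 0 by rewrite gt_eqF ?gauss_gt0.
apply: deriv_eq.
  by apply: derivM; [exact: dF|apply: derivV => //; exact: deriv_gauss].
rewrite /stein_deriv /stein; field.
exact: gn0.
Qed.

Let stein_continuous : continuous f.
Proof. by move=> x; exact: deriv_continuous (deriv_stein x). Qed.

Let stein_deriv_continuous : continuous f'.
Proof.
move=> x; apply: cvgB; last exact: cvg_cst.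
by apply: cvgD; [apply: cvgM; [exact: cvg_id|exact: stein_continuous]|exact: cramp].
Qed.

(** Outside a compact interval the solution is a multiple of the Mills ratio. *)
Lemma stein_tail x : `|t| + `|t + delta| + 1 < `|x| ->
  [/\ `|f x| <= 1, `|f' x| <= 2 & `|x * f' x| <= 1].
Proof.
have := ler_norm (t + delta); have := ler_norm (- t); rewrite normrN.
have := normr_ge0 (t + delta); have := normr_ge0 t.
move=> t0 td0 tn tdn; have /andP[p0 p1] := ramp_mean01.
case: (leP 0 x) => x0.
  rewrite (ger0_norm x0) => Ax; have x1 : 1 <= x by lra.
  have tx : t + delta <= x by lra.
  have [/andP[r0 r1] /andP[yr0 yr1] yyr] :=
    mills_ratio_bounds deriv_upper_tail upper_tail_cvg0 x1.
  set r := mills_ratio _ x in r0 r1 yr0 yr1 yyr.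
  have fE : f x = p * r.
    by rewrite /stein stein_integral_right// /r /mills_ratio mulrA.
  have f'E : f' x = - (p * (1 - x * r)) by rewrite /stein_deriv fE ramp0//; ring.
  rewrite f'E fE mulrN !normrN !ger0_norm; last 3 first.
  - by rewrite mulr_ge0// mulr_ge0//; lra.
  - by rewrite mulr_ge0//; lra.
  - by rewrite mulr_ge0.
  split.
  - by rewrite mulr_ile1.
  - by apply: le_trans (_ : 1 <= 2); [rewrite mulr_ile1//; lra|lra].
  - by rewrite mulrCA mulr_ile1//; rewrite mulr_ge0//; lra.
rewrite (ltr0_norm x0) => Ax; have x1 : 1 <= - x by lra.
have tx : x <= t by lra.
have [/andP[r0 r1] /andP[yr0 yr1] yyr] :=
  mills_ratio_bounds deriv_lower_tail lower_tail_cvg0 x1.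
set r := mills_ratio _ (- x) in r0 r1 yr0 yr1 yyr.
have fE : f x = (1 - p) * r.
  by rewrite /stein stein_integral_left// /r /mills_ratio mulrA opprK gauss_even.
have f'E : f' x = (1 - p) * (1 - (- x) * r) by rewrite /stein_deriv fE ramp1//; ring.
have q0 : 0 <= 1 - p by lra.
have q1 : 1 - p <= 1 by lra.
rewrite f'E fE -[`|x * _|]normrN -[- (x * _)]mulNr !ger0_norm; last 3 first.
- by apply: mulr_ge0; [lra|apply: mulr_ge0; lra].
- by rewrite mulr_ge0//; lra.
- by rewrite mulr_ge0.
split.
- by rewrite mulr_ile1.
- by apply: le_trans (_ : 1 <= 2); [rewrite mulr_ile1//; lra|lra].
- have yr : 0 <= - x * (1 - - x * r) by rewrite mulr_ge0//; lra.
  by rewrite mulrCA mulr_ile1.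
Qed.

(** Continuity gives bounds on a compact interval and [stein_tail] gives them outside.
    The derivative is Lipschitz because [x * f x] has the bounded derivative
    [f x + x * f' x] and [h] is Lipschitz. *)
Lemma stein_bounds : exists2 K, 0 <= K &
  (forall x, `|f' x| <= K) /\ (forall x y, `|f' x - f' y| <= K * `|x - y|).
Proof.
pose A := `|t| + `|t + delta| + 1.
have [K1 fK] := continuous_bounded A stein_continuous.
have [K2 f'K] := continuous_bounded A stein_deriv_continuous.
have [K3 xfK] : exists K, forall x, - A <= x <= A -> `|x * f' x| <= K.
  apply: continuous_bounded => x; apply: cvgM; first exact: cvg_id.
  exact: stein_deriv_continuous.
have [Kr Kr0 rK] := ramp_lip.
have b1 x : `|f x| <= `|K1| + 1.
  case: (leP `|x| A) => xA; last by have [h1 _ _] := stein_tail xA; have := normr_ge0 K1; lra.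
  by have := fK x; rewrite -ler_norml => /(_ xA); have := ler_norm K1; lra.
have b2 x : `|f' x| <= `|K2| + 2.
  case: (leP `|x| A) => xA; last by have [_ h1 _] := stein_tail xA; have := normr_ge0 K2; lra.
  by have := f'K x; rewrite -ler_norml => /(_ xA); have := ler_norm K2; lra.
have b3 x : `|x * f' x| <= `|K3| + 1.
  case: (leP `|x| A) => xA; last by have [_ _ h1] := stein_tail xA; have := normr_ge0 K3; lra.
  by have := xfK x; rewrite -ler_norml => /(_ xA); have := ler_norm K3; lra.
have lipx : forall x y, `|x * f x - y * f y| <= (`|K1| + `|K3| + 2) * `|x - y|.
  apply: (bounded_deriv_lip (f' := fun x => 1 * f x + x * f' x)) => x.
    by apply: derivM; [exact: deriv_id|exact: deriv_stein].
  rewrite mul1r; apply: le_trans (ler_normD _ _) _.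
  by have := b1 x; have := b3 x; lra.
exists (`|K1| + `|K2| + `|K3| + 2 + Kr) => [|].
  by rewrite !addr_ge0.
split=> [x|x y].
  by have := b2 x; have := normr_ge0 K1; have := normr_ge0 K3; lra.
have -> : f' x - f' y = (x * f x - y * f y) + (h x - h y).
  by rewrite /stein_deriv; ring.
apply: le_trans (ler_normD _ _) _.
have := lipx x y; have := rK x y.
have : 0 <= `|K2| * `|x - y| by rewrite mulr_ge0.
rewrite !mulrDl; lra.
Qed.

Lemma ramp_mean_ge : Phi t <= p.
Proof.
rewrite gauss_cdfE Rintegral_mkcond; apply: le_Rintegral => //.
  by rewrite -restrict_EFin -integrable_mkcond//; exact: integrableS gauss_integrable.
move=> x _; rewrite patchE; case: ifPn => [/[!inE]/= /[!in_itv]/= xt|_].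
  by rewrite ramp1// mul1r.
by rewrite mulr_ge0 ?ramp_ge0// ltW// gauss_gt0.
Qed.

Lemma ramp_mean_le : p <= Phi (t + delta).
Proof.
rewrite gauss_cdfE Rintegral_mkcond; apply: le_Rintegral => //.
  by rewrite -restrict_EFin -integrable_mkcond//; exact: integrableS gauss_integrable.
move=> x _; rewrite patchE; case: ifPn => [_|/negP].
  by rewrite ler_piMl ?ramp_le1// ltW// gauss_gt0.
rewrite inE/= in_itv/= => /negP; rewrite -ltNge => xt.
by rewrite ramp0 ?mul0r// ltW.
Qed.

End Solution.

End Gauss.

(** * A central limit theorem for locally dependent sums *)

Section SecondMoments.
Context {d : measure_display} {T : measurableType d} {R : realType}.
Variable P : probability T R.

Definition norm2 (f : T -> R) : R := Num.sqrt (\int[P]_w (f w ^+ 2)).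

Lemma norm2_ge0 f : 0 <= norm2 f. Proof. exact: sqrtr_ge0. Qed.

Lemma norm2_sqr f : norm2 f ^+ 2 = \int[P]_w (f w ^+ 2).
Proof. by rewrite sqr_sqrtr//; apply: mean_ge0 => w; exact: sqr_ge0. Qed.

Lemma mean_mul_le f g : bounded_rv f -> bounded_rv g ->
  \int[P]_w (f w * g w) <= norm2 f * norm2 g.
Proof.
move=> bf bg; apply: le_trans (ler_norm _) _.
rewrite -[leLHS]sqrtr_sqr /norm2 -sqrtrM; last by apply: mean_ge0 => w; exact: sqr_ge0.
by rewrite ler_wsqrtr//; exact: mean_Cauchy_Schwarz.
Qed.

Lemma mean_norm_le f : bounded_rv f -> \int[P]_w `|f w| <= norm2 f.
Proof.
move=> bf; have b1 : bounded_rv (fun=> 1 : R) := @bounded_rv_cst _ T R 1.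
have := mean_mul_le (bounded_rv_norm bf) b1.
rewrite (eq_mean P (g := fun w => `|f w|)); last by move=> w; rewrite mulr1.
move=> /le_trans; apply; rewrite /norm2.
rewrite [X in _ * Num.sqrt X](eq_mean P (g := fun=> 1)); last by move=> w; rewrite expr1n.
rewrite mean_cst sqrtr1 mulr1.
by rewrite (eq_mean P (g := fun w => f w ^+ 2))// => w; rewrite real_normK// num_real.
Qed.

Lemma norm2_triangle f g : bounded_rv f -> bounded_rv g ->
  norm2 (fun w => f w + g w) <= norm2 f + norm2 g.
Proof.
move=> bf bg; have nn := addr_ge0 (norm2_ge0 f) (norm2_ge0 g).
rewrite -[leRHS]ger0_norm// -sqrtr_sqr ler_wsqrtr//.
rewrite (eq_mean P (g := fun w => f w ^+ 2 + 2 * (f w * g w) + g w ^+ 2)); last first.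
  by move=> w; ring.
have bM h k : bounded_rv h -> bounded_rv k -> bounded_rv (fun w => h w * k w).
  exact: bounded_rvM.
have bf2 : bounded_rv (fun w => f w ^+ 2) by exact: bM.
have bg2 : bounded_rv (fun w => g w ^+ 2) by exact: bM.
have bfg : bounded_rv (fun w => 2 * (f w * g w)) by apply: bounded_rvZ; exact: bM.
rewrite meanD//; last exact: bounded_rvD.
rewrite meanD// meanZ; last exact: bM.
rewrite -!norm2_sqr sqrrD.
have := mean_mul_le bf bg; lra.
Qed.

Lemma norm2Z k f : bounded_rv f -> norm2 (fun w => k * f w) = `|k| * norm2 f.
Proof.
move=> bf; rewrite /norm2 (eq_mean P (g := fun w => k ^+ 2 * f w ^+ 2)); last first.
  by move=> w; rewrite exprMn.
have bf2 : bounded_rv (fun w => f w ^+ 2) by apply: bounded_rvM.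
by rewrite meanZ// sqrtrM ?sqr_ge0// sqrtr_sqr.
Qed.

Lemma norm2_diff f g : bounded_rv f -> bounded_rv g ->
  `|norm2 (fun w => f w + g w) - norm2 f| <= norm2 g.
Proof.
move=> bf bg; rewrite ler_norml; apply/andP; split; last first.
  by have := norm2_triangle bf bg; lra.
have bfg := bounded_rvD bf bg; have bNg := bounded_rvN bg.
have := norm2_triangle bfg bNg.
have -> : norm2 (fun w => f w + g w + - g w) = norm2 f.
  by congr norm2; apply/funext => w; rewrite addrK.
have -> : norm2 (fun w => - g w) = norm2 g.
  by congr Num.sqrt; apply: eq_mean => w; rewrite sqrrN.
lra.
Qed.

Lemma norm2_le f k : bounded_rv f -> (forall w, `|f w| <= k) -> norm2 f <= k.
Proof.
move=> bf fk; have k0 : 0 <= k.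
  rewrite -(mean_cst P k); apply: le_trans (_ : 0 <= \int[P]_w `|f w|) _.
    by apply: mean_ge0 => w.
  by apply: le_mean => //; [exact: bounded_rv_norm|exact: bounded_rv_cst].
rewrite -[leRHS]ger0_norm// -sqrtr_sqr ler_wsqrtr//.
rewrite -[leRHS](mean_cst P); apply: le_mean => [||w].
- exact: bounded_rvM.
- exact: bounded_rv_cst.
- by rewrite -[leLHS]real_normK ?num_real// ler_pXn2r// nnegrE.
Qed.

Lemma mean_sum_sqr n (e : nat -> T -> R) : (forall i, bounded_rv (e i)) ->
  \int[P]_w ((\sum_(i < n) e i w) ^+ 2) =
  \sum_(i < n) \sum_(j < n) \int[P]_w (e i w * e j w).
Proof.
move=> be; rewrite (eq_mean P (g := fun w => \sum_(i < n) \sum_(j < n) (e i w * e j w))).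
  rewrite mean_sum => [|i _].
    by apply: eq_bigr => i _; rewrite mean_sum// => j _; exact: bounded_rvM.
  by apply: bounded_rv_sum => j _; exact: bounded_rvM.
move=> w; rewrite expr2 mulr_suml; apply: eq_bigr => i _.
by rewrite mulr_sumr.
Qed.

Lemma mean_sum_sqr_orthogonal n (e : nat -> T -> R) : (forall i, bounded_rv (e i)) ->
  (forall i j, (i < j)%N -> \int[P]_w (e i w * e j w) = 0) ->
  \int[P]_w ((\sum_(i < n) e i w) ^+ 2) = \sum_(i < n) \int[P]_w (e i w ^+ 2).
Proof.
move=> be ortho; rewrite mean_sum_sqr//; apply: eq_bigr => i _.
rewrite (bigD1 i)//= [X in _ + X]big1 ?addr0// => j ji.
have [lt|lt|eq] := ltngtP i j.
- exact: ortho.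
- by rewrite (eq_mean P (g := fun w => e j w * e i w)) ?ortho// => w; exact: mulrC.
- by case/eqP: ji; apply: val_inj.
Qed.

Lemma near_indices n i m : (\sum_(j < n | (i < j + m) && (j < i + m)) 1 <= 2 * m)%N.
Proof.
rewrite -(big_mkord (fun j => (i < j + m) && (j < i + m))%N (fun=> 1%N)).
rewrite sum1_count -size_filter.
apply: leq_trans (_ : size (iota (i - m) (2 * m)) <= _)%N; last by rewrite size_iota.
apply: uniq_leq_size; first by rewrite filter_uniq// iota_uniq.
move=> j; rewrite mem_filter => /andP[/andP[h1 h2] _].
by rewrite mem_iota; lia.
Qed.

(** At most [2 * m] terms survive in each row of the expanded square. *)
Lemma mean_sum_sqr_local n m M (e : nat -> T -> R) : (forall i, bounded_rv (e i)) ->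
  (forall i w, `|e i w| <= M) ->
  (forall i j, (i + m <= j)%N -> \int[P]_w (e i w * e j w) = 0) ->
  \int[P]_w ((\sum_(i < n) e i w) ^+ 2) <= (2 * m * n)%:R * M ^+ 2.
Proof.
move=> be eM ortho; rewrite mean_sum_sqr//.
apply: le_trans (_ : \sum_(i < n) (2 * m)%:R * M ^+ 2 <= _); last first.
  by rewrite sumr_const card_ord -[leLHS]mulr_natr mulrAC -natrM.
apply: ler_sum => i _.
rewrite (bigID (fun j : 'I_n => (i < j + m) && (j < i + m))%N)/=.
rewrite [X in _ + X]big1 ?addr0 => [|j]; last first.
  rewrite negb_and -!leqNgt => /orP[h|h]; last exact: ortho.
  by rewrite (eq_mean P (g := fun w => e j w * e i w)) ?ortho// => w; exact: mulrC.
apply: le_trans (_ : \sum_(j < n | ((i < j + m) && (j < i + m))%N) M ^+ 2 <= _).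
  apply: ler_sum => j _; apply: le_trans (ler_norm _) _.
  apply: norm_mean_le => [|w]; first exact: bounded_rvM.
  by rewrite normrM expr2 ler_pM.
rewrite (_ : \sum_(j < n | _) _ =
    (\sum_(j < n | (i < j + m) && (j < i + m)) 1)%N%:R * M ^+ 2); last first.
  by rewrite natr_sum mulr_suml; apply: eq_bigr => j _; rewrite mul1r.
by rewrite ler_wpM2r ?sqr_ge0// ler_nat; exact: near_indices.
Qed.

End SecondMoments.

Section LocalDependence.
Context {d : measure_display} {T : measurableType d} {R : realType}.
Variables (P : probability T R) (n : nat) (e : nat -> T -> R) (K : R).
Hypothesis be : forall i, bounded_rv (e i).
Hypothesis eK : forall i w, `|e i w| <= K.

Definition local_sum (w : T) : R := \sum_(i < n) e i w.
(** The terms at distance at most one from [i], the term [i] included. *)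
Definition neighbours (i : nat) (w : T) : R :=
  \sum_(j < n | ((i < j + 2) && (j < i + 2))%N) e j w.
Local Notation S := local_sum.
Local Notation nb := neighbours.

Hypothesis rest_independent : forall i (g : R -> R), (i < n)%N -> lip g ->
  \int[P]_w (e i w * g (S w - nb i w)) = 0.
Hypothesis far_independent : forall i j, (i + 4 <= j)%N ->
  \int[P]_w ((e i w * nb i w - \int[P]_w' (e i w' * nb i w')) *
             (e j w * nb j w - \int[P]_w' (e j w' * nb j w'))) = 0.

Definition local_variance : R := \sum_(i < n) \int[P]_w (e i w * nb i w).
Local Notation V := local_variance.

Let bS : bounded_rv S. Proof. by apply: bounded_rv_sum => i _; exact: be. Qed.
Let bnb i : bounded_rv (nb i). Proof. by apply: bounded_rv_sum => j _; exact: be. Qed.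
Let benb i : bounded_rv (fun w => e i w * nb i w). Proof. exact: bounded_rvM. Qed.

Let K0 : 0 <= K.
Proof.
rewrite -(mean_cst P K); apply: le_trans (_ : 0 <= \int[P]_w `|e 0 w|) _.
  by apply: mean_ge0 => w.
by apply: le_mean => //; [exact: bounded_rv_norm|exact: bounded_rv_cst].
Qed.

Let nbK i w : `|nb i w| <= 4 * K.
Proof.
apply: le_trans (ler_norm_sum _ _ _) _.
apply: le_trans (_ : \sum_(j < n | ((i < j + 2) && (j < i + 2))%N) K <= _).
  by apply: ler_sum => j _; exact: eK.
rewrite (_ : \sum_(j < n | _) _ =
    (\sum_(j < n | (i < j + 2) && (j < i + 2)) 1)%N%:R * K); last first.
  by rewrite natr_sum mulr_suml; apply: eq_bigr => j _; rewrite mul1r.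
by rewrite ler_wpM2r// ler_nat; exact: near_indices.
Qed.

Let enbK i w : `|e i w * nb i w| <= 4 * K ^+ 2.
Proof. by rewrite normrM expr2 mulrCA ler_pM. Qed.

(** Stein's method. Removing the neighbours of [e i] from the sum makes the rest
    independent of [e i]; a first-order expansion of [f] then leaves
    [e i * nb i * f'], whose sum concentrates around the variance. *)
Lemma stein_local_bound (f f' : R -> R) (B Lam a kappa : R) :
  (forall x, deriv f x (f' x)) -> (forall x, `|f' x| <= B) ->
  (forall x y, `|f' x - f' y| <= Lam * `|x - y|) -> 0 <= Lam -> 0 < a ->
  a ^+ 2 * V = 1 -> n%:R * a ^+ 2 <= kappa ->
  `|\int[P]_w (f' (a * S w) - a * S w * f (a * S w))|
    <= (16 * Lam * K ^+ 3 * kappa + 8 * B * K ^+ 2 * Num.sqrt (8 * kappa)) * a.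
Proof.
move=> df f'B f'L Lam0 a0 aV nak; have a0' := ltW a0.
have lf : lip f.
  exists B; last exact: bounded_deriv_lip df f'B.
  exact: le_trans (f'B 0).
have lf' : lip f' by exists Lam.
have B0 : 0 <= B by exact: le_trans (f'B 0).
have lfa : lip (fun x => f (a * x)).
  have [L L0 fL] := lf; exists (L * a) => [|x y]; first by rewrite mulr_ge0// ltW.
  by apply: le_trans (fL _ _) _; rewrite -mulrA -mulrBr normrM gtr0_norm.
pose zeta i w := e i w * nb i w - \int[P]_w' (e i w' * nb i w').
have bz i : bounded_rv (zeta i).
  by apply: bounded_rvB => //; exact: bounded_rv_cst.
have zK i w : `|zeta i w| <= 8 * K ^+ 2.
  apply: le_trans (ler_normB _ _) _; have := enbK i w.
  by have := norm_mean_le P (benb i) (enbK i); lra.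
have baS : bounded_rv (fun w => a * S w) by exact: bounded_rvZ.
have bf'S : bounded_rv (fun w => f' (a * S w)) by exact: bounded_rv_comp.
have bfS : bounded_rv (fun w => f (a * S w)) by exact: bounded_rv_comp.
have bfSnb i : bounded_rv (fun w => f (a * (S w - nb i w))).
  by apply: (bounded_rv_comp lfa); exact: bounded_rvB.
(* the first-order remainder of [f] when the neighbours are removed *)
pose rem i w := e i w * (f (a * S w) - f (a * (S w - nb i w)))
  - a * (e i w * nb i w * f' (a * S w)).
have brem i : bounded_rv (rem i).
  apply: bounded_rvB; first by apply: bounded_rvM => //; exact: bounded_rvB.
  by apply: bounded_rvZ; exact: bounded_rvM.
have remK i w : `|rem i w| <= 16 * Lam * K ^+ 3 * a ^+ 2.
  have [z [zS fz]] := mean_value (a * S w) (a * (S w - nb i w)) df.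
  have e1 : a * (S w - nb i w) - a * S w = - (a * nb i w) by ring.
  rewrite e1 normrN normrM (gtr0_norm a0) in fz zS.
  have -> : rem i w = a * (e i w * nb i w) * (f' z - f' (a * S w)).
    rewrite /rem; have -> : f (a * S w) - f (a * (S w - nb i w)) = f' z * (a * nb i w).
      by rewrite -opprB fz; ring.
    by ring.
  rewrite !normrM (gtr0_norm a0) -normrM.
  have -> : 16 * Lam * K ^+ 3 * a ^+ 2 = a * (4 * K ^+ 2) * (Lam * (a * (4 * K))).
    by ring.
  apply: ler_pM => //; first by rewrite mulr_ge0.
    by rewrite ler_wpM2l.
  apply: le_trans (f'L _ _) _; rewrite ler_wpM2l//.
  by apply: le_trans zS _; rewrite ler_wpM2l.
have decomp w : f' (a * S w) - a * S w * f (a * S w) =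
    - a ^+ 2 * (f' (a * S w) * (\sum_(i < n) zeta i w))
    - a * (\sum_(i < n) rem i w)
    - a * (\sum_(i < n) e i w * f (a * (S w - nb i w))).
  have -> : \sum_(i < n) zeta i w = \sum_(i < n) e i w * nb i w - V.
    by rewrite sumrB.
  have -> : \sum_(i < n) rem i w = S w * f (a * S w)
      - \sum_(i < n) e i w * f (a * (S w - nb i w))
      - a * f' (a * S w) * \sum_(i < n) e i w * nb i w.
    rewrite /rem; move: (f (a * S w)) (f' (a * S w)) => y z.
    rewrite {1}/local_sum mulr_suml [X in _ = _ - X]mulr_sumr -!sumrB.
    by apply: eq_bigr => i _; ring.
  rewrite -[X in X - _ = _]mul1r -aV.
  ring.
have bsz : bounded_rv (fun w => \sum_(i < n) zeta i w) by apply: bounded_rv_sum.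
have bsr : bounded_rv (fun w => \sum_(i < n) rem i w) by apply: bounded_rv_sum.
have bse : bounded_rv (fun w => \sum_(i < n) e i w * f (a * (S w - nb i w))).
  by apply: bounded_rv_sum => i _; exact: bounded_rvM.
have bfz : bounded_rv (fun w => f' (a * S w) * (\sum_(i < n) zeta i w)).
  exact: bounded_rvM.
rewrite (eq_mean P decomp) meanB; last 2 first.
- by apply: bounded_rvB; exact: bounded_rvZ.
- exact: bounded_rvZ.
rewrite meanB; [|exact: bounded_rvZ..].
rewrite !meanZ//.
have -> : \int[P]_w (\sum_(i < n) e i w * f (a * (S w - nb i w))) = 0.
  rewrite mean_sum => [|i _]; last exact: bounded_rvM.
  by rewrite big1// => i _; exact: (rest_independent (ltn_ord i) lfa).
rewrite mulr0 subr0.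
have h1 : `|a * \int[P]_w (\sum_(i < n) rem i w)| <= 16 * Lam * K ^+ 3 * kappa * a.
  rewrite normrM (gtr0_norm a0) mulrC ler_wpM2r//.
  apply: norm_mean_le => // w; apply: le_trans (ler_norm_sum _ _ _) _.
  apply: le_trans (_ : \sum_(i < n) 16 * Lam * K ^+ 3 * a ^+ 2 <= _).
    exact: ler_sum.
  rewrite sumr_const card_ord -mulrnAr -[a ^+ 2 *+ n]mulr_natl ler_wpM2l//.
  by rewrite !mulr_ge0// exprn_ge0.
have h2 : `|\int[P]_w (f' (a * S w) * (\sum_(i < n) zeta i w))|
    <= B * (8 * K ^+ 2 * Num.sqrt (8 * n%:R)).
  apply: (le_trans (le_normr_Rintegral measurableT (bounded_rv_integrable P bfz))).
  apply: le_trans (_ : \int[P]_w (B * `|\sum_(i < n) zeta i w|) <= _).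
    apply: le_mean => [||w]; first exact: bounded_rv_norm.
      by apply: bounded_rvZ; exact: bounded_rv_norm.
    by rewrite normrM ler_wpM2r.
  rewrite meanZ; last exact: bounded_rv_norm.
  apply: ler_wpM2l => //; apply: le_trans (mean_norm_le P bsz) _.
  have K20 : 0 <= 8 * K ^+ 2 by rewrite mulr_ge0// exprn_ge0.
  rewrite -[8 * K ^+ 2]ger0_norm// -sqrtr_sqr -sqrtrM ?sqr_ge0// ler_wsqrtr//.
  apply: le_trans (mean_sum_sqr_local n bz zK far_independent) _.
  by rewrite mulrC ler_wpM2l ?sqr_ge0// natrM.
have h3 : a * Num.sqrt (8 * n%:R) <= Num.sqrt (8 * kappa).
  rewrite -[X in X * _](ger0_norm (ltW a0)) -sqrtr_sqr -sqrtrM ?sqr_ge0//.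
  by rewrite ler_wsqrtr// mulrCA ler_wpM2l// mulrC.
have h4 : `|- a ^+ 2 * \int[P]_w (f' (a * S w) * (\sum_(i < n) zeta i w))|
    <= 8 * B * K ^+ 2 * Num.sqrt (8 * kappa) * a.
  rewrite normrM normrN (ger0_norm (sqr_ge0 a)).
  apply: le_trans (_ : a ^+ 2 * (B * (8 * K ^+ 2 * Num.sqrt (8 * n%:R))) <= _).
    by rewrite ler_wpM2l ?sqr_ge0.
  have -> : a ^+ 2 * (B * (8 * K ^+ 2 * Num.sqrt (8 * n%:R))) =
    (8 * B * K ^+ 2 * a) * (a * Num.sqrt (8 * n%:R)) by ring.
  have -> : 8 * B * K ^+ 2 * Num.sqrt (8 * kappa) * a =
    (8 * B * K ^+ 2 * a) * Num.sqrt (8 * kappa) by ring.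
  by rewrite ler_wpM2l// !mulr_ge0// ?exprn_ge0// ltW.
apply: le_trans (ler_normB _ _) _; rewrite mulrDl addrC.
by apply: lerD.
Qed.

End LocalDependence.

(** * From Lipschitz test functions to convergence in distribution *)

Section WeakConvergence.
Context {d : measure_display} {T : measurableType d} {R : realType}.
Variable P : probability T R.

Lemma ramp_rv t delta (Z : T -> R) : 0 < delta -> measurable_fun [set: T] Z ->
  bounded_rv (fun w => ramp t delta (Z w)).
Proof.
move=> d0 mZ; split.
  by apply: measurableT_comp => //; apply: lip_measurable; exact: ramp_lip.
by exists 1 => w; rewrite ger0_norm ?ramp_ge0 ?ramp_le1.
Qed.

Let below (Z : T -> R) (t : R) : set T := Z @^-1` `]-oo, t]%classic.

Let measurable_below Z t : measurable_fun [set: T] Z -> measurable (below Z t).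
Proof. by move=> mZ; rewrite /below -[X in measurable X]setTI; exact: mZ. Qed.

Let indic_rv (A : set T) : measurable A -> bounded_rv (\1_A : T -> R).
Proof.
move=> mA; split; first exact: measurable_indic.
by exists 1 => w; rewrite indicE ger0_norm// lern1 leq_b1.
Qed.

Let mean_indic (A : set T) : measurable A -> \int[P]_w (\1_A w : R) = fine (P A).
Proof. by move=> mA; rewrite /Rintegral integral_indic// setIT. Qed.

Lemma probability_le_ramp t delta (Z : T -> R) : 0 < delta ->
  measurable_fun [set: T] Z ->
  fine (P (below Z t)) <= \int[P]_w ramp t delta (Z w).
Proof.
move=> d0 mZ; have mA := measurable_below t mZ.
rewrite -mean_indic//; apply: le_mean => [||w]; [exact: indic_rv|exact: ramp_rv|].
rewrite indicE; case: (boolP (w \in _)) => [|_]; last exact: ramp_ge0.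
by rewrite inE /below/= in_itv/= => Zt; rewrite ramp1.
Qed.

Lemma ramp_le_probability t delta (Z : T -> R) : 0 < delta ->
  measurable_fun [set: T] Z ->
  \int[P]_w ramp (t - delta) delta (Z w) <= fine (P (below Z t)).
Proof.
move=> d0 mZ; have mA := measurable_below t mZ.
rewrite -mean_indic//; apply: le_mean => [||w]; [exact: ramp_rv|exact: indic_rv|].
rewrite indicE; case: (boolP (w \in _)) => [_|]; first exact: ramp_le1.
rewrite notin_setE /below/= in_itv/= => /negP; rewrite -ltNge => tZ.
by rewrite ramp0// subrK ltW.
Qed.

(** The distribution functions are squeezed between averages of ramps, and the
    limit is continuous. *)
Lemma cvg_in_distribution_ramp (Z : nat -> T -> R) :
  (forall n, measurable_fun [set: T] (Z n)) ->
  (forall t delta, 0 < delta ->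
    \int[P]_w ramp t delta (Z n w) @[n --> \oo] --> ramp_mean t delta) ->
  cvg_in_distribution P Z (normal_prob 0 1).
Proof.
move=> mZ cvgZ t _.
have finP n : P (below (Z n) t) = (fine (P (below (Z n) t)))%:E.
  by rewrite fineK// fin_num_measure//; exact: measurable_below.
have -> : normal_prob 0 1 `]-oo, t]%classic = (gauss_cdf t)%:E.
  by rewrite /gauss_cdf fineK// fin_num_measure.
rewrite (eq_cvg _ _ finP); apply: cvg_EFin; first by near=> n.
apply/cvgrPdist_le => /= e e0.
have e20 : 0 < e / 2 by rewrite divr_gt0.
have cPhi : {for t, continuous gauss_cdf} := deriv_continuous (deriv_gauss_cdf t).
have [delta d0 Phid] : exists2 delta, 0 < delta &
    `|gauss_cdf t - gauss_cdf (t + delta)| < e / 2 /\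
    `|gauss_cdf t - gauss_cdf (t - delta)| < e / 2.
  have : nbhs t [set y | `|gauss_cdf t - gauss_cdf y| < e / 2].
    exact: (cvgr_dist_lt _ _ cPhi _ e20).
  move=> /nbhs_ballP[r /= r0 rP].
  exists (r / 2); first by rewrite divr_gt0.
  have r2 : `|r / 2| < r by rewrite ger0_norm; lra.
  by split; apply: rP; rewrite /ball/= opprD addrA subrr sub0r ?normrN ?opprK.
case: Phid => Phi1 Phi2.
near=> n.
have c1 : `|ramp_mean t delta - \int[P]_w ramp t delta (Z n w)| < e / 2.
  by near: n; exact: (cvgr_dist_lt _ _ (cvgZ t delta d0) _ e20).
have c2 : `|ramp_mean (t - delta) delta - \int[P]_w ramp (t - delta) delta (Z n w)|
    < e / 2.
  by near: n; exact: (cvgr_dist_lt _ _ (cvgZ (t - delta) delta d0) _ e20).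
have := probability_le_ramp t d0 (mZ n); have := ramp_le_probability t d0 (mZ n).
have := ramp_mean_le t d0; have := ramp_mean_ge (t - delta) d0.
move: c1 c2 Phi1 Phi2; rewrite !ltr_norml ler_norml.
move: (gauss_cdf t) (gauss_cdf (t + delta)) (gauss_cdf (t - delta + delta)).
move: (gauss_cdf (t - delta)) (ramp_mean _ _) (ramp_mean _ _) (\int[P]_w _).
move: (\int[P]_w _) (fine _) => a1 a2 a3 a4 a5 a6 a7 a8 a9.
by move=> /andP[? ?] /andP[? ?] /andP[? ?] /andP[? ?] *; apply/andP; split; lra.
Unshelve. all: by end_near. Qed.

(** The sum and its norm both change by at most [norm2 P Q], relative to
    [norm2 P S]. *)
Lemma normalization_close (S Q : T -> R) (h : R -> R) L :
  bounded_rv S -> bounded_rv Q -> lip h ->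
  (forall x y, `|h x - h y| <= L * `|x - y|) ->
  let U := fun w => S w + Q w in
  0 < norm2 P S -> 0 < norm2 P U ->
  `|\int[P]_w h (U w / norm2 P U) - \int[P]_w h ((norm2 P S)^-1 * S w)|
     <= 2 * L * (norm2 P Q / norm2 P S).
Proof.
move=> bS bQ lh hL U S0 U0.
have L0 : 0 <= L.
  by have := hL 1 0; rewrite subr0 normr1 mulr1; exact: le_trans.
have bU : bounded_rv U by exact: bounded_rvD.
set s := norm2 P S in S0 *; set u := norm2 P U in U0 *.
have bUu : bounded_rv (fun w => U w / u).
  by apply: bounded_rvM => //; exact: bounded_rv_cst.
have bSs : bounded_rv (fun w => s^-1 * S w) by exact: bounded_rvZ.
rewrite -meanB; [|exact: bounded_rv_comp..].
pose X w := `|(u^-1 - s^-1) * U w| + s^-1 * `|Q w|.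
have bX : bounded_rv X.
  apply: bounded_rvD; first by apply: bounded_rv_norm; exact: bounded_rvZ.
  by apply: bounded_rvZ; exact: bounded_rv_norm.
have bh : bounded_rv (fun w => h (U w / u) - h (s^-1 * S w)).
  by apply: bounded_rvB; exact: bounded_rv_comp.
apply: (le_trans (le_normr_Rintegral measurableT (bounded_rv_integrable P bh))).
apply: le_trans (_ : \int[P]_w (L * X w) <= _).
  apply: le_mean => [||w]; first exact: bounded_rv_norm.
    exact: bounded_rvZ.
  apply: le_trans (hL _ _) _; rewrite ler_wpM2l//.
  have -> : U w / u - s^-1 * S w = (u^-1 - s^-1) * U w + s^-1 * Q w.
    by rewrite /U; ring.
  apply: le_trans (ler_normD _ _) _; rewrite lerD2l normrM ger0_norm//.
  by rewrite invr_ge0 ltW.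
have -> : 2 * L * (norm2 P Q / s) = L * (norm2 P Q / s + norm2 P Q / s) by ring.
rewrite meanZ// ler_wpM2l//.
rewrite meanD; last 2 first.
- by apply: bounded_rv_norm; exact: bounded_rvZ.
- by apply: bounded_rvZ; exact: bounded_rv_norm.
rewrite meanZ; last exact: bounded_rv_norm.
have h1 : \int[P]_w `|(u^-1 - s^-1) * U w| <= norm2 P Q / s.
  apply: le_trans (mean_norm_le P (bounded_rvZ _ bU)) _.
  rewrite norm2Z// -/u.
  have -> : `|u^-1 - s^-1| * u = `|s - u| / s.
    rewrite -[X in _ * X]gtr0_norm// -normrM -[X in _ / X]gtr0_norm//.
    rewrite -normfV -normrM; congr `|_|; field.
    by rewrite !gt_eqF.
  rewrite ler_pM2r ?invr_gt0// distrC; exact: norm2_diff.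
have h2 : s^-1 * \int[P]_w `|Q w| <= norm2 P Q / s.
  by rewrite mulrC ler_pM2r ?invr_gt0//; exact: mean_norm_le.
exact: lerD.
Qed.

End WeakConvergence.

(** * The innovations of the cost *)

Lemma cvgn_lower_bound (R : realType) (u : nat -> R) (a : R) :
  u n @[n --> \oo] --> a -> exists m, forall n, m <= u n.
Proof.
move=> ua; have [N _ uN] : \forall n \near \oo, `|a - u n| < 1.
  exact: (cvgr_dist_lt _ _ ua _ ltr01).
exists (Num.min (a - 1) (- \sum_(k < N) `|u k|)) => n.
have [nN|Nn] := ltnP n N; last first.
  have := uN n Nn; rewrite /= ltr_norml ge_min => /andP[_ h].
  by apply/orP; left; lra.
rewrite ge_min; apply/orP; right; rewrite lerNl.
apply: le_trans (ler_norm _) _; rewrite normrN.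
by rewrite (bigD1 (Ordinal nN))//= lerDl sumr_ge0.
Qed.

Lemma cesaro_small (R : realType) (u : nat -> R) (C eta : R) :
  u n @[n --> \oo] --> 0 -> 0 < eta ->
  \forall n \near \oo, C + \sum_(k < n) u k <= eta * n%:R.
Proof.
move=> u0 eta0; have eta2 : 0 < eta / 2 by rewrite divr_gt0.
have := cvgr_dist_lt _ _ (cesaro u0) _ eta2.
move=> [N1 _ uN1].
exists (maxn N1.+1 (Num.truncn (2 * `|C| / eta)).+1) => // n /=.
rewrite geq_max => /andP[n1 n2].
case: n n1 n2 => // n n1 n2.
have n0 : 0 < n.+1%:R :> R by [].
have C1 : `|C| <= eta / 2 * n.+1%:R.
  have : 2 * `|C| / eta < n.+1%:R.
    by apply: lt_le_trans (truncnS_gt _) _; rewrite ler_nat.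
  by rewrite ltr_pdivrMr// => h; lra.
have := uN1 n n1; rewrite /arithmetic_mean /series/= big_mkord sub0r normrN.
rewrite normrM (gtr0_norm (_ : 0 < n.+1%:R^-1)) ?invr_gt0// mulrC ltr_pdivrMr//.
have := ler_norm C; have := ler_norm (\sum_(k < n.+1) u k).
lra.
Qed.

Section Innovation.
Context {d : measure_display} {T : measurableType d} {R : realType}.
Variables (P : probability T R) (E Y : nat -> T -> R) (b c q : R).
Hypothesis mE : forall i, measurable_fun [set: T] (E i).
Hypothesis mY : forall i, measurable_fun [set: T] (Y i).
Hypothesis E0b : forall i w, 0 <= E i w <= b.
Hypothesis Y01 : forall i w, 0 <= Y i w <= 1.
Hypothesis q01 : 0 <= q <= 1.

Definition variable (v : nat + nat) : T -> R :=
  match v with inl i => E i | inr i => Y i end.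

Hypothesis indep : mutually_independent P variable.
Hypothesis same_law : forall i (f : R -> R), continuous f ->
  \int[P]_w f (E i w) = \int[P]_w f (E 0%N w).
Hypothesis mean_delivery : forall i, \int[P]_w Y i w = q.

Variables (L l l2 : R -> R) (mu : R).
Hypotheses (lL : lip L) (ll : lip l) (ll2 : lip l2).
Hypothesis muE : mu = \int[P]_w E 0%N w.
Hypothesis lE : forall y, l y = \int[P]_w L (y - E 0%N w).
Hypothesis l2E : forall y, l2 y = \int[P]_w l (y - E 0%N w).

Local Notation events := (events_of variable).

(** The cost of a period, centered, when the stock is [u] before and [y] after the
    order, the demand is [z] and [r] tells whether the order is delivered at once.
    The demand takes the place of the order volume, from which it differs by a
    telescoping term. The last term is the effect of the demand on the mean delayed
    holding cost of the next period, accounted for when the demand occurs. *)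
Definition innovation (u y z r : R) : R :=
  c * (z - mu) + r * L (y - z) + (1 - r) * L (u - z) - q * l y - (1 - q) * l u
  + (1 - q) * (l (y - z) - l2 y).
Local Notation tau := innovation.

Let mvar i : measurable_fun [set: T] (variable i). Proof. by case: i. Qed.
Lemma innovation_rv d' (T' : measurableType d') (u y z r : T' -> R) :
  bounded_rv u -> bounded_rv y -> bounded_rv z -> bounded_rv r ->
  bounded_rv (fun w => tau (u w) (y w) (z w) (r w)).
Proof.
move=> bu by_ bz br.
have cst k : bounded_rv (fun=> k : R) := @bounded_rv_cst _ T' R k.
have byz : bounded_rv (fun w => y w - z w) by exact: bounded_rvB.
have buz : bounded_rv (fun w => u w - z w) by exact: bounded_rvB.
apply: bounded_rvD; last first.
  by apply: bounded_rvZ; apply: bounded_rvB; exact: bounded_rv_comp.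
apply: bounded_rvB; last by apply: bounded_rvZ; exact: bounded_rv_comp.
apply: bounded_rvB; last by apply: bounded_rvZ; exact: bounded_rv_comp.
apply: bounded_rvD; last first.
  by apply: bounded_rvM; [exact: bounded_rvB|exact: bounded_rv_comp].
apply: bounded_rvD; last by apply: bounded_rvM => //; exact: bounded_rv_comp.
by apply: bounded_rvZ; exact: bounded_rvB.
Qed.

Lemma innovation_lip : exists2 K, 0 <= K & forall u y u' y' z r, 0 <= r <= 1 ->
  `|tau u y z r - tau u' y' z r| <= K * (`|u - u'| + `|y - y'|).
Proof.
have [K1 K10 L1] := lL; have [K2 K20 L2] := ll; have [K3 K30 L3] := ll2.
have /andP[q0 q1] := q01; have p0 : 0 <= 1 - q by rewrite subr_ge0.
exists (K1 + 2 * K2 + K3) => [|u y u' y' z r /andP[r0 r1]].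
  by rewrite !addr_ge0// mulr_ge0.
have r0' : 0 <= 1 - r by rewrite subr_ge0.
have -> : tau u y z r - tau u' y' z r =
    r * (L (y - z) - L (y' - z)) + (1 - r) * (L (u - z) - L (u' - z))
    + q * (l y' - l y) + (1 - q) * (l u' - l u)
    + (1 - q) * (l (y - z) - l (y' - z)) + (1 - q) * (l2 y' - l2 y).
  by rewrite /innovation; ring.
have part (k A B K x x' : R) : 0 <= k <= 1 -> `|A - B| <= K * `|x - x'| -> 
    `|k * (A - B)| <= K * `|x - x'|.
  move=> /andP[k0 k1] AB; rewrite normrM (ger0_norm k0).
  by apply: le_trans AB; rewrite ler_piMl.
have zz (x x' : R) : x - z - (x' - z) = x - x' by ring.
have r01 : 0 <= r <= 1 by rewrite r0.
have r01' : 0 <= 1 - r <= 1 by rewrite r0' gerBl.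
have p01 : 0 <= 1 - q <= 1 by rewrite p0 gerBl.
have h1 := part _ _ _ _ _ _ r01 (L1 (y - z) (y' - z)).
have h2 := part _ _ _ _ _ _ r01' (L1 (u - z) (u' - z)).
have h3 := part _ _ _ _ _ _ q01 (L2 y' y).
have h4 := part _ _ _ _ _ _ p01 (L2 u' u).
have h5 := part _ _ _ _ _ _ p01 (L2 (y - z) (y' - z)).
have h6 := part _ _ _ _ _ _ p01 (L3 y' y).
rewrite zz in h1; rewrite zz in h2; rewrite zz in h5.
rewrite (distrC y') in h3; rewrite (distrC u') in h4; rewrite (distrC y') in h6.
have g1 := mulr_ge0 K20 (normr_ge0 (u - u')).
have g2 := mulr_ge0 K30 (normr_ge0 (u - u')).
have tri (a1 a2 a3 a4 a5 a6 : R) :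
    `|a1 + a2 + a3 + a4 + a5 + a6| <= `|a1| + `|a2| + `|a3| + `|a4| + `|a5| + `|a6|.
  by do 4! (apply: le_trans (ler_normD _ _) _; rewrite lerD2r); exact: ler_normD.
apply: le_trans (tri _ _ _ _ _ _) _.
move: h1 h2 h3 h4 h5 h6 g1 g2.
move: `|r * _| `|(1 - r) * _| `|q * _| => v1 v2 v3.
move: `|(1 - q) * (l u' - _)| `|(1 - q) * (l (y - z) - _)| => v4 v5.
move: `|(1 - q) * (l2 _ - _)| `|u - u'| `|y - y'| => v6 v7 v8 *.
lra.
Qed.

Lemma innovation_bounded M : exists K, forall u y z r,
  `|u| <= M -> `|y| <= M -> 0 <= z <= b -> 0 <= r <= 1 -> `|tau u y z r| <= K.
Proof.
have [K K0 tauK] := innovation_lip.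
pose g z := c * (z - mu) + L (0 - z) - l 0 + (1 - q) * (l (0 - z) - l2 0).
have lg : lip g.
  apply: lipD; last first.
    apply: lipZ; apply: lipD; [exact: lip_flip|exact: lip_cst].
  apply: lipD; last exact: lip_cst.
  apply: lipD; last exact: lip_flip.
  apply: lipZ; apply: lipD; last exact: lip_cst.
  by exists 1 => // x y; rewrite mul1r.
have [K1 gK1] := continuous_bounded b (lip_continuous lg).
exists (K * (M + M) + K1) => u y z r uM yM z0b r01.
have -> : tau u y z r = (tau u y z r - tau 0 0 z r) + g z.
  by rewrite /g /innovation; ring.
apply: le_trans (ler_normD _ _) _; apply: lerD.
  apply: le_trans (tauK _ _ _ _ _ _ r01) _.
  by rewrite !subr0 ler_wpM2l// lerD.
by apply: gK1; case/andP: z0b => z0 zb; apply/andP; split=> //; lra.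
Qed.

(** ** Independence of the periods *)

Definition period_variables (p : seq nat) : seq (nat + nat) :=
  map inl p ++ map inr p.
Local Notation vars := period_variables.

Lemma uniq_vars N (a1 a2 : pred nat) : (forall k, ~~ (a1 k && a2 k)) ->
  uniq (vars [seq k <- iota 0 N | a1 k] ++ vars [seq k <- iota 0 N | a2 k]).
Proof.
move=> a12.
have u a : uniq (vars [seq k <- iota 0 N | a k]).
  rewrite cat_uniq !map_inj_uniq ?filter_uniq ?iota_uniq//; try by move=> ? ? [].
  by rewrite andbT/=; apply/hasPn => _ /mapP[k _ ->]; apply/mapP => -[].
rewrite cat_uniq !u andbT/=; apply/hasPn => v v2; apply/negP => v1.
have mv a w : w \in vars [seq k <- iota 0 N | a k] ->
    a (match w with inl k => k | inr k => k end).
  by rewrite mem_cat => /orP[] /mapP[k]; rewrite mem_filter => /andP[ak _] ->.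
by have := a12 (match v with inl k => k | inr k => k end); rewrite (mv a1)// (mv a2).
Qed.

Lemma mem_vars N (a : pred nat) (k : nat) : (k < N)%N -> a k ->
  (inl k \in vars [seq k <- iota 0 N | a k]) && (inr k \in vars [seq k <- iota 0 N | a k]).
Proof.
move=> kN ak; have kf : k \in [seq k <- iota 0 N | a k] by rewrite mem_filter ak mem_iota.
by rewrite !mem_cat !(mem_map (f := inl)) ?(mem_map (f := inr)) ?kf ?orbT;
  try by move=> ? ? [].
Qed.

Lemma demand_rv J k : inl k \in J -> bounded_rv (E k : events J -> R).
Proof.
move=> kJ; split; first exact: (measurable_variable (X := variable) kJ).
by exists b => w; have /andP[e0 eb] := E0b k w; rewrite ger0_norm.
Qed.

Lemma delivery_rv J k : inr k \in J -> bounded_rv (Y k : events J -> R).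
Proof.
move=> kJ; split; first exact: (measurable_variable (X := variable) kJ).
by exists 1 => w; have /andP[e0 eb] := Y01 k w; rewrite ger0_norm.
Qed.

(** Periods are selected by a predicate, cut at [N] to obtain a finite list of
    variables. *)
Definition window (N : nat) (a : pred nat) :=
  events (vars [seq k <- iota 0 N | a k]).

Lemma window_demand N (a : pred nat) k : (k < N)%N -> a k ->
  bounded_rv (E k : window N a -> R).
Proof. by move=> kN ak; apply: demand_rv; have /andP[] := mem_vars kN ak. Qed.

Lemma window_delivery N (a : pred nat) k : (k < N)%N -> a k ->
  bounded_rv (Y k : window N a -> R).
Proof. by move=> kN ak; apply: delivery_rv; have /andP[] := mem_vars kN ak. Qed.

Lemma bounded_rv_window N a (f : window N a -> R) :
  bounded_rv f -> bounded_rv (f : T -> R).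
Proof. exact: (bounded_rv_events mvar). Qed.

Lemma bounded_rv_fst d1 d2 (T1 : measurableType d1) (T2 : measurableType d2)
  (f : T1 -> R) : bounded_rv f -> bounded_rv (fun z : T1 * T2 => f z.1).
Proof. by move=> [mf [K fK]]; split; [exact: measurableT_comp|exists K]. Qed.

Lemma bounded_rv_snd d1 d2 (T1 : measurableType d1) (T2 : measurableType d2)
  (f : T2 -> R) : bounded_rv f -> bounded_rv (fun z : T1 * T2 => f z.2).
Proof. by move=> [mf [K fK]]; split; [exact: measurableT_comp|exists K]. Qed.

Let bE i : bounded_rv (E i). Proof.
by split=> //; exists b => w; have /andP[? ?] := E0b i w; rewrite ger0_norm.
Qed.
Let bY i : bounded_rv (Y i).
Proof. by split=> //; exists 1 => w; have /andP[? ?] := Y01 i w; rewrite ger0_norm. Qed.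
Let cst k : bounded_rv (fun=> k : R) := @bounded_rv_cst _ T R k.
Let byE i y : bounded_rv (fun w => y - E i w). Proof. exact: bounded_rvB. Qed.
Let bf f i y : lip f -> bounded_rv (fun w => f (y - E i w)).
Proof. by move=> lf; exact: bounded_rv_comp. Qed.

Let mean_flip f i y : lip f -> \int[P]_w f (y - E i w) = \int[P]_w f (y - E 0%N w).
Proof.
by move=> lf; apply: (same_law i (f := fun z => f (y - z))); apply: lip_continuous; exact: lip_flip.
Qed.

Let mean_demand i : \int[P]_w E i w = mu.
Proof. by rewrite muE; apply: (same_law i (f := fun z => z)) => x; exact: cvg_id. Qed.

(** The innovation splits into terms that are averaged separately. *)
Let innovationE u y z r : tau u y z r = c * z + r * (L (y - z) - L (u - z))
  + L (u - z) + (1 - q) * l (y - z)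
  - (c * mu + q * l y + (1 - q) * l u + (1 - q) * l2 y).
Proof. by rewrite /innovation; ring. Qed.

Lemma innovation_mean u y j : \int[P]_w tau u y (E j w) (Y j w) = 0.
Proof.
rewrite (eq_mean P (fun w => innovationE u y (E j w) (Y j w))).
have bd : bounded_rv (fun w => L (y - E j w) - L (u - E j w)).
  by apply: bounded_rvB; exact: bf.
have bYL : bounded_rv (fun w => Y j w * (L (y - E j w) - L (u - E j w))).
  exact: bounded_rvM.
have bcE : bounded_rv (fun w => c * E j w) by exact: bounded_rvZ.
have bL : bounded_rv (fun w => L (u - E j w)) by exact: bf.
have bl : bounded_rv (fun w => (1 - q) * l (y - E j w)) by apply: bounded_rvZ; exact: bf.
have bs1 := bounded_rvD bcE bYL.
have bs2 := bounded_rvD bs1 bL.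
have bs3 := bounded_rvD bs2 bl.
rewrite meanB// mean_cst !meanD// meanZ// meanZ; last exact: bf.
rewrite mean_demand !mean_flip// -lE -l2E.
rewrite (mean_independentM mvar indep (J1 := [:: inr j]) (J2 := [:: inl j])
  (f := Y j) (g := fun w => L (y - E j w) - L (u - E j w)))//; last 2 first.
- by apply: delivery_rv; rewrite inE.
- have bx x : bounded_rv (fun w : events [:: inl j] => x - E j w).
    by apply: bounded_rvB; [exact: bounded_rv_cst|apply: demand_rv; rewrite inE].
  by apply: bounded_rvB; exact: bounded_rv_comp.
rewrite mean_delivery meanB; [|exact: bf..].
by rewrite !mean_flip// -!lE; ring.
Qed.

(** With the past frozen, what remains is [innovation_mean]. *)
Lemma innovation_centered j (Z u y : window j.+1 (fun k => k < j)%N -> R) :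
  bounded_rv Z -> bounded_rv u -> bounded_rv y ->
  \int[P]_w (Z w * tau (u w) (y w) (E j w) (Y j w)) = 0.
Proof.
move=> bZ bu by_.
pose W1 := window j.+1 (fun k => k < j)%N.
pose W2 := window j.+1 (fun k => k == j).
have bE2 : bounded_rv (E j : W2 -> R) by apply: window_demand.
have bY2 : bounded_rv (Y j : W2 -> R) by apply: window_delivery.
have disj k : ~~ ((k < j)%N && (k == j)).
  by apply/negP => /andP[kj /eqP e]; rewrite e ltnn in kj.
rewrite (mean_freeze mvar indep
  (phi := fun z : W1 * W2 => Z z.1 * tau (u z.1) (y z.1) (E j z.2) (Y j z.2)) (uniq_vars j.+1 disj)).
  transitivity (\int[P]_w (0 : R)); last exact: mean_cst.
  apply: eq_mean => w /=; rewrite meanZ ?innovation_mean ?mulr0//.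
  by apply: innovation_rv => //; exact: cst.
apply: bounded_rvM; first exact: bounded_rv_fst.
by apply: innovation_rv; [exact: bounded_rv_fst|exact: bounded_rv_fst|
  exact: bounded_rv_snd|exact: bounded_rv_snd].
Qed.

Section BaseInnovation.
Variable s : R.

(** The innovations of the limiting regime, in which the stock is raised to [s] in
    every period; it is [s] before the first order by convention. *)
Definition base_innovation (i : nat) (w : T) : R :=
  tau (if i is j.+1 then s - E j w else s) s (E i w) (Y i w).
Local Notation dd := base_innovation.

Lemma base_innovation_window N (a : pred nat) i : (i < N)%N -> a i ->
  (forall j, i = j.+1 -> a j) -> bounded_rv (dd i : window N a -> R).
Proof.
move=> iN ai aj; have cstw (k : R) : bounded_rv (fun=> k : R) :=
  @bounded_rv_cst _ (window N a) R k.
have bu : bounded_rv ((fun w => if i is j.+1 then s - E j w else s) : window N a -> R).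
  case: i iN ai aj => [|j] iN ai aj; first exact: cstw.
  apply: bounded_rvB; first exact: cstw.
  by apply: window_demand; [exact: ltnW|exact: aj].
by apply: innovation_rv => //; [exact: window_demand|exact: window_delivery].
Qed.

Lemma base_innovation_rv i : bounded_rv (dd i).
Proof.
exact: bounded_rv_window (@base_innovation_window i.+1 predT i (ltnSn i) isT (fun _ _ => isT)).
Qed.
Local Notation bdd := base_innovation_rv.

Lemma base_innovation_centered j (Z : T -> R) :
  bounded_rv (Z : window j.+1 (fun k => k < j)%N -> R) ->
  \int[P]_w (Z w * dd j w) = 0.
Proof.
move=> bZ; have bs : bounded_rv (fun w : window j.+1 (fun k => k < j)%N => s).
  exact: bounded_rv_cst.
have bu : bounded_rv ((fun w => if j is k.+1 then s - E k w else s) :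
    window j.+1 (fun k => k < j)%N -> R).
  case: (j) => [|k]; first exact: bounded_rv_cst.
  by apply: bounded_rvB; [exact: bounded_rv_cst|exact: window_demand].
exact: (innovation_centered bZ bu bs).
Qed.

Lemma base_innovation_orthogonal i j : (i < j)%N -> \int[P]_w (dd i w * dd j w) = 0.
Proof.
move=> ij; apply: base_innovation_centered.
by apply: base_innovation_window => [||k e]; lia.
Qed.

Lemma base_innovation_mean i : \int[P]_w dd i w = 0.
Proof.
rewrite -[RHS](@base_innovation_centered i (fun=> 1)); last exact: bounded_rv_cst.
by apply: eq_mean => w; rewrite mul1r.
Qed.

Local Notation nb n i := (neighbours n dd i).

(** Without the neighbours of [dd i], the sum involves neither the demand and the
    delivery of period [i] nor the demand of the period before. *)
Lemma base_innovation_rest n i (g : R -> R) : (i < n)%N -> lip g ->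
  \int[P]_w (dd i w * g (local_sum n dd w - nb n i w)) = 0.
Proof.
move=> ilt lg.
(* [a1] holds for the two periods on which [dd i] depends *)
pose a1 k := (k == i) || (k.+1 == i); pose a2 k := ~~ a1 k.
have rest w : local_sum n dd w - nb n i w =
    \sum_(j < n | ~~ ((i < j + 2) && (j < i + 2))%N) dd j w.
  rewrite /local_sum /neighbours.
  by rewrite (bigID (fun j : 'I_n => (i < j + 2) && (j < i + 2))%N)/= addrAC subrr add0r.
rewrite (eq_mean P (g := fun w => dd i w *
   g (\sum_(j < n | ~~ ((i < j + 2) && (j < i + 2))%N) dd j w))); last first.
  by move=> w; rewrite rest.
rewrite (mean_independentM mvar indep
  (J1 := vars [seq k <- iota 0 n | a1 k]) (J2 := vars [seq k <- iota 0 n | a2 k])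
  (f := dd i)
  (g := fun w => g (\sum_(j < n | ~~ ((i < j + 2) && (j < i + 2))%N) dd j w))).
- by rewrite base_innovation_mean mul0r.
- by apply: uniq_vars => k; rewrite /a2 andbN.
- by apply: base_innovation_window => //; [rewrite /a1 eqxx|
    move=> j e; rewrite /a1 e eqxx orbT].
- apply: bounded_rv_comp => //; apply: bounded_rv_sum => j jfar.
  apply: base_innovation_window => //; rewrite /a2 /a1.
    by move: jfar; lia.
  by move=> k jk; move: jfar; rewrite jk; lia.
Qed.

(** [dd i * nb n i] involves the periods from [i - 2] to [i + 1] only, and
    [dd j * nb n j] the periods from [j - 2] on. *)
Lemma base_innovation_far n i j : (i + 4 <= j)%N ->
  \int[P]_w ((dd i w * nb n i w - \int[P]_w' (dd i w' * nb n i w')) *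
             (dd j w * nb n j w - \int[P]_w' (dd j w' * nb n j w'))) = 0.
Proof.
move=> ij.
(* large enough for both windows *)
pose N := (n + j + 2)%N.
pose a1 k := (k < i + 2)%N; pose a2 k := (i + 2 <= k)%N.
have bnb (a : pred nat) k : (k < N)%N -> (forall m, (m < k + 2)%N -> (k < m + 3)%N -> a m) ->
    bounded_rv ((fun w => dd k w * nb n k w) : window N a -> R).
  move=> kN ak; apply: bounded_rvM.
    apply: base_innovation_window => //; first by apply: ak; lia.
    by move=> m km; apply: ak; lia.
  apply: bounded_rv_sum => m mk.
  apply: base_innovation_window; first by have := ltn_ord m; rewrite /N; lia.
    by apply: ak; lia.
  by move=> m' mm'; apply: ak; lia.
have b1 : bounded_rv ((fun w => dd i w * nb n i w) : window N a1 -> R).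
  by apply: bnb; rewrite ?/N ?/a1; lia.
have b2 : bounded_rv ((fun w => dd j w * nb n j w) : window N a2 -> R).
  by apply: bnb; rewrite ?/N ?/a2; lia.
rewrite (mean_independentM mvar indep
  (J1 := vars [seq k <- iota 0 N | a1 k]) (J2 := vars [seq k <- iota 0 N | a2 k])
  (f := fun w => dd i w * nb n i w - \int[P]_w' (dd i w' * nb n i w'))
  (g := fun w => dd j w * nb n j w - \int[P]_w' (dd j w' * nb n j w'))).
- rewrite meanB; [|exact: bounded_rv_window b1|exact: cst].
  by rewrite mean_cst subrr mul0r.
- by apply: uniq_vars => k; rewrite /a1 /a2; lia.
- by apply: bounded_rvB => //; exact: bounded_rv_cst.
- by apply: bounded_rvB => //; exact: bounded_rv_cst.
Qed.

(** Up to a constant, the conditional mean of the base innovation given the demand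
    of its own period. *)
Definition demand_effect (z : R) : R :=
  c * z + q * L (s - z) + 2 * (1 - q) * l (s - z).
Local Notation A := demand_effect.
Local Notation C := (\int[P]_w A (E 0%N w)).

Lemma demand_effect_lip : lip A.
Proof.
apply: lipD; first apply: lipD; first exact: lip_scale.
- by apply: lipZ; exact: lip_flip.
- by apply: lipZ; exact: lip_flip.
Qed.

Lemma mean_demand_effect : C = c * mu + q * l s + 2 * (1 - q) * l2 s.
Proof.
have b1 : bounded_rv (fun w => c * E 0%N w) by exact: bounded_rvZ.
have b2 : bounded_rv (fun w => q * L (s - E 0%N w)) by apply: bounded_rvZ; exact: bf.
have b3 : bounded_rv (fun w => 2 * (1 - q) * l (s - E 0%N w)).
  by apply: bounded_rvZ; exact: bf.
have b12 := bounded_rvD b1 b2.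
rewrite meanD// meanD// !meanZ//; last 2 first.
- exact: bf.
- exact: bf.
by rewrite -muE -lE -l2E.
Qed.

(** Averaging first over everything except the demand of period [i.+1]. *)
Lemma base_innovation_demand i :
  \int[P]_w (dd i.+1 w * (A (E i.+1 w) - C)) = \int[P]_w (A (E 0%N w) - C) ^+ 2.
Proof.
pose J1 : seq (nat + nat) := [:: inl i.+1].
pose J2 : seq (nat + nat) := [:: inl i; inr i.+1].
have lA := demand_effect_lip.
have bE1 : bounded_rv (E i.+1 : events J1 -> R) by apply: demand_rv; rewrite inE.
have bE2 : bounded_rv (E i : events J2 -> R) by apply: demand_rv; rewrite !inE eqxx.
have bY2 : bounded_rv (Y i.+1 : events J2 -> R) by apply: delivery_rv; rewrite !inE eqxx orbT.
have uJ : uniq (J1 ++ J2).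
  by rewrite /= !inE /= andbT; apply/negP => /orP[]// /eqP [] /eqP; rewrite eqn_leq ltnn.
have inner z : \int[P]_w' tau (s - E i w') s z (Y i.+1 w') = A z - C.
  rewrite (eq_mean P (g := fun w => Y i.+1 w * L (s - z) - Y i.+1 w * L ((s - z) - E i w)
     + L ((s - z) - E i w) - (1 - q) * l (s - E i w)
     + (c * (z - mu) - q * l s + (1 - q) * (l (s - z) - l2 s)))); last first.
    move=> w; rewrite /innovation (_ : s - E i w - z = s - z - E i w); ring.
  have bY1 : bounded_rv (fun w => Y i.+1 w * L (s - z)) by apply: bounded_rvM.
  have bY3 : bounded_rv (fun w => Y i.+1 w * L ((s - z) - E i w)).
    by apply: bounded_rvM => //; exact: bf.
  have bL : bounded_rv (fun w => L ((s - z) - E i w)) by exact: bf.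
  have bl : bounded_rv (fun w => (1 - q) * l (s - E i w)) by apply: bounded_rvZ; exact: bf.
  have b1 := bounded_rvB bY1 bY3.
  have b2 := bounded_rvD b1 bL.
  have b3 := bounded_rvB b2 bl.
  rewrite meanD// mean_cst meanB// meanD// meanB// meanZ; last exact: bf.
  rewrite !mean_flip// -lE -l2E.
  rewrite (eq_mean P (f := fun w => Y i.+1 w * L (s - z)) (g := fun w => L (s - z) * Y i.+1 w));
    last by move=> w; rewrite mulrC.
  rewrite meanZ// mean_delivery.
  rewrite (mean_independentM mvar indep (J1 := [:: inr i.+1]) (J2 := [:: inl i])
    (f := Y i.+1) (g := fun w => L (s - z - E i w)))//; last 2 first.
  - by apply: delivery_rv; rewrite inE.
  - apply: bounded_rv_comp => //; apply: bounded_rvB; first exact: bounded_rv_cst.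
    by apply: demand_rv; rewrite inE.
  rewrite mean_delivery mean_flip// -lE mean_demand_effect /demand_effect; ring.
rewrite (mean_freeze mvar indep (J1 := J1) (J2 := J2)
  (phi := fun z => tau (s - E i z.2) s (E i.+1 z.1) (Y i.+1 z.2) * (A (E i.+1 z.1) - C)) uJ).
  transitivity (\int[P]_w (A (E i.+1 w) - C) ^+ 2).
    apply: eq_mean => w /=.
    rewrite (eq_mean P (g := fun w' =>
      (A (E i.+1 w) - C) * tau (s - E i w') s (E i.+1 w) (Y i.+1 w'))); last first.
      by move=> w'; rewrite mulrC.
    rewrite meanZ ?inner ?expr2//.
    by apply: innovation_rv.
  apply: (same_law i.+1 (f := fun z => (A z - C) ^+ 2)) => x.
  apply: (@continuous_comp _ _ _ (fun z => A z - C) (fun z => z ^+ 2)).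
    by apply: cvgB; [exact: lip_continuous lA x|exact: cvg_cst].
  exact: sqr_continuous.
apply: bounded_rvM.
  apply: innovation_rv.
  - apply: bounded_rvB; first exact: bounded_rv_cst.
    by apply: bounded_rv_snd.
  - exact: bounded_rv_cst.
  - by apply: bounded_rv_fst.
  - by apply: bounded_rv_snd.
apply: bounded_rvB; last exact: bounded_rv_cst.
by apply: bounded_rv_comp => //; apply: bounded_rv_fst.
Qed.

(** Taking a conditional mean does not increase the variance. *)
Lemma base_innovation_variance i :
  \int[P]_w (A (E 0%N w) - C) ^+ 2 <= \int[P]_w (dd i.+1 w ^+ 2).
Proof.
have lA := demand_effect_lip.
have bA : bounded_rv (fun w => A (E i.+1 w) - C).
  by apply: bounded_rvB => //; exact: bounded_rv_comp.
have same : \int[P]_w (A (E i.+1 w) - C) ^+ 2 = \int[P]_w (A (E 0%N w) - C) ^+ 2.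
  apply: (same_law i.+1 (f := fun z => (A z - C) ^+ 2)) => x.
  apply: (@continuous_comp _ _ _ (fun z => A z - C) (fun z => z ^+ 2)).
    by apply: cvgB; [exact: lip_continuous lA x|exact: cvg_cst].
  exact: sqr_continuous.
have bdd2 : bounded_rv (fun w => dd i.+1 w ^+ 2) by apply: bounded_rvM; exact: bdd.
have bdA : bounded_rv (fun w => 2 * (dd i.+1 w * (A (E i.+1 w) - C))).
  by apply: bounded_rvZ; apply: bounded_rvM => //; exact: bdd.
have bA2 : bounded_rv (fun w => (A (E i.+1 w) - C) ^+ 2) by apply: bounded_rvM.
have : 0 <= \int[P]_w ((dd i.+1 w - (A (E i.+1 w) - C)) ^+ 2).
  by apply: mean_ge0 => w; exact: sqr_ge0.
rewrite (eq_mean P (g := fun w => dd i.+1 w ^+ 2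
    - 2 * (dd i.+1 w * (A (E i.+1 w) - C)) + (A (E i.+1 w) - C) ^+ 2)); last first.
  by move=> w; ring.
rewrite meanD//; last exact: bounded_rvB.
rewrite meanB// meanZ; last by apply: bounded_rvM => //; exact: bdd.
by rewrite base_innovation_demand same; lra.
Qed.

Lemma base_innovation_bounded : exists K, forall i w, `|dd i w| <= K.
Proof.
have b0 : 0 <= b by have /andP[+ +] := E0b 0%N (point : T); exact: le_trans.
have [K KP] := innovation_bounded (`|s| + b).
exists K => i w; apply: KP => //; last by rewrite lerDl.
case: i => [|i]; first by rewrite lerDl.
apply: le_trans (ler_normB _ _) _; rewrite lerD2l.
by have /andP[e0 eb] := E0b i w; rewrite ger0_norm.
Qed.

Local Notation Sd n := (local_sum n dd).

Lemma base_sum_norm2 n : norm2 P (Sd n) ^+ 2 = \sum_(i < n) \int[P]_w (dd i w ^+ 2).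
Proof.
rewrite norm2_sqr; exact: mean_sum_sqr_orthogonal bdd base_innovation_orthogonal.
Qed.

Lemma base_local_variance n : local_variance P n dd = norm2 P (Sd n) ^+ 2.
Proof.
rewrite base_sum_norm2; apply: eq_bigr => i _.
rewrite (eq_mean P (g := fun w => \sum_(j < n | ((i < j + 2) && (j < i + 2))%N)
  (dd i w * dd j w))); last by move=> w; rewrite mulr_sumr.
rewrite mean_sum => [|j _]; last by apply: bounded_rvM; exact: bdd.
rewrite (bigD1 i)/=; last by lia.
rewrite [X in _ + X]big1 ?addr0 => [|j /andP[_ ji]]; first exact: eq_mean.
have [lt|lt|eq] := ltngtP i j.
- exact: base_innovation_orthogonal.
- rewrite (eq_mean P (g := fun w => dd j w * dd i w)) => [|w]; last by rewrite mulrC.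
  exact: base_innovation_orthogonal.
- by case/eqP: ji; apply: val_inj.
Qed.

Local Notation v := (\int[P]_w (A (E 0%N w) - C) ^+ 2).

Lemma base_sum_norm2_ge n : (1 < n)%N -> 0 < v ->
  n%:R * (v / 2) <= norm2 P (Sd n) ^+ 2.
Proof.
case: n => [//|n n1 v0]; rewrite base_sum_norm2 big_ord_recl.
apply: ler_wpDl; first by apply: mean_ge0 => w; exact: sqr_ge0.
apply: le_trans (_ : \sum_(i < n) v <= _); last first.
  by apply: ler_sum => i _; exact: base_innovation_variance.
have n2 : n.+1%:R <= 2 * n%:R :> R by rewrite -natrM ler_nat; lia.
rewrite sumr_const card_ord -[leRHS]mulr_natl mulrA ler_pdivrMr// mulrAC.
apply: ler_wpM2r; first exact: (ltW v0).
by rewrite mulrC.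
Qed.

(** Two base innovations share a demand only if they are adjacent, so Stein's method
    applies; the error is of the order of the inverse of [norm2 P (Sd n)]. *)
Lemma base_sum_ramp t delta : 0 < delta -> 0 < v ->
  \int[P]_w ramp t delta ((norm2 P (Sd n))^-1 * Sd n w) @[n --> \oo]
    --> ramp_mean t delta.
Proof.
move=> d0 v0; have [B B0 [fB fL]] := stein_bounds t d0.
have [K KP] := base_innovation_bounded.
(* the variance is at least [n%:R * (v / 2)] *)
pose kappa := 2 / v; have kappa0 : 0 < kappa by rewrite divr_gt0.
pose G := 16 * B * K ^+ 3 * kappa + 8 * B * K ^+ 2 * Num.sqrt (8 * kappa).
apply/cvgrPdist_le => /= eps eps0.
have eps1 : 0 < eps / (`|G| + 1) by rewrite divr_gt0// ltr_wpDl.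
pose N := (Num.truncn (kappa / (eps / (`|G| + 1)) ^+ 2)).+2.
exists N => // n /= Nn; have n2 : (1 < n)%N by apply: leq_trans Nn; rewrite ltnS.
have n0 : 0 < n%:R :> R by rewrite ltr0n; exact: ltnW.
have V0 := base_sum_norm2_ge n2 v0.
have V1 : 0 < norm2 P (Sd n) ^+ 2.
  by apply: lt_le_trans V0; rewrite mulr_gt0// divr_gt0.
have s0 : 0 < norm2 P (Sd n) by rewrite lt_def norm2_ge0 andbT -sqrf_eq0 gt_eqF.
set a := (norm2 P (Sd n))^-1; have a0 : 0 < a by rewrite invr_gt0.
have nak : n%:R * a ^+ 2 <= kappa.
  rewrite exprVn ler_pdivrMr// /kappa.
  by have := ler_wpM2l (ltW kappa0) V0; rewrite /kappa; congr (_ <= _); field; rewrite gt_eqF.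
have aV : a ^+ 2 * local_variance P n dd = 1.
  by rewrite base_local_variance -exprMn mulVf ?expr1n// gt_eqF.
have := stein_local_bound bdd KP (@base_innovation_rest n) (@base_innovation_far n)
  (deriv_stein t d0) fB fL B0 a0 aV nak.
set I1 := \int[P]_w (_ - _); have -> : I1 = \int[P]_w ramp t delta (a * Sd n w) - ramp_mean t delta.
  rewrite -[ramp_mean _ _](mean_cst P) -meanB; last 2 first.
  - apply: (bounded_rv_comp (ramp_lip t d0)); apply: bounded_rvZ.
    by apply: bounded_rv_sum => i _; exact: bdd.
  - exact: bounded_rv_cst.
  by apply: eq_mean => w; rewrite /stein_deriv; ring.
rewrite distrC => /le_trans; apply.
apply: le_trans (_ : (`|G| + 1) * a <= _).
  by rewrite ler_wpM2r ?(ltW a0)// (le_trans (ler_norm _))// lerDl.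
rewrite mulrC -ler_pdivlMr; last by rewrite ltr_wpDl.
have ep := ltW eps1; have a0' := ltW a0.
rewrite -(ler_pXn2r (_ : 0 < 2)%N)// -(ler_pM2l n0).
apply: le_trans nak _; rewrite -ler_pdivrMr ?exprn_gt0//.
apply: ltW; apply: lt_le_trans (truncnS_gt _) _.
by rewrite ler_nat; exact: ltnW.
Qed.

End BaseInnovation.

(** ** The cost of a base-stock policy *)

Section Policy.
Local Notation J := (fun y => q * l y + (1 - q) * l2 y).

Variables (up : nat -> R -> R) (S : nat -> R) (s x : R).
Hypothesis upE : forall k y, up k.+2 y = Num.max y (S k.+2).
Hypothesis up1 : (exists s1, forall y, up 1 y = Num.max y s1) \/
  (forall y, up 1 y = y).
Hypothesis S_le : forall k, S k.+2 <= s.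
Hypothesis S_cvg : S n @[n --> \oo] --> s.
Hypothesis Jmin : forall y, J s <= J y.
Hypothesis Jdec : forall y z, y <= z <= s -> J z <= J y.
Hypothesis gap : exists B, forall n, \sum_(k < n) (J (S k.+2) - J s) <= B.
Hypothesis x_le : x <= s.

Fixpoint stock (n i : nat) (w : T) : R :=
  if i is j.+1 then up (n - j) (stock n j w) - E j w else x.
Definition raised (n i : nat) (w : T) : R := up (n - i) (stock n i w).
Definition process_cost (n : nat) (w : T) : R :=
  \sum_(i < n) (c * (raised n i w - stock n i w) + Y i w * L (raised n i w - E i w)
    + (1 - Y i w) * L (stock n i w - E i w)).
Definition step_innovation n i w : R :=
  tau (stock n i w) (raised n i w) (E i w) (Y i w).
(** The boundary terms of the telescoping sums, and the excess of the stage cost over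
    its minimum. *)
Definition remainder n w : R :=
  c * (stock n n w - x) - (1 - q) * (l (stock n n w) - l x)
  + \sum_(i < n) (J (raised n i w) - J s).

(** The order volume telescopes, and so do the averaged holding costs of the stock
    on hand: what is left per period is an innovation and the stage cost [J]. *)
Lemma process_costE n w : process_cost n w =
  \sum_(i < n) step_innovation n i w + (n%:R * (c * mu + J s) + remainder n w).
Proof.
rewrite /process_cost /remainder.
have : forall m, \sum_(i < m) (c * (raised n i w - stock n i w)
      + Y i w * L (raised n i w - E i w) + (1 - Y i w) * L (stock n i w - E i w)) =
    \sum_(i < m) step_innovation n i w + (m%:R * (c * mu + J s) +
    (c * (stock n m w - x) - (1 - q) * (l (stock n m w) - l x)
     + \sum_(i < m) (J (raised n i w) - J s))); last exact.
elim=> [|m IHm]; first by rewrite !big_ord0/=; ring.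
rewrite !big_ord_recr/= IHm -/(raised n m w) -[m.+1]addn1 natrD.
rewrite /step_innovation /innovation.
move: (\sum_(i < m) _) (\sum_(i < m) _) => a1 a2; ring.
Qed.

Let S_lower : exists m, forall k, m <= S k.+2.
Proof. by have [m mS] := cvgn_lower_bound S_cvg; exists m => k; exact: mS. Qed.

Lemma up_ge n y : (0 < n)%N -> y <= up n y.
Proof.
case: n => [//|[_|n _]]; last by rewrite upE le_max lexx.
by case: up1 => [[s1 ->]|->//]; rewrite le_max lexx.
Qed.

Lemma stock_le n i w : (i < n)%N -> stock n i w <= s.
Proof.
elim: i => [|i IHi] lin /=; first exact: x_le.
have /andP[E0 _] := E0b i w.
have -> : (n - i)%N = (n - i - 2).+2 by lia.
rewrite upE; apply: le_trans (_ : Num.max (stock n i w) (S (n - i - 2).+2) <= _).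
  by rewrite gerBl.
by rewrite ge_max S_le IHi// ltnW.
Qed.

Lemma raised_le n i w : (i.+1 < n)%N -> S (n - i) <= raised n i w <= s.
Proof.
move=> lin; rewrite /raised; have -> : (n - i)%N = (n - i - 2).+2 by lia.
by rewrite upE le_max lexx orbT ge_max S_le stock_le// ltnW.
Qed.

Lemma stock_bounded : exists M, forall n i w,
  ((i <= n)%N -> `|stock n i w| <= M) /\ ((i < n)%N -> `|raised n i w| <= M).
Proof.
have [m mS] := S_lower.
have [s1 s1P] : exists s1, forall y, y <= s -> up 1 y <= s1.
  case: up1 => [[s1 s1E]|s1E]; last by exists s => y; rewrite s1E.
  exists (Num.max s s1) => y ys; rewrite s1E ge_max !le_max ys lexx orbT.
  by [].
pose lo := Num.min x (m - b); pose hi := Num.max s s1.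
have low n i w : (i < n)%N -> lo <= stock n i w.
  case: i => [|i] lin /=; first by rewrite /lo ge_min lexx.
  have /andP[r1 _] := raised_le w lin.
  rewrite -/(raised n i w) /lo ge_min; apply/orP; right.
  have /andP[_ Eb] := E0b i w; have := mS (n - i - 2)%N.
  by rewrite (_ : (n - i - 2).+2 = n - i)%N; [lra|lia].
have b0 : 0 <= b by have /andP[+ +] := E0b 0%N (point : T); exact: le_trans.
have rlow n i w : (i < n)%N -> lo <= raised n i w.
  by move=> lin; apply: le_trans (low n i w lin) _; apply: up_ge; rewrite subn_gt0.
have rhi n i w : (i < n)%N -> raised n i w <= hi.
  move=> lin; have [lin1|lin1] := ltnP i.+1 n.
    by have /andP[_ h] := raised_le w lin1; rewrite le_max h.
  rewrite /raised (_ : n - i = 1)%N; last by lia.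
  by rewrite /hi le_max s1P ?orbT// stock_le.
have slow n i w : (i <= n)%N -> lo - b <= stock n i w.
  rewrite leq_eqVlt => /orP[/eqP ->|lin]; last first.
    by have := low n i w lin; lra.
  case: n => [|n] /=; first by rewrite /lo; have : Num.min x (m - b) <= x by [rewrite ge_min lexx]; lra.
  rewrite -/(raised n.+1 n w); have /andP[_ Eb] := E0b n w.
  by have := rlow n.+1 n w (ltnSn n); lra.
have shi n i w : (i <= n)%N -> stock n i w <= hi.
  case: i => [|i] lin /=; first by rewrite /hi le_max x_le.
  rewrite -/(raised n i w); have /andP[E0 _] := E0b i w.
  by have := rhi n i w lin; lra.
exists (`|lo| + `|hi| + b) => n i w.
have := ler_norm hi; have := ler_norm (- lo); rewrite normrN.
have := normr_ge0 hi; have := normr_ge0 lo.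
move=> lo0 hi0 h1 h2; split=> lin; rewrite ler_norml; apply/andP; split.
- by have := slow n i w lin; lra.
- by have := shi n i w lin; lra.
- by have := rlow n i w lin; lra.
- by have := rhi n i w lin; lra.
Qed.

Let lJ : lip J.
Proof. by apply: lipD; apply: lipZ. Qed.

(** The stage costs at the levels have summable gaps, and only in the last period can
    the stock be raised to something else than a value between the level and [s]. *)
Lemma remainder_bounded : exists K, forall n w, `|remainder n w| <= K.
Proof.
have [M MP] := stock_bounded; have [B BP] := gap.
have [Kl lK] := continuous_bounded M (lip_continuous ll).
have [KJ JK] := continuous_bounded M (lip_continuous lJ).
have p0 : 0 <= 1 - q by case/andP: q01 => _ q1; rewrite subr_ge0.
exists (`|c| * (M + `|x|) + (1 - q) * (Kl + `|l x|) + (`|B| + (KJ + `|J s|))) => n w.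
have [sM _] := MP n n w; have {}sM := sM (leqnn n).
apply: le_trans (ler_normD _ _) _; apply: lerD.
  apply: le_trans (ler_normB _ _) _; apply: lerD.
    by rewrite normrM ler_wpM2l// (le_trans (ler_normB _ _))// lerD2r.
  rewrite normrM (ger0_norm p0) ler_wpM2l// (le_trans (ler_normB _ _))// lerD2r.
  by apply: lK; rewrite -ler_norml.
have M0 : 0 <= M by exact: le_trans (normr_ge0 _) sM.
have KJ0 : 0 <= KJ by apply: le_trans (normr_ge0 _) (JK 0 _); rewrite oppr_le0 M0.
case: n {sM} => [|m].
  by rewrite big_ord0 normr0 !addr_ge0.
rewrite big_ord_recr/=; apply: le_trans (ler_normD _ _) _; apply: lerD; last first.
  apply: le_trans (ler_normB _ _) _; rewrite lerD2r; apply: JK.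
  by rewrite -ler_norml; have [_ ->] := MP m.+1 m w.
rewrite ger0_norm; last by apply: sumr_ge0 => i _; rewrite subr_ge0; exact: Jmin.
apply: le_trans (_ : \sum_(i < m) (J (S (m.+1 - i)%N) - J s) <= _).
  apply: ler_sum => i _; rewrite lerD2r; apply: Jdec; apply: raised_le.
  exact: (ltn_ord i).
rewrite (reindex_inj rev_ord_inj)/=.
rewrite (eq_bigr (fun k : 'I_m => J (S k.+2) - J s)) => [|k _].
  by apply: le_trans (BP m) (ler_norm _).
by rewrite (_ : (m.+1 - (m - k.+1) = k.+2)%N)//; have := ltn_ord k; lia.
Qed.

Lemma up_lip k : (0 < k)%N -> lip (up k).
Proof.
have lid : lip (fun y : R => y) by exists 1 => // y z; rewrite mul1r.
have lmax r : lip (fun y : R => Num.max y r) := lip_max r lid.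
case: k => [//|[_|k _]].
  case: up1 => [[s1 h]|h].
    by rewrite (_ : up 1 = (fun y => Num.max y s1)) //; apply/funext.
  by rewrite (_ : up 1 = id) //; apply/funext.
by rewrite (_ : up k.+2 = (fun y => Num.max y (S k.+2)))//; apply/funext.
Qed.

Lemma stock_window N (a : pred nat) n i : (i <= n)%N -> (i <= N)%N ->
  (forall k, (k < i)%N -> a k) -> bounded_rv (stock n i : window N a -> R).
Proof.
elim: i => [|i IHi] ilen ileN ia; first exact: bounded_rv_cst.
apply: bounded_rvB; last by apply: window_demand => //; exact: ia.
apply: bounded_rv_comp; first by apply: up_lip; rewrite subn_gt0.
apply: IHi; [exact: ltnW|exact: ltnW|move=> k ki; apply: ia; exact: ltnW].
Qed.

Lemma raised_window N (a : pred nat) n i : (i < n)%N -> (i <= N)%N ->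
  (forall k, (k < i)%N -> a k) -> bounded_rv (raised n i : window N a -> R).
Proof.
move=> ilen ileN ia; apply: bounded_rv_comp; first by apply: up_lip; rewrite subn_gt0.
by apply: stock_window => //; exact: ltnW.
Qed.

Lemma process_cost_rv n : bounded_rv (process_cost n).
Proof.
apply: bounded_rv_sum => i _.
have bs : bounded_rv (stock n i).
  by apply: (@bounded_rv_window i predT); apply: stock_window => //; exact: ltnW.
have br : bounded_rv (raised n i) by apply: (@bounded_rv_window i predT); apply: raised_window.
apply: bounded_rvD; last apply: bounded_rvM; first apply: bounded_rvD.
- by apply: bounded_rvZ; exact: bounded_rvB.
- by apply: bounded_rvM => //; apply: bounded_rv_comp => //; exact: bounded_rvB.
- exact: bounded_rvB.
- by apply: bounded_rv_comp => //; exact: bounded_rvB.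
Qed.

Lemma remainder_rv n : bounded_rv (remainder n).
Proof.
have bs : bounded_rv (stock n n) by apply: (@bounded_rv_window n predT); exact: stock_window.
apply: bounded_rvD; last first.
  apply: bounded_rv_sum => i _; apply: bounded_rvB => //.
  apply: (bounded_rv_comp lJ); apply: (@bounded_rv_window i predT).
  exact: raised_window.
apply: bounded_rvB; first by apply: bounded_rvZ; exact: bounded_rvB.
by apply: bounded_rvZ; apply: bounded_rvB => //; exact: bounded_rv_comp.
Qed.

Lemma step_innovation_window N (a : pred nat) n i : (i < n)%N -> (i < N)%N ->
  (forall k, (k <= i)%N -> a k) -> bounded_rv (step_innovation n i : window N a -> R).
Proof.
move=> ilen ileN ia; have ai : a i by exact: ia.
have ia' k : (k < i)%N -> a k by move=> ki; apply: ia; exact: ltnW.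
apply: innovation_rv.
- by apply: stock_window => //; exact: ltnW.
- by apply: raised_window => //; exact: ltnW.
- exact: window_demand.
- exact: window_delivery.
Qed.

Lemma step_innovation_rv n i : (i < n)%N -> bounded_rv (step_innovation n i).
Proof. by move=> lin; apply: (@bounded_rv_window i.+1 predT); exact: step_innovation_window. Qed.

Definition deviation n i w : R :=
  if (i < n)%N then step_innovation n i w - base_innovation s i w else 0.

Lemma deviation_window N (a : pred nat) n i : (i < N)%N ->
  (forall k, (k <= i)%N -> a k) -> bounded_rv (deviation n i : window N a -> R).
Proof.
move=> iN ia; rewrite /deviation; case: (boolP (i < n)%N) => lin; last exact: bounded_rv_cst.
apply: bounded_rvB; first exact: step_innovation_window.
by apply: base_innovation_window => // [|j ij]; apply: ia => //; rewrite ij.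
Qed.

Lemma deviation_rv n i : bounded_rv (deviation n i).
Proof. by apply: (@bounded_rv_window i.+1 predT); exact: deviation_window. Qed.

(** The stock and the level it is raised to are decided before the demand and the
    delivery of the period are known. *)
Lemma step_innovation_centered n j (Z : T -> R) : (j < n)%N ->
  bounded_rv (Z : window j.+1 (fun k => k < j)%N -> R) ->
  \int[P]_w (Z w * step_innovation n j w) = 0.
Proof.
move=> jn bZ; pose a := (fun k => k < j)%N.
have bs : bounded_rv (stock n j : window j.+1 a -> R).
  by apply: stock_window => //; exact: ltnW.
have br : bounded_rv (raised n j : window j.+1 a -> R).
  by apply: raised_window => //; exact: ltnW.
exact: (innovation_centered bZ bs br).
Qed.

Lemma deviation_orthogonal n i j : (i < j)%N ->
  \int[P]_w (deviation n i w * deviation n j w) = 0.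
Proof.
move=> ij; pose a := (fun k => k < j)%N.
have bi : bounded_rv (deviation n i : window j.+1 a -> R).
  by apply: deviation_window; [exact: ltnW|move=> k ki; exact: leq_ltn_trans ki ij].
have bi' := bounded_rv_window bi.
rewrite {2}/deviation; case: (boolP (j < n)%N) => jn; last first.
  by rewrite -[RHS](mean_cst P 0); apply: eq_mean => w; rewrite mulr0.
rewrite (eq_mean P (g := fun w => deviation n i w * step_innovation n j w
  - deviation n i w * base_innovation s j w)); last by move=> w; rewrite mulrBr.
rewrite meanB; last 2 first.
- by apply: bounded_rvM => //; exact: step_innovation_rv.
- by apply: bounded_rvM => //; exact: base_innovation_rv.
by rewrite step_innovation_centered// base_innovation_centered// subrr.
Qed.

Lemma deviation_bounded : exists K, forall n i w, `|deviation n i w| <= K.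
Proof.
have [M MP] := stock_bounded; have [K KP] := innovation_bounded M.
have [K' K'P] := base_innovation_bounded s.
exists (`|K| + `|K'|) => n i w; rewrite /deviation; case: ifP => lin; last first.
  by rewrite normr0 addr_ge0.
have [h1 h2] := MP n i w.
apply: le_trans (ler_normB _ _) _; apply: lerD; last exact: le_trans (ler_norm K').
by apply: le_trans (ler_norm K); apply: KP => //; [exact: (h1 (ltnW lin))|exact: h2].
Qed.

(** The stock is raised to a value between the level and [s], now and in the period
    before. *)
Lemma deviation_small : exists2 K, 0 <= K & forall n i w, (i.+2 < n)%N ->
  `|deviation n i.+1 w| <= K * ((s - S (n - i)) + (s - S (n - i.+1))).
Proof.
have [K K0 KP] := innovation_lip; exists K => // n i w lin.
rewrite /deviation ltnW//; apply: le_trans (KP _ _ _ _ _ _ (Y01 _ _)) _.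
rewrite ler_wpM2l//.
have h1 := raised_le w (ltnW lin); have h2 := raised_le w lin.
rewrite /= -/(raised n i w) (_ : raised n i w - E i w - (s - E i w) = raised n i w - s);
  last by ring.
move: h1 h2; move: (raised n i w) (raised n i.+1 w) => r1 r2 /andP[h1 h2] /andP[h3 h4].
by rewrite !ler0_norm ?subr_le0//; lra.
Qed.

(** The deviations are orthogonal, so their squares add up. With [k] periods to go a
    deviation is at most a multiple of [(s - S k.+1) + (s - S k)], which is small on
    average over the horizon. *)
Lemma deviation_sum_small eta : 0 < eta ->
  \forall n \near \oo, norm2 P (fun w => \sum_(i < n) deviation n i w)
    <= eta * Num.sqrt n%:R.
Proof.
move=> eta0; have [Ke KeP] := deviation_bounded; have [K K0 KP] := deviation_small.
(* a bound for the deviation with [k] periods to go *)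
pose r (k : nat) : R := if k is k'.+1 then
  if (1 < k)%N then K * ((s - S k.+1) + (s - S k)) else Ke else Ke.
have r0 : (r k.+1) ^+ 2 @[k --> \oo] --> 0.
  rewrite -[0 in X in _ --> X](expr0n _ 2).
  apply: (@cvg_comp _ _ _ (fun k => r k.+1) (fun z => z ^+ 2)); last exact: sqr_continuous.
  apply: (@cvg_trans _ ((fun k => K * ((s - S k.+2) + (s - S k.+1))) @ \oo)).
    by apply: near_eq_cvg; exists 1%N => // k /= k1; rewrite /r ltnS k1.
  rewrite (_ : 0 = K * ((s - s) + (s - s))); last by ring.
  have S1 : S k.+1 @[k --> \oo] --> s by rewrite (cvg_shiftS S).
  have S2 : S k.+2 @[k --> \oo] --> s by rewrite (cvg_shiftS (fun k => S k.+1)).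
  apply: cvgM; first exact: cvg_cst.
  by apply: cvgD; apply: cvgB => //; exact: cvg_cst.
have [N _ NP] := cesaro_small (Ke ^+ 2) r0 (exprn_gt0 2 eta0).
exists N => // n nN.
have h : Ke ^+ 2 + \sum_(k < n) r k.+1 ^+ 2 <= eta ^+ 2 * n%:R := NP n nN.
rewrite /=.
rewrite -[eta]ger0_norm ?(ltW eta0)// -sqrtr_sqr -sqrtrM ?sqr_ge0//.
rewrite ler_wsqrtr// (mean_sum_sqr_orthogonal n (deviation_rv n) (@deviation_orthogonal n)).
apply: le_trans h.
have sq (A B : R) : `|A| <= B -> A ^+ 2 <= B ^+ 2.
  by move=> AB; rewrite -[leLHS]real_normK ?num_real// ler_pXn2r// nnegrE (le_trans _ AB).
have bd i (B : R) : (forall w, `|deviation n i w| <= B) ->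
    \int[P]_w (deviation n i w ^+ 2) <= B ^+ 2.
  move=> dB; rewrite -[leRHS](mean_cst P); apply: le_mean => [||w]; last exact: sq.
    by apply: bounded_rvM; exact: deviation_rv.
  exact: bounded_rv_cst.
case: n {nN} bd => [|n] bd; first by rewrite !big_ord0 addr0 sqr_ge0.
(* the first period has no predecessor and is bounded apart *)
rewrite big_ord_recl; apply: lerD; first by apply: bd => w; exact: KeP.
rewrite [leRHS](reindex_inj rev_ord_inj)/= big_ord_recl/=.
apply: ler_wpDl; first exact: sqr_ge0.
apply: ler_sum => i _; apply: bd => w; rewrite /r subSS /bump /= add1n.
case: ifP => [lin|_]; last exact: KeP.
have := KP n.+1 i w; rewrite !subSS.
have nn : (i < n)%N := ltn_ord i.
have -> : (n - i.+1).+1 = (n - i)%N by lia.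
rewrite subSn; last exact: ltnW.
by move=> h1; apply: h1; move: lin; lia.
Qed.

(** The error consists of the sum of the deviations and of the centered remainder,
    which is bounded. *)
Lemma process_cost_approximation eta : 0 < eta ->
  \forall n \near \oo, norm2 P (fun w => process_cost n w
      - \int[P]_w' process_cost n w' - \sum_(i < n) base_innovation s i w)
    <= eta * Num.sqrt n%:R.
Proof.
move=> eta0; have eta2 : 0 < eta / 2 by rewrite divr_gt0.
have [B BP] := remainder_bounded.
have b0 : 0 <= B by apply: le_trans (normr_ge0 _) (BP 0%N (point : T)).
have [N1 _ N1P] := deviation_sum_small eta2.
pose N2 := (Num.truncn ((2 * B / (eta / 2)) ^+ 2)).+1.
exists (maxn N1 N2) => // n /=; rewrite geq_max => /andP[n1 n2].
have be : bounded_rv (fun w => \sum_(i < n) deviation n i w).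
  by apply: bounded_rv_sum => i _; exact: deviation_rv.
have brn := remainder_rv n.
have bst : bounded_rv (fun w => \sum_(i < n) step_innovation n i w).
  by apply: bounded_rv_sum => i _; exact: step_innovation_rv.
have meanE : \int[P]_w' process_cost n w' =
    n%:R * (c * mu + J s) + \int[P]_w' remainder n w'.
  rewrite (eq_mean P (process_costE n)) meanD//; last first.
    by apply: bounded_rvD => //; exact: bounded_rv_cst.
  rewrite mean_sum => [|i _]; last exact: step_innovation_rv.
  rewrite big1 => [|i _]; last first.
    rewrite -[RHS](@step_innovation_centered n i (fun=> 1))//.
      by apply: eq_mean => w; rewrite mul1r.
    exact: bounded_rv_cst.
  by rewrite add0r meanD ?mean_cst//; exact: bounded_rv_cst.
have -> : (fun w => process_cost n w - \int[P]_w' process_cost n w'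
      - \sum_(i < n) base_innovation s i w) =
    (fun w => \sum_(i < n) deviation n i w + (remainder n w - \int[P]_w' remainder n w')).
  apply/funext => w; rewrite meanE process_costE.
  rewrite [\sum_(i < n) deviation n i w](eq_bigr (fun i : 'I_n =>
    step_innovation n i w - base_innovation s i w)) => [|i _]; last first.
    by rewrite /deviation ltn_ord.
  rewrite sumrB; move: (\sum_(i < n) _) (\sum_(i < n) _) => a1 a2.
  by move: (remainder n w) (\int[P]_w' _) => a3 a4; ring.
apply: le_trans (norm2_triangle P be (bounded_rvB brn (@bounded_rv_cst _ T R _))) _.
have r2 : norm2 P (fun w => remainder n w - \int[P]_w' remainder n w') <= B + B.
  apply: norm2_le => [|w]; first exact: bounded_rvB.
  by apply: le_trans (ler_normB _ _) _; apply: lerD => //; exact: norm_mean_le.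
have sn : B + B <= eta / 2 * Num.sqrt n%:R.
  rewrite mulrC -ler_pdivrMr// (_ : B + B = 2 * B); last by ring.
  rewrite -[leLHS]ger0_norm; last by rewrite divr_ge0 ?mulr_ge0// ltW.
  rewrite -sqrtr_sqr ler_wsqrtr//; apply: ltW.
  by apply: lt_le_trans (truncnS_gt _) _; rewrite ler_nat.
have := N1P n n1; move=> /= h1; lra.
Qed.

(** The centered cost inherits the normal limit of the sum of base innovations,
    whose norm grows like the square root of the horizon. *)
Lemma process_cost_ramp t delta :
  0 < \int[P]_w (demand_effect s (E 0%N w) - \int[P]_w demand_effect s (E 0%N w)) ^+ 2 ->
  0 < delta ->
  let U n := fun w => process_cost n w - \int[P]_w' process_cost n w' in
  \int[P]_w ramp t delta (U n w / norm2 P (U n)) @[n --> \oo] --> ramp_mean t delta.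
Proof.
set v := \int[P]_w _ => v0 d0 U.
have [Lr Lr0 rL] := ramp_lip t d0.
have cvgS := base_sum_ramp (s := s) (t := t) d0 v0.
pose Sd n := local_sum n (base_innovation s).
rewrite (_ : (fun n => \int[P]_w ramp t delta (U n w / norm2 P (U n))) =
   (fun n => (\int[P]_w ramp t delta (U n w / norm2 P (U n)) -
     \int[P]_w ramp t delta ((norm2 P (Sd n))^-1 * Sd n w)) +
     \int[P]_w ramp t delta ((norm2 P (Sd n))^-1 * Sd n w))); last first.
  by apply/funext => n; rewrite subrK.
rewrite -[ramp_mean _ _]add0r; apply: cvgD; last exact: cvgS.
apply/cvgrPdist_le => /= eps eps0.
have v2 : 0 < v / 2 by rewrite divr_gt0.
have sv0 : 0 < Num.sqrt (v / 2) by rewrite sqrtr_gt0.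
(* one bound makes the normalization error small, the other keeps the norm of the
   perturbed sum positive *)
pose eta := Num.min (eps / (2 * Lr + 1)) (1 / 2) * Num.sqrt (v / 2).
have L1 : 0 < 2 * Lr + 1 by rewrite ltr_wpDl// mulr_ge0.
have eta0 : 0 < eta by rewrite mulr_gt0// lt_min divr_gt0//= divr_gt0.
have [N _ NP] := process_cost_approximation eta0.
exists (maxn N 2) => // n /=; rewrite geq_max => /andP[Nn n2].
have n0 : 0 < n%:R :> R by rewrite ltr0n; exact: ltnW.
have V0 : n%:R * (v / 2) <= norm2 P (Sd n) ^+ 2 by exact: base_sum_norm2_ge.
have SV : Num.sqrt n%:R * Num.sqrt (v / 2) <= norm2 P (Sd n).
  rewrite -sqrtrM ?ler0n// -[leRHS]ger0_norm ?norm2_ge0// -sqrtr_sqr.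
  exact: ler_wsqrtr.
have sn0 : 0 < Num.sqrt n%:R :> R by rewrite sqrtr_gt0.
have S0 : 0 < norm2 P (Sd n) by apply: lt_le_trans SV; exact: mulr_gt0.
pose Q := fun w => U n w - Sd n w.
have bS : bounded_rv (Sd n) by apply: bounded_rv_sum => i _; exact: base_innovation_rv.
have bU : bounded_rv (U n).
  by apply: bounded_rvB; [exact: process_cost_rv|exact: bounded_rv_cst].
have bQ : bounded_rv Q by exact: bounded_rvB.
have Qle : norm2 P Q <= Num.min (eps / (2 * Lr + 1)) (1 / 2) * norm2 P (Sd n).
  apply: le_trans (NP n Nn) _; rewrite /eta -mulrA ler_wpM2l//.
    by rewrite le_min !divr_ge0// ltW.
  by rewrite mulrC.
have UE : U n = (fun w => Sd n w + Q w) by apply/funext => w; rewrite /Q addrC subrK.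
have Q1 : norm2 P Q <= eps / (2 * Lr + 1) * norm2 P (Sd n).
  by apply: le_trans Qle _; rewrite ler_wpM2r ?norm2_ge0// ge_min lexx.
have Q2 : norm2 P Q <= 1 / 2 * norm2 P (Sd n).
  by apply: le_trans Qle _; rewrite ler_wpM2r ?norm2_ge0// ge_min lexx orbT.
have U0 : 0 < norm2 P (fun w => Sd n w + Q w).
  have := norm2_diff P bS bQ; rewrite ler_norml => /andP[h _].
  by move: h Q2 S0; move: (norm2 P _) (norm2 P Q) (norm2 P (Sd n)) => n1 n3 n4; lra.
have close : `|\int[P]_w ramp t delta (U n w / norm2 P (U n)) -
    \int[P]_w ramp t delta ((norm2 P (Sd n))^-1 * Sd n w)|
    <= 2 * Lr * (norm2 P Q / norm2 P (Sd n)).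
  rewrite UE; exact: normalization_close bS bQ (ramp_lip t d0) rL S0 U0.
rewrite sub0r normrN; apply: le_trans close _.
have Q3 : norm2 P Q / norm2 P (Sd n) <= eps / (2 * Lr + 1) by rewrite ler_pdivrMr.
apply: le_trans (_ : 2 * Lr * (eps / (2 * Lr + 1)) <= _).
  by rewrite ler_wpM2l// mulr_ge0.
rewrite mulrA ler_pdivrMr// mulrC ler_wpM2l ?(ltW eps0)//; lra.
Qed.

End Policy.
End Innovation.

(** * Laws and almost sure equality *)

Section AlmostSure.
Context {d : measure_display} {T : measurableType d} {R : realType}.
Variable P : probability T R.

Lemma ae_eq_mean (f g : T -> R) : measurable_fun [set: T] f ->
  measurable_fun [set: T] g -> {ae P, forall w, f w = g w} ->
  \int[P]_w f w = \int[P]_w g w.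
Proof.
move=> mf mg fg; rewrite /Rintegral; congr fine.
apply: ae_eq_integral => //; [exact/measurable_EFinP..|].
by apply: filterS fg => w /= -> _.
Qed.

Lemma standardized_ae (Z Z' : T -> R) : measurable_fun [set: T] Z -> bounded_rv Z' ->
  {ae P, forall w, Z w = Z' w} ->
  let U := fun w => Z' w - \int[P]_w Z' w in
  {ae P, forall w, standardized P Z w = U w / norm2 P U}.
Proof.
move=> mZ bZ' ZZ' U; have mZ' : measurable_fun [set: T] Z' by case: bZ'.
have EZ : fine 'E_P[Z] = \int[P]_w Z' w by rewrite unlock; exact: ae_eq_mean.
have VZ : fine 'V_P[Z] = \int[P]_w (U w ^+ 2).
  rewrite /variance unlock EZ unlock.
  apply: (@ae_eq_mean (fun w => (Z w - \int[P]_w Z' w) * (Z w - \int[P]_w Z' w))).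
  - by apply: measurable_funM; apply: measurable_funB.
  - by apply: measurable_funM; apply: measurable_funB.
  - by apply: filterS ZZ' => w /= ->.
by apply: filterS ZZ' => w ZZ; rewrite /standardized EZ VZ ZZ.
Qed.

Lemma measurable_standardized (Z : T -> R) : measurable_fun [set: T] Z ->
  measurable_fun [set: T] (standardized P Z).
Proof. by move=> mZ; apply: measurable_funM => //; exact: measurable_funB. Qed.

Lemma mutually_independent_comp (I : choiceType) (X : I -> T -> R) (g : I -> R -> R) :
  mutually_independent P X -> (forall i, measurable_fun [set: R] (g i)) ->
  mutually_independent P (fun i w => g i (X i w)).
Proof.
move=> indX mg J B uJ mB; apply: (indX J (fun i => g i @^-1` B i)) => // i.
by rewrite -[X in measurable X]setTI; exact: mg.
Qed.

Lemma density_ae_support (X : {RV P >-> R}) f b : has_density X f ->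
  (forall z, ~ (0 <= z <= b) -> f z = 0) -> {ae P, forall w, 0 <= X w <= b}.
Proof.
move=> [_ Xf] f0; have mI : measurable `[0, b]%classic by exact: measurable_itv.
exists (X @^-1` (~` `[0, b]%classic)); split.
- by rewrite -[X in measurable X]setTI; apply: measurable_funP => //; exact: measurableC.
- have := Xf _ (measurableC mI); rewrite /distribution/= /pushforward => ->.
  by apply: integral0_eq => z /= zb; rewrite f0// => z0b; apply: zb.
- by move=> w /= Xw Xb; apply: Xw; move: Xb; rewrite in_itv/=.
Qed.

Lemma density_atomless (X : {RV P >-> R}) f z : has_density X f ->
  P (X @^-1` [set z]) = 0%E.
Proof.
by move=> [_ Xf]; have := Xf _ (measurable_set1 z); rewrite integral_set1.
Qed.

Lemma same_density_mean (X X' : {RV P >-> R}) f (g : R -> R) : has_density X f ->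
  has_density X' f -> bounded_rv g -> \int[P]_w g (X w) = \int[P]_w g (X' w).
Proof.
move=> [_ Xf] [_ X'f] [mg [K gK]]; rewrite /Rintegral; congr fine.
have mg' : measurable_fun [set: R] (EFin \o g) by exact/measurable_EFinP.
have bi (Z : {RV P >-> R}) : P.-integrable [set: T] ((EFin \o g) \o Z).
  have mgZ : measurable_fun [set: T] (g \o Z) by exact: measurableT_comp.
  by apply: (@bounded_rv_integrable _ _ _ P (g \o Z)); split=> //; exists K => w; exact: gK.
rewrite -[LHS](integral_distribution mg' (bi X)) -[RHS](integral_distribution mg' (bi X')).
apply: eq_measure_integral => B mB _; exact: etrans (Xf B mB) (esym (X'f B mB)).
Qed.

Lemma bernoulli_mean (Y : {RV P >-> bool}) q : 0 <= q <= 1 ->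
  (forall B, distribution P Y B = bernoulli_prob q B) -> \int[P]_w (Y w)%:R = q.
Proof.
move=> q01 Yq; rewrite /Rintegral.
rewrite (_ : \int[P]_w _ = \int[distribution P Y]_z (z%:R : R)%:E)%E; last first.
  by rewrite ge0_integral_distribution// => z; rewrite lee_fin.
rewrite (eq_measure_integral (bernoulli_prob q)); last by move=> B _ _; exact: Yq.
by rewrite integral_bernoulli_prob//= mulr1 mulr0 addr0.
Qed.

End AlmostSure.

(** * Nondegeneracy *)

Section NonDegenerate.
Context {d : measure_display} {T : measurableType d} {R : realType}.
Variables (P : probability T R) (X : T -> R) (b c : R) (A : R -> R).
Hypothesis mX : measurable_fun [set: T] X.
Hypothesis X0b : forall w, 0 <= X w <= b.
Hypothesis atomless : forall z, P (X @^-1` [set z]) = 0%E.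
Hypotheses (lA : lip A) (cA : convex A) (c0 : 0 < c).
Local Notation C := (\int[P]_w A (X w)).
Hypothesis drift : forall t, 0 <= t -> C + c * t <= \int[P]_w A (X w + t).

(** If [A (X w)] were almost surely constant, then by convexity [A] would stay below
    this constant up to the essential supremum of [X], and a small shift of [X]
    could not raise the average of [A (X w)] at a linear rate. *)
Lemma convex_variance_gt0 : 0 < \int[P]_w ((A (X w) - C) ^+ 2).
Proof.
set v := \int[P]_w _; have v0 : 0 <= v by apply: mean_ge0 => w; exact: sqr_ge0.
rewrite lt_def v0 andbT; apply/negP => /eqP v_eq0.
have bX : bounded_rv X.
  by split=> //; exists b => w; have /andP[? ?] := X0b w; rewrite ger0_norm.
have bA : bounded_rv (fun w => A (X w)) by exact: bounded_rv_comp.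
have bAC : bounded_rv (fun w => A (X w) - C).
  by apply: bounded_rvB => //; exact: bounded_rv_cst.
have bv : bounded_rv (fun w => (A (X w) - C) ^+ 2) by exact: bounded_rvM.
have [M [mM PM offM]] : exists M, [/\ measurable M, P M = 0%E &
    forall w, ~ M w -> A (X w) = C].
  have mf : measurable_fun [set: T] (fun w => ((A (X w) - C) ^+ 2)%:E).
    by apply/measurable_EFinP; have [] := bv.
  have : ae_eq P setT (fun w => ((A (X w) - C) ^+ 2)%:E) (cst 0%E).
    apply/(ae_eq_integral_abs P measurableT mf).
    under eq_integral do rewrite gee0_abs ?lee_fin ?sqr_ge0//.
    rewrite -[LHS]fineK; last exact: integrable_fin_num (bounded_rv_integrable P bv).
    by rewrite -/(Rintegral _ _ _) -/v v_eq0.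
  move=> [M [mM PM sM]]; exists M; split=> // w Mw.
  apply/eqP; rewrite -subr_eq0 -sqrf_eq0; apply/eqP.
  by apply: contrapT => h; apply: Mw; apply: sM => /= /(_ I) [].
have [w0 Mw0] : exists w, ~ M w.
  apply: contrapT => h; have MT : M = setT.
    by apply/seteqP; split=> // w _; apply: contrapT => Mw; apply: h; exists w.
  by move: PM; rewrite MT probability_setT => /eqP; rewrite onee_eq0.
pose beta := sup [set X w | w in ~` M].
have supM : has_sup [set X w | w in ~` M].
  split; first by exists (X w0), w0.
  by exists b => _ [w _ <-]; have /andP[] := X0b w.
have Xbeta w : ~ M w -> X w <= beta.
  by move=> Mw; apply: sup_upper_bound => //; exists w.
have [K K0 AK] := lA.
(* [A] equals [C] at [X w] and at some value of [X] beyond [X w + t] *)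
have stay w t : ~ M w -> 0 <= t -> X w + t < beta -> A (X w + t) <= C.
  move=> Mw t0 Xt.
  have e0 : 0 < beta - (X w + t) by rewrite subr_gt0.
  have [_ [w' Mw' <-]] := sup_adherent e0 supM.
  rewrite -/beta subKr => Xw'.
  have := @cA (X w) (X w + t) (X w'); rewrite lerDl t0 (ltW Xw') => /(_ isT).
  rewrite (offM w Mw) (offM w' Mw') -mulrDl subrKA ler_pM2l//.
  by rewrite subr_gt0; apply: le_lt_trans Xw'; rewrite lerDl.
(* off [H n] a shift by [n.+1%:R^-1] stays below [beta] *)
pose H n := M `|` [set w | beta - n.+1%:R^-1 <= X w].
have mge z : measurable [set w | z <= X w].
  rewrite (_ : [set w | _] = X @^-1` `[z, +oo[%classic).
    by rewrite -[X in measurable X]setTI; exact: mX.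
  by apply/seteqP; split=> w /=; rewrite in_itv/= andbT.
have mH n : measurable (H n) by exact: measurableU.
have PH n : c <= K * fine (P (H n)).
  pose t : R := n.+1%:R^-1; have t0 : 0 < t by rewrite invr_gt0.
  have bAt : bounded_rv (fun w => A (X w + t)).
    apply: bounded_rv_comp => //; apply: bounded_rvD => //; exact: bounded_rv_cst.
  have bI : bounded_rv (fun w => K * t * \1_(H n) w).
    apply: bounded_rvZ; split; first exact: measurable_indic.
    by exists 1 => w; rewrite indicE ger0_norm// lern1 leq_b1.
  have : \int[P]_w A (X w + t) <= \int[P]_w (A (X w) + K * t * \1_(H n) w).
    apply: le_mean => //; first exact: bounded_rvD.
    move=> w; rewrite indicE; case: (boolP (w \in H n)) => [_|].
      rewrite mulr1; have := AK (X w + t) (X w).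
      by rewrite addrAC subrr add0r (gtr0_norm t0) ler_norml => /andP[_]; lra.
    rewrite notin_setE mulr0 addr0 => /not_orP[Mw /negP]; rewrite -ltNge => Xt.
    rewrite (offM w Mw); apply: stay => //; first exact: ltW.
    by rewrite -ltrBrDr.
  rewrite meanD// meanZ; last first.
    split; first exact: measurable_indic.
    by exists 1 => w; rewrite indicE ger0_norm// lern1 leq_b1.
  rewrite [\int[P]_w \1_(H n) w](_ : _ = fine (P (H n))); last first.
    by rewrite /Rintegral integral_indic// setIT.
  move=> /(le_trans (drift (ltW t0))); rewrite lerD2l.
  by rewrite mulrAC ler_pM2r.
have Hcvg : P (H n) @[n --> \oo] --> P (\bigcap_n H n).
  apply: nonincreasing_cvg_mu => //.
  - by rewrite (le_lt_trans (probability_le1 P (mH 0%N)))// ltry.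
  - exact: bigcap_measurable.
  move=> i j ij; apply/subsetPset => w [Mw|/= Xw]; [by left|right=> /=].
  by apply: le_trans Xw; rewrite lerD2l lerN2 lef_pV2 ?posrE// ler_nat.
have PH0 : P (\bigcap_n H n) = 0%E.
  have sub : \bigcap_n H n `<=` M `|` X @^-1` [set beta].
    move=> w Hw; have [Mw|Mw] := pselect (M w); [by left|right=> /=].
    apply/eqP; rewrite eq_le Xbeta//=; apply/ler_addgt0Pr => e e0.
    near \oo => n; have ne : n.+1%:R^-1 < e by near: n; exact: near_infty_natSinv_lt (PosNum e0).
    by case: (Hw n I) => //= h; rewrite -lerBlDr (le_trans _ h)// lerD2l lerN2 ltW.
  have mXb : measurable (X @^-1` [set beta]) by rewrite -[X in measurable X]setTI; exact: mX.
  apply/eqP; rewrite eq_le measure_ge0 andbT.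
  apply: (@le_trans _ _ (P (M `|` X @^-1` [set beta]))).
    apply: le_measure; rewrite ?inE//; first exact: bigcap_measurable.
    exact: measurableU.
  apply: le_trans (measureU2 P mM mXb) _.
  by rewrite [X in (X + _ <= _)%E]PM [X in (_ + X <= _)%E]atomless adde0.
rewrite PH0 in Hcvg; move/fine_cvgP : Hcvg => [_ Hcvg].
have cK : 0 < c / (K + 1) by rewrite divr_gt0//; lra.
near \oo => n.
have : `|0 - fine (P (H n))| < c / (K + 1).
  by near: n; exact: (cvgr_dist_lt _ _ Hcvg _ cK).
rewrite sub0r normrN ger0_norm; last exact: fine_ge0.
rewrite ltr_pdivlMr; last lra.
have := PH n; have : 0 <= fine (P (H n)) by exact: fine_ge0.
by move: (fine _) => x; lra.
Unshelve. all: by end_near. Qed.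

End NonDegenerate.

Section NonDegeneracy.
Context {d : measure_display} {T : measurableType d} {R : realType}.
Variables (P : probability T R) (X : T -> R) (b c ch cp q s : R).
Hypothesis mX : measurable_fun [set: T] X.
Hypothesis X0b : forall w, 0 <= X w <= b.
Hypotheses (c0 : 0 < c) (ch0 : 0 < ch) (ccp : c < cp) (q01 : 0 <= q <= 1).
Hypothesis sJ : least_min (stage_cost P X ch cp q) s.
Hypothesis atomless : forall z, P (X @^-1` [set z]) = 0%E.
Local Notation L := (carrying_cost ch cp).
Local Notation l := (mean_cost P X ch cp).
Local Notation l2 := (mean_cost2 P X ch cp).
Local Notation A := (demand_effect c q L l s).

(** Adding [t] to the demand costs [c * t] and acts on the holding costs as lowering
    [s] by [t]. By the choice of [s] this lowers neither the stage cost nor [l2],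
    whence the linear rate that [convex_variance_gt0] asks for. *)
Lemma demand_effect_variance_gt0 :
  0 < \int[P]_w (A (X w) - \int[P]_w A (X w)) ^+ 2.
Proof.
have cp0 : 0 < cp by exact: lt_trans ccp.
have /andP[q0 q1] := q01; have p0 : 0 <= 1 - q by rewrite subr_ge0.
have lL : lip L by exact: carrying_cost_lip.
have ll : lip l by exact: (mean_cost_lip P mX X0b c0 ch0 ccp).
have shift t : \int[P]_w A (X w + t) =
    c * (\int[P]_w X w + t) + q * l (s - t) + 2 * (1 - q) * l2 (s - t).
  have bX : bounded_rv X := bounded_demand mX X0b.
  have bf (f : R -> R) : lip f -> bounded_rv (fun w => f (s - t - X w)).
    move=> lf; apply: bounded_rv_comp => //; apply: bounded_rvB => //.
    exact: bounded_rv_cst.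
  have b1 : bounded_rv (fun w => c * X w + c * t).
    by apply: bounded_rvD; [exact: bounded_rvZ|exact: bounded_rv_cst].
  have b2 : bounded_rv (fun w => q * L (s - t - X w)) by apply: bounded_rvZ; exact: bf.
  have b3 : bounded_rv (fun w => 2 * (1 - q) * l (s - t - X w)).
    by apply: bounded_rvZ; exact: bf.
  have b12 := bounded_rvD b1 b2.
  rewrite (eq_mean P (g := fun w => c * X w + c * t + q * L (s - t - X w) +
    2 * (1 - q) * l (s - t - X w))); last first.
    move=> w; rewrite /demand_effect (_ : s - (X w + t) = s - t - X w); last by ring.
    by rewrite mulrDr.
  rewrite meanD// meanD// meanD//; last 2 first.
  - exact: bounded_rvZ.
  - exact: bounded_rv_cst.
  rewrite mean_cst meanZ// meanZ; last exact: bf.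
  rewrite meanZ; last exact: bf.
  by rewrite [c * (_ + t)]mulrDr.
have mean0 : \int[P]_w A (X w) = c * \int[P]_w X w + q * l s + 2 * (1 - q) * l2 s.
  rewrite (eq_mean P (g := fun w => A (X w + 0))); last by move=> w; rewrite addr0.
  by rewrite shift addr0 subr0.
apply: (convex_variance_gt0 mX X0b atomless _ _ c0).
- apply: lipD; first apply: lipD; first exact: lip_scale.
  + by apply: lipZ; exact: lip_flip.
  + by apply: lipZ; exact: lip_flip.
- apply: convexD; first apply: convexD; first exact: convex_scale.
  + by apply: convexZ => //; apply: convex_opp_shift; exact: carrying_cost_convex.
  + apply: convexZ; first exact: mulr_ge0.
    apply: convex_opp_shift; exact: (mean_cost_convex P mX X0b c0 ch0 ccp).
- move=> t t0; rewrite shift mean0.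
  have [Js _] := sJ; have := Js (s - t); rewrite /stage_cost.
  have := ler_wpM2l p0 (mean_cost2_left mX X0b c0 ch0 ccp q01 sJ t0).
  move: (l s) (l2 s) (l (s - t)) (l2 (s - t)) (\int[P]_w X w) => x1 x2 x3 x4 x5.
  lra.
Qed.

End NonDegeneracy.

(** * The normal limit of the total cost *)

Section CostProcess.
Context {d : measure_display} {T : measurableType d} {R : realType}.
Variables (P : probability T R) (D : nat -> T -> R) (Y : nat -> T -> bool).
Variables (c ch cp q x : R).
Hypothesis mD : forall i, measurable_fun [set: T] (D i).
Hypothesis mY : forall i, measurable_fun [set: T] (Y i).
Hypothesis up_lip : forall k, (0 < k)%N -> lip (order_up_to P D c ch cp q k).
Hypothesis lL : lip (carrying_cost ch cp).

Lemma measurable_inventory n i : (i <= n)%N ->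
  measurable_fun [set: T] (inventory P D c ch cp q x n i).
Proof.
elim: i => [|i IHi] lin; first exact: measurable_cst.
apply: measurable_funB => //; apply: measurableT_comp; last by apply: IHi; exact: ltnW.
by apply: lip_measurable; apply: up_lip; rewrite subn_gt0.
Qed.

Lemma measurable_total_cost n :
  measurable_fun [set: T] (total_cost P D Y c ch cp q x n).
Proof.
apply: measurable_sum => i; rewrite /period_cost.
have mx : measurable_fun [set: T] (inventory P D c ch cp q x n i).
  by apply: measurable_inventory; exact: ltnW.
have my : measurable_fun [set: T]
    (fun w => order_up_to P D c ch cp q (n - i) (inventory P D c ch cp q x n i w)).
  apply: measurableT_comp => //.
  by apply: lip_measurable; apply: up_lip; rewrite subn_gt0.
have mYR : measurable_fun [set: T] (fun w => (Y i w)%:R : R).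
  exact: (measurableT_comp (f := fun z : bool => z%:R : R)).
have mL (f : T -> R) : measurable_fun [set: T] f ->
    measurable_fun [set: T] (fun w => carrying_cost ch cp (f w - D i w)).
  move=> mf; apply: measurableT_comp; first exact: lip_measurable.
  exact: measurable_funB.
apply: measurable_funD; first apply: measurable_funD.
- by apply: measurable_funM => //; exact: measurable_funB.
- by apply: measurable_funM => //; exact: mL.
- by apply: measurable_funM; [exact: measurable_funB|exact: mL].
Qed.

Lemma total_costE (E : nat -> T -> R) n w : (forall i, D i w = E i w) ->
  total_cost P D Y c ch cp q x n w = process_cost E (fun i w => (Y i w)%:R) c
    (carrying_cost ch cp) (order_up_to P D c ch cp q) x n w.
Proof.
move=> DE; have sE i : inventory P D c ch cp q x n i w =
    stock E (order_up_to P D c ch cp q) x n i w.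
  by elim: i => [//|i IHi] /=; rewrite IHi DE.
by apply: eq_bigr => i _; rewrite /period_cost /raised DE sE.
Qed.

End CostProcess.

Section Clamp.
Context {R : realType}.

(** The demands lie in [0, b] only almost surely; clamped, they do so surely, and the
    costs change on a null set. *)
Definition clamp (b z : R) : R := Num.max (Num.min z b) 0.

Lemma clamp_ge0_le b z : 0 <= b -> 0 <= clamp b z <= b.
Proof. by move=> b0; rewrite le_max lexx orbT ge_max b0 ge_min lexx orbT. Qed.

Lemma clamp_id b z : 0 <= z <= b -> clamp b z = z.
Proof. by move=> /andP[z0 zb]; rewrite /clamp min_l// max_l. Qed.

Lemma clamp_measurable b : measurable_fun [set: R] (clamp b).
Proof.
by apply: measurable_maxr; [apply: measurable_minr; [exact: measurable_id|]|];
  exact: measurable_cst.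
Qed.

End Clamp.

Section Normality.
Context {d : measure_display} {T : measurableType d} {R : realType}.
Variables (P : probability T R) (D E : nat -> T -> R) (Y : nat -> T -> bool).
Variables (b c ch cp q x : R).
Hypotheses (c0 : 0 < c) (ch0 : 0 < ch) (ccp : c < cp) (q01 : 0 <= q <= 1).
Hypothesis mD : forall i, measurable_fun [set: T] (D i).
Hypothesis mE : forall i, measurable_fun [set: T] (E i).
Hypothesis mY : forall i, measurable_fun [set: T] (Y i).
Hypothesis E0b : forall i w, 0 <= E i w <= b.
Hypothesis DE : {ae P, forall w, forall i, D i w = E i w}.
Hypothesis indep : mutually_independent P (variable E (fun i w => (Y i w)%:R)).
Hypothesis same_law : forall i (f : R -> R), continuous f ->
  \int[P]_w f (E i w) = \int[P]_w f (E 0%N w).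
Hypothesis delivery : forall i, \int[P]_w (Y i w)%:R = q.
Hypothesis atomless : forall z, P (E 0%N @^-1` [set z]) = 0%E.
Hypothesis x_le : x <= limit_level P D c ch cp q.

Local Notation up := (order_up_to P D c ch cp q).
Local Notation S := (base_stock_level P D c ch cp q).
Local Notation J := (stage_cost P (E 0%N) ch cp q).
Local Notation L := (carrying_cost ch cp).

Lemma total_cost_normal : cvg_in_distribution P
  (fun n => standardized P (total_cost P D Y c ch cp q x n)) (normal_prob 0 1).
Proof.
pose X := E 0%N; have mX : measurable_fun [set: T] X by exact: mE.
have X0b : forall w, 0 <= X w <= b by exact: E0b.
have DX : {ae P, forall w, D 0%N w = X w} by apply: filterS DE => w.
have [s sJ] := least_min_exists (stage_cost_lip P mX X0b q c0 ch0 ccp)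
  (stage_cost_coercive P mX X0b c0 ch0 ccp q01).
have xs : x <= s by move: x_le; rewrite (limit_levelE (D := D) mX X0b c0 ch0 ccp q01 (mD 0%N) DX sJ).
have upE k y : up k.+2 y = Num.max y (S k.+2).
  by have [_ ->] := base_stock_levelP (D := D) mX X0b c0 ch0 ccp q01 (mD 0%N) DX k.
have [up1 _] := last_period (D := D) mX X0b c0 ch0 ccp q01 (mD 0%N) DX.
have S_le := base_stock_level_le (D := D) mX X0b c0 ch0 ccp q01 (mD 0%N) DX sJ.
have S_cvg : S n @[n --> \oo] --> s :=
  base_stock_level_cvg (D := D) mX X0b c0 ch0 ccp q01 (mD 0%N) DX sJ.
have gap := stage_cost_gap_summable (D := D) mX X0b c0 ch0 ccp q01 (mD 0%N) DX sJ.
have Jmin y : J s <= J y by case: sJ => /(_ y).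
have Jdec y z : y <= z <= s -> J z <= J y.
  apply: (convex_le_min _ Jmin).
  exact: (stage_cost_convex P mX X0b c0 ch0 ccp q01).
have lL : lip L by apply: carrying_cost_lip => //; exact: lt_trans ccp.
have ll := mean_cost_lip P mX X0b c0 ch0 ccp.
have ll2 := mean_cost2_lip P mX X0b c0 ch0 ccp.
have v0 := demand_effect_variance_gt0 mX X0b c0 ch0 ccp q01 sJ atomless.
have mYR i : measurable_fun [set: T] (fun w => (Y i w)%:R : R).
  exact: (measurableT_comp (f := fun z : bool => z%:R : R)).
have Y01 i w : 0 <= ((Y i w)%:R : R) <= 1 by case: (Y i w); rewrite ?lexx ?ler01.
have ramps t delta (d0 : 0 < delta) := process_cost_ramp mE mYR E0b Y01 q01 indep
  same_law delivery lL ll ll2 erefl (fun=> erefl) (fun=> erefl) upE up1 S_le S_cvg Jmin Jdec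
  gap xs (t := t) v0 d0.
have uplip k : (0 < k)%N -> lip (up k) := up_lip upE up1 (k := k).
have bC n := process_cost_rv c mE mYR E0b Y01 lL x upE up1 n.
have mC n : measurable_fun [set: T] (total_cost P D Y c ch cp q x n).
  exact: measurable_total_cost.
have CE n : {ae P, forall w, total_cost P D Y c ch cp q x n w =
    process_cost E (fun i w => (Y i w)%:R) c L up x n w}.
  by apply: filterS DE => w DEw; exact: total_costE.
apply: cvg_in_distribution_ramp => [n|t delta d0].
  exact: measurable_standardized.
pose C n := process_cost E (fun i w => (Y i w)%:R) c L up x n.
pose U n := fun w => C n w - \int[P]_w' C n w'.
rewrite (_ : (fun n => \int[P]_w _) =
  (fun n => \int[P]_w ramp t delta (U n w / norm2 P (U n)))); first exact: ramps.
apply/funext => n; apply: ae_eq_mean.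
- apply: measurableT_comp; last exact: measurable_standardized.
  by apply: lip_measurable; exact: ramp_lip.
- apply: measurableT_comp; first by apply: lip_measurable; exact: ramp_lip.
  apply: measurable_funM => //; apply: measurable_funB => //.
  by case: (bC n).
- by apply: filterS (standardized_ae (mC n) (bC n) (CE n)) => w ->.
Qed.

End Normality.

Theorem theorem1 (R : realType) (d : measure_display) (T : measurableType d)
    (P : probability T R) (D : nat -> {RV P >-> R}) (Y : nat -> {RV P >-> bool})
    (psi : R -> R) (c ch cp q x : R)
    (c_gt0 : 0 < c) (ch_gt0 : 0 < ch) (c_lt_cp : c < cp) (q01 : 0 <= q <= 1)
    (psi_support : bounded_support_ge0 psi)
    (D_density : forall i, has_density (D i) psi)
    (Y_bernoulli : forall i (B : set bool),
      distribution P (Y i) B = bernoulli_prob q B)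
    (DY_independent : mutually_independent P
      (fun j : nat + nat => match j with
                            | inl i => fun w => D i w
                            | inr i => fun w => (Y i w)%:R
                            end))
    (psi_unimodal : softly_unimodal psi)
    (x_range : 0 <= x <= limit_level P D c ch cp q) :
  cvg_in_distribution P
    (fun n => standardized P (total_cost P D Y c ch cp q x n))
    (normal_prob 0 1).
Proof.
have [a [b1 [a0 psi0]]] := psi_support.
pose b := Num.max b1 0.
have b0 : 0 <= b by rewrite le_max lexx orbT.
have supp z : ~ (0 <= z <= b) -> psi z = 0.
  move=> zb; apply: psi0 => /andP[az zb1]; apply: zb.
  by rewrite (le_trans a0 az) le_max zb1.
pose E i w := clamp b (D i w).
have mD i : measurable_fun [set: T] (D i) by exact: measurable_funP.
have mY i : measurable_fun [set: T] (Y i) by exact: measurable_funP.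
have mE i : measurable_fun [set: T] (E i).
  by apply: measurableT_comp => //; exact: clamp_measurable.
have DE : {ae P, forall w, forall i, D i w = E i w}.
  apply: ae_foralln => i.
  by apply: filterS (density_ae_support (D_density i) supp) => w Db; rewrite /E clamp_id.
have indep : mutually_independent P (variable E (fun i w => (Y i w)%:R)).
  pose g (j : nat + nat) : R -> R := if j is inl _ then clamp b else id.
  have mg j : measurable_fun [set: R] (g j).
    by case: j => i; [exact: clamp_measurable|exact: measurable_id].
  have := mutually_independent_comp DY_independent mg.
  by congr (mutually_independent _ _); apply/funext => -[].
have same_law i (f : R -> R) : continuous f ->
    \int[P]_w f (E i w) = \int[P]_w f (E 0%N w).
  move=> cf; apply: (same_density_mean (g := f \o clamp b) (D_density i) (D_density 0%N)).
  split; first by apply: measurableT_comp; [exact: continuous_measurable_fun|exact: clamp_measurable].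
  have [K fK] := continuous_bounded b cf; exists K => z /=; apply: fK.
  by have /andP[z0 zb] := clamp_ge0_le z b0; rewrite zb (le_trans _ z0)// oppr_le0.
have atomless z : P (E 0%N @^-1` [set z]) = 0%E.
  have mA (f : T -> R) : measurable_fun [set: T] f -> measurable (f @^-1` [set z]).
    by move=> mf; rewrite -[X in measurable X]setTI; exact: mf.
  apply/(negligibleP _ (mA _ (mE 0%N))).
  have D0 := density_atomless z (D_density 0%N).
  move/(negligibleP _ (mA _ (mD 0%N))) in D0.
  apply: negligibleS (negligibleU DE D0) => w /= Ez.
  have [DEw|nDE] := pselect (forall i, D i w = E i w); last by left.
  by right; rewrite /= DEw.
apply: (total_cost_normal c_gt0 ch_gt0 c_lt_cp q01 mD mE mY (b := b) _ DE indep same_law _ atomless).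
- by move=> i w; exact: clamp_ge0_le.
- by move=> i; exact: bernoulli_mean.
- by case/andP: x_range.
Qed.
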